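(* Let $S\subseteq\{1,\dots,n\}$, let $x\in\mathbb{R}^n$ or $\mathbb{C}^n$ be supported on $S$ and satisfy the random sign assumption, and let $A$ be the random sensing matrix of the setting with parameter $\Theta(S,F)$. Let $y=Ax$. Then for every $0<\varepsilon<1$, if $$m\ge 82\,\Theta(S,F)\,\ln^2\!\left(\tfrac{6n}{\varepsilon}\right),$$ then with probability at least $1-\varepsilon$, $x$ is the unique minimizer of (BP).
   Context: Setting: Let $n,m\ge 1$. For $\ell=1,\dots,m$ let $F_\ell$ be a probability distribution on $\mathbb{C}^{p_\ell\times n}$ ($p_\ell\ge1$), $F=(F_\ell)_{\ell=1}^m$, let $B_1,\dots,B_m$ be independent random matrices with $B_\ell\sim F_\ell$, and $A=\frac{1}{\sqrt m}\begin{pmatrix}B_1\\ \vdots\\ B_m\end{pmatrix}$. Isotropy is assumed: $\mathbb{E}(A^*A)=\frac1m\sum_{\ell=1}^m\mathbb{E}(B_\ell^*B_\ell)=\mathrm{Id}_n$. For $S\subseteq\{1,\dots,n\}$, $P_S$ is the restriction $P_Sx=x_S$ and $M_S:=MP_S^*$; $B_{\ell,S}=B_\ell P_S^*$. $\|M\|_{p\to q}=\sup_{\|v\|_p\le1}\|Mv\|_q$; in particular $\|M\|_{\infty\to\infty}$ is the maximal $\ell^1$ norm of a row of $M$. $\Theta(S,F)$ denotes any positive real number such that almost surely $\|B_\ell^*B_{\ell,S}\|_{\infty\to\infty}\le\Theta(S,F)$ for all $\ell$. Random sign assumption: the vector $(x_i/|x_i|)_{i\in S}$ is a Rademacher sequence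 (independent uniform $\pm1$ entries) if $x$ is real, or a Steinhaus sequence (independent entries uniform on the complex unit circle) if $x$ is complex, independent of $A$. (BP) is the problem $\min_{z\in\mathbb{C}^n}\|z\|_1$ subject to $Az=y$. *)

(* Defs.v *)
From HB Require Import structures.
From mathcomp Require Import all_boot all_order all_algebra.
From mathcomp Require Import all_classical all_reals all_analysis.
From mathcomp Require Import complex.
Set Implicit Arguments.
Unset Strict Implicit.
Unset Printing Implicit Defensive.
Import Order.TTheory GRing.Theory Num.Theory.
Import numFieldNormedType.Exports.
Local Open Scope classical_set_scope.
Local Open Scope ring_scope.

Section LinAlg.
Context {R : realType}.
Local Notation C := R[i].

Definition cabs (z : C) : R := ComplexField.Normc.normc z.
Definition csgn (z : C) : C := if z == 0 then 0 else z / Complex (cabs z) 0.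
Definition l1norm n (z : 'cV[C]_n) : R := \sum_(i < n) cabs (z i 0).
Definition mx_adj p q (M : 'M[C]_(p, q)) : 'M[C]_(q, p) := (map_mx conjc M)^T.
Definition norm_inf_inf p q (M : 'M[C]_(p, q)) : R :=
  \big[Num.max/0]_(i < p) \sum_(j < q) cabs (M i j).
Definition restr_mx n (S : {set 'I_n}) : 'M[C]_(#|S|, n) :=
  \matrix_(k < #|S|, j < n) (j == enum_val k)%:R.
Definition colS p n (S : {set 'I_n}) (M : 'M[C]_(p, n)) : 'M[C]_(p, #|S|) :=
  M *m mx_adj (restr_mx S).
Definition BP_unique_minimizer M n (A : 'M[C]_(M, n)) (x : 'cV[C]_n) : Prop :=
  forall z : 'cV[C]_n, A *m z = A *m x -> z <> x -> l1norm x < l1norm z.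
End LinAlg.

Section Prob.
Context {R : realType} {d : measure_display} {Omega : measurableType d}.
Variable P : probability Omega R.
Local Notation C := R[i].

Definition prb (E : set Omega) : R := fine (P E).
Definition Rexpect (f : Omega -> R) : R := fine (\int[P]_w (f w)%:E).
Definition Rintegrable (f : Omega -> R) : Prop := P.-integrable setT (EFin \o f).
Definition Cmeasurable (f : Omega -> C) : Prop :=
  measurable_fun setT (fun w => complex.Re (f w)) /\ measurable_fun setT (fun w => complex.Im (f w)).
Definition Cintegrable (f : Omega -> C) : Prop :=
  Rintegrable (fun w => complex.Re (f w)) /\ Rintegrable (fun w => complex.Im (f w)).
Definition Cexpect (f : Omega -> C) : C :=
  Complex (Rexpect (fun w => complex.Re (f w))) (Rexpect (fun w => complex.Im (f w))).
Definition mx_measurable p q (X : Omega -> 'M[C]_(p, q)) : Prop :=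
  forall i j, Cmeasurable (fun w => X w i j).
Definition Emx p q (X : Omega -> 'M[C]_(p, q)) : 'M[C]_(p, q) :=
  \matrix_(i, j) Cexpect (fun w => X w i j).

Definition gen_sigma (fs : set (Omega -> R)) : set (set Omega) :=
  smallest (sigma_algebra setT)
    [set E | exists f B, [/\ fs f, measurable B & E = f @^-1` B]].
Definition Ccoords (f : Omega -> C) : set (Omega -> R) :=
  [set fun w => complex.Re (f w); fun w => complex.Im (f w)].
Definition sigma_mx p q (X : Omega -> 'M[C]_(p, q)) : set (set Omega) :=
  gen_sigma (\bigcup_(ij in [set: 'I_p * 'I_q]) Ccoords (fun w => X w ij.1 ij.2)).

Definition indep (G1 G2 : set (set Omega)) : Prop :=
  forall E1 E2, G1 E1 -> G2 E2 -> prb (E1 `&` E2) = prb E1 * prb E2.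
Definition mutual_indep m (G : 'I_m -> set (set Omega)) : Prop :=
  forall E : 'I_m -> set Omega, (forall l, G l (E l)) ->
    prb (\bigcap_(l in [set: 'I_m]) E l) = \prod_(l < m) prb (E l).

Definition rademacher n (S : {set 'I_n}) (s : Omega -> 'I_n -> C) : Prop :=
  forall e : 'I_n -> bool,
    prb [set w | forall i, i \in S -> s w i = (-1) ^+ e i] = (2^-1) ^+ #|S|.
Definition steinhaus n (S : {set 'I_n}) (s : Omega -> 'I_n -> C) : Prop :=
  forall a b : 'I_n -> R, (forall i, 0 <= a i <= b i /\ b i <= 2 * pi) ->
    prb [set w | forall i, i \in S ->
                 exists2 t, a i <= t <= b i & s w i = Complex (cos t) (sin t)]
    = \prod_(i in S) ((b i - a i) / (2 * pi)).
End Prob.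

(* Main.v *)
Require Import Defs.
From HB Require Import structures.
From mathcomp Require Import all_boot all_order all_algebra.
From mathcomp Require Import all_classical all_reals all_analysis.
From mathcomp Require Import complex.
From mathcomp Require Import measurable_realfun.
From mathcomp Require Import ring lra zify.
Import Order.TTheory GRing.Theory Num.Theory.
Import numFieldNormedType.Exports.
Local Open Scope classical_set_scope.
Local Open Scope ring_scope.

(* By Fuchs' condition it suffices that the Gram matrix [A_S^* A_S] is invertible and
   that the dual certificate [A^* A_S (A_S^* A_S)^-1 sgn(x_S)] has modulus less than 1
   off [S].  After truncation the rows of the summands [B_l^* B_{l,S}] are bounded
   everywhere, so by Schur's test each [B_{l,S}^* B_{l,S}] has operator norm at most
   [Theta], and three events have to be controlled, each at cost [2 n exp (- L)] with
   [L = ln (6 n / eps)].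
   - [A_S^* A_S] is far from the identity: the moments [E tr Y^{2p}] of the deviation
     [Y] are bounded through the recursion obtained by exchanging one summand with an
     independent copy, followed by Markov's inequality.
   - A column [A_S^* a_j] is long: it is a sum of independent centred bounded vectors,
     and Pinelis' [cosh] supermartingale bounds its tail.
   - The certificate is large at [j]: conditionally on [A] it is a sum of random signs
     with small coefficients.  The signs are first rounded to a finite grid that is
     invariant under [z |-> - z], and the tail follows by averaging [cosh] over flips. *)

Set Implicit Arguments.
Unset Strict Implicit.
Unset Printing Implicit Defensive.

(** * Trace inequalities for the Frobenius product *)

Section Frobenius.
Context {R : realFieldType}.

(** Complex matrices are turned into real ones of twice the size, and operator norms are always read
    off quadratic forms or traces of powers. The doubling gives the factor 2 in the cost of the Gram
    matrix; for the columns and the signs it comes from [cosh t >= exp t / 2], and [n] from the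
    union over [j]. Conditioning on [A] is replaced by a finite average: once the signs are rounded,
    a conditional probability is a proportion of grid points, bounded at each outcome and then
    integrated. Isotropy holds only on average over [l], so a single summand need not have mean
    proportional to the identity; hence the exchange of one summand with a copy, and the separate
    centring of each column term. On the good event the deviation has norm at most 1/2,
    [|A_S^* a_j|^2] is at most [9 / (100 L)], and the coefficients [(A_S^* A_S)^-1 A_S^* a_j] have
    square norm at most [2 / (5 L)]. The rounded certificate stays below 9/10 and rounding costs at
    most 1/10; with parameter [2 L] the sign tail has exponent [4 L / 5 - 9 L / 5 = - L]. The
    constant 82 is set by the size bound on the column terms, which asks for [16 * 5 = 80]. *)

Definition fro {m n} (A B : 'M[R]_(m, n)) : R := \tr (A^T *m B).

Lemma froE m n (A B : 'M[R]_(m, n)) : fro A B = \sum_i \sum_j A i j * B i j.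
Proof.
rewrite /fro /mxtrace exchange_big /=; apply: eq_bigr => j _.
by rewrite !mxE; apply: eq_bigr => i _; rewrite !mxE.
Qed.

Lemma froC m n (A B : 'M[R]_(m, n)) : fro A B = fro B A.
Proof. by rewrite !froE; apply: eq_bigr => i _; apply: eq_bigr => j _; rewrite mulrC. Qed.

Lemma froDr m n (A B C : 'M[R]_(m, n)) : fro A (B + C) = fro A B + fro A C.
Proof. by rewrite /fro mulmxDr mxtraceD. Qed.

Lemma froDl m n (A B C : 'M[R]_(m, n)) : fro (A + B) C = fro A C + fro B C.
Proof. by rewrite !(froC _ C) froDr. Qed.

Lemma froZr m n a (A B : 'M[R]_(m, n)) : fro A (a *: B) = a * fro A B.
Proof. by rewrite /fro -scalemxAr mxtraceZ. Qed.

Lemma froZl m n a (A B : 'M[R]_(m, n)) : fro (a *: A) B = a * fro A B.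
Proof. by rewrite froC froZr froC. Qed.

Lemma froNr m n (A B : 'M[R]_(m, n)) : fro A (- B) = - fro A B.
Proof. by rewrite -scaleN1r froZr mulN1r. Qed.

Lemma froNl m n (A B : 'M[R]_(m, n)) : fro (- A) B = - fro A B.
Proof. by rewrite froC froNr froC. Qed.

Lemma fro_ge0 m n (A : 'M[R]_(m, n)) : 0 <= fro A A.
Proof. by rewrite froE; do 2 (apply: sumr_ge0 => ? _); rewrite -expr2 sqr_ge0. Qed.

Lemma fro_eq0 m n (A : 'M[R]_(m, n)) : fro A A = 0 -> A = 0.
Proof.
rewrite froE => /eqP; rewrite psumr_eq0; last first.
  by move=> i _; apply: sumr_ge0 => j _; rewrite -expr2 sqr_ge0.
move=> /allP h; apply/matrixP => i j; rewrite mxE.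
have := h i (mem_index_enum _); rewrite /= psumr_eq0; last first.
  by move=> k _; rewrite -expr2 sqr_ge0.
by move=> /allP /(_ j (mem_index_enum _)); rewrite /= mulf_eq0 orbb => /eqP.
Qed.

Lemma fro_mull m n k (A : 'M[R]_(m, k)) (B : 'M[R]_(k, n)) C :
  fro (A *m B) C = fro B (A^T *m C).
Proof. by rewrite /fro trmx_mul mulmxA. Qed.

Lemma fro_AMGM m n (A B : 'M[R]_(m, n)) : 2 * fro A B <= fro A A + fro B B.
Proof.
have := fro_ge0 (A - B).
rewrite froDl !froDr !froNl !froNr (froC B A); lra.
Qed.

Lemma fro_parallelogram_le m n (A B : 'M[R]_(m, n)) :
  fro (A - B) (A - B) <= 2 * fro A A + 2 * fro B B.
Proof.
have := fro_ge0 (A + B).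
rewrite !froDl !froDr !froNl !froNr (froC B A); lra.
Qed.

Lemma fro_CS m n (A B : 'M[R]_(m, n)) : fro A B ^+ 2 <= fro A A * fro B B.
Proof.
have [B0|B0] := eqVneq (fro B B) 0.
  by rewrite (fro_eq0 B0) /fro !mulmx0 mxtrace0 expr0n mulr0.
have Bp : 0 < fro B B by rewrite lt_def B0 fro_ge0.
have := fro_ge0 (fro B B *: A - fro A B *: B).
rewrite !froDl !froDr !froNl !froNr !froZl !froZr (froC B A) => h.
rewrite -subr_ge0 -(pmulr_rge0 _ Bp); apply: le_trans h _.
rewrite le_eqVlt; apply/orP; left; apply/eqP; ring.
Qed.

Lemma fro_mulmx_vec m n (A : 'M[R]_(m, n)) (u : 'cV[R]_n) :
  fro (A *m u) (A *m u) <= fro A A * fro u u.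
Proof.
have e k (v : 'cV[R]_k) : fro v v = \sum_i v i 0 * v i 0.
  by rewrite froE; apply: eq_bigr => i _; rewrite big_ord1.
rewrite [X in X <= _]e [X in X * _]froE mulr_suml; apply: ler_sum => i _.
have -> : (A *m u) i 0 = fro (row i A)^T u.
  by rewrite froE mxE; apply: eq_bigr => j _; rewrite big_ord1 !mxE.
rewrite -expr2; apply: le_trans (fro_CS _ _) _.
rewrite ler_wpM2r ?fro_ge0 // e; apply: ler_sum => j _.
by rewrite !mxE.
Qed.

Lemma trmxX n (A : 'M[R]_n) k : (A ^+ k)^T = (A^T) ^+ k.
Proof.
elim: k => [|k IH]; first by rewrite !expr0 trmx1.
by rewrite exprS exprSr -[in LHS]/(A *m A ^+ k) trmx_mul IH.
Qed.

Lemma fro_powers n (A B D : 'M[R]_n) i i' j j' :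
  A^T = A -> B^T = B -> D^T = D ->
  fro (A ^+ i *m D *m B ^+ j) (A ^+ i' *m D *m B ^+ j') =
  \tr (D *m A ^+ (i + i') *m D *m B ^+ (j + j')).
Proof.
move=> sA sB sD; rewrite /fro !trmx_mul !trmxX sA sB sD.
rewrite (addnC j) !exprD -!mulmxE -!mulmxA [LHS]mxtrace_mulC !mulmxA.
by [].
Qed.

(** The arithmetic-geometric inequality for [A^i D B^j] and [A^i' D B^j']: midpoint convexity of the
    mixed trace in its pair of exponents. *)
Lemma tr_powers_mid n (A B D : 'M[R]_n) i i' j j' :
  A^T = A -> B^T = B -> D^T = D ->
  2 * \tr (D *m A ^+ (i + i') *m D *m B ^+ (j + j')) <=
  \tr (D *m A ^+ (i + i) *m D *m B ^+ (j + j)) +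
  \tr (D *m A ^+ (i' + i') *m D *m B ^+ (j' + j')).
Proof.
by move=> sA sB sD; rewrite -!fro_powers //; apply: fro_AMGM.
Qed.

(** Telescoping that respects the order of the noncommuting factors. *)
Lemma subrXX_mx n (A B : 'M[R]_n) r :
  A ^+ r.+1 - B ^+ r.+1 = \sum_(q < r.+1) A ^+ q *m (A - B) *m B ^+ (r - q).
Proof.
elim: r => [|r IH].
  by rewrite big_ord1 subnn !expr0 !expr1 mul1mx mulmx1.
rewrite big_ord_recr /= subnn expr0 mulmx1.
rewrite (eq_bigr (fun q : 'I_r.+1 => A ^+ q *m (A - B) *m B ^+ (r - q) *m B)); last first.
  by move=> q _; rewrite subSn ?leq_ord // (exprSr B (r - q)) -mulmxE mulmxA.
rewrite -mulmx_suml -IH mulmxBr mulmxBl !mulmxE -!exprSr addrC.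
by rewrite addrA subrK.
Qed.

(* [k |-> |Y^k u|^2] is log-convex, so a first step growing by more than [delta^2] would
   make [|Y^p.+1 u|] exceed what the trace allows: no spectral theorem is needed. *)
Lemma power_contraction n (Y : 'M[R]_n) p (delta : R) (u : 'cV[R]_n) :
  Y^T = Y -> 0 < delta -> \tr (Y ^+ (p.+1 + p.+1)) <= delta ^+ (p.+1 + p.+1) ->
  fro (Y *m u) (Y *m u) <= delta ^+ 2 * fro u u.
Proof.
move=> sY d0 trY; set b := fun k => fro (Y ^+ k *m u) (Y ^+ k *m u).
rewrite leNgt; apply/negP => h.
have u0 : 0 < fro u u.
  rewrite lt_def fro_ge0 andbT; apply/eqP => /fro_eq0 u0.
  by move: h; rewrite u0 mulmx0 /fro !mulmx0 mxtrace0 mulr0 ltxx.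
have logc k : b k.+1 ^+ 2 <= b k * b k.+2.
  suff -> : b k.+1 = fro (Y ^+ k *m u) (Y ^+ k.+2 *m u) by apply: fro_CS.
  rewrite /b [X in fro (X *m _) _]exprS -mulmxE -mulmxA fro_mull sY (mulmxA Y).
  by rewrite mulmxE -exprS.
have H k : 0 < b k /\ delta ^+ 2 * b k < b k.+1.
  elim: k => [|k [bk IH]]; first by rewrite /b expr0 mul1mx expr1.
  have bk1 : 0 < b k.+1 by apply: le_lt_trans IH; rewrite mulr_ge0 ?sqr_ge0 // ltW.
  split=> //; have := logc k.
  have : delta ^+ 2 * b k * b k.+1 < b k.+1 ^+ 2 by rewrite expr2 ltr_pM2r.
  by move=> h1 h2; have := lt_le_trans h1 h2; rewrite mulrAC mulrC ltr_pM2l.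
have expr_dbl k : delta ^+ (k.+1 + k.+1) = delta ^+ 2 * delta ^+ (k + k).
  by rewrite -exprD addSn addnS.
have Hk k : delta ^+ (k + k) * b 0%N <= b k.
  elim: k => [|k IH]; first by rewrite expr0 mul1r.
  rewrite expr_dbl -mulrA; apply: le_trans (ltW (H k).2).
  by rewrite ler_pM2l ?exprn_gt0.
have := (H p).2; have := fro_mulmx_vec (Y ^+ p.+1) u.
have -> : fro (Y ^+ p.+1) (Y ^+ p.+1) = \tr (Y ^+ (p.+1 + p.+1)).
  by rewrite /fro trmxX sY mulmxE exprD.
rewrite -/(b p.+1) => h1 h2.
have h3 : delta ^+ (p.+1 + p.+1) * b 0%N < b p.+1.
  by apply: le_lt_trans h2; rewrite expr_dbl -mulrA ler_pM2l ?exprn_gt0.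
have := lt_le_trans h3 h1; rewrite /b expr0 mul1mx ltr_pM2r // ltNge.
by rewrite trY.
Qed.

Lemma convex_seq_max (e : nat -> R) P :
  (forall i, (i.+2 <= P)%N -> 2 * e i.+1 <= e i + e i.+2) ->
  forall i, (i <= P)%N -> e i <= Num.max (e 0%N) (e P).
Proof.
move=> cv.
(* The chord over [[0, i+1]] lies above the sequence at [i], so a bound at [i+1] and at 0 passes to
   [i]; the second induction descends from [P]. *)
have H i : (i.+1 <= P)%N -> i.+1%:R * e i <= i%:R * e i.+1 + e 0%N.
  elim: i => [|i IH] iP; first by rewrite mul1r mul0r add0r.
  have := IH (ltnW iP); have := cv i iP.
  rewrite -(ler_pM2l (ltr0Sn _ i)) => h1 h2.
  rewrite -(ltr_nat R) in iP.
  move: h1 h2; rewrite -!natr1; move: (i%:R) => x; nra.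
suff S k i : (i + k = P)%N -> e i <= Num.max (e 0%N) (e P).
  by move=> i iP; apply: (S (P - i)%N); rewrite subnKC.
elim: k i => [|k IH] i; first by rewrite addn0 => ->; rewrite le_max lexx orbT.
rewrite addnS -addSn => ik; have h := IH _ ik.
have iP : (i.+1 <= P)%N by rewrite -ik leq_addr.
have := H _ iP => h'.
rewrite -(ler_pM2l (ltr0Sn _ i)); apply: (le_trans h').
have h0 : e 0%N <= Num.max (e 0%N) (e P) by rewrite le_max lexx.
have : (0 : R) <= i%:R by []. rewrite -natr1.
by move: (i%:R) h0 h; move: (Num.max _ _) => M x; nra.
Qed.

End Frobenius.

(** * Bounded measurable functions and expectation *)

Section SubSigma.
Context {R : realType} {Omega : pointedType}.
Implicit Types (g : set (set Omega)) (f : Omega -> R).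

(** Measurability for the sigma-algebra generated by [g], as a predicate on functions: the same
    [Omega] then carries the ambient sigma-algebra and those of the single blocks. *)
Definition smeas g f : Prop :=
  measurable_fun [set: g_sigma_algebraType g] (f : g_sigma_algebraType g -> R).

(** The bound holds everywhere and not only almost surely. Such functions form an algebra and are
    integrable, so every polynomial in the matrix entries has an expectation; truncation serves to
    reach this class. *)
Definition bmeas g f : Prop := smeas g f /\ exists M : R, forall w, `|f w| <= M.

Lemma smeas_cst g (c : R) : smeas g (fun=> c).
Proof. exact: measurable_cst. Qed.

Lemma smeasD g f h : smeas g f -> smeas g h -> smeas g (fun w => f w + h w).
Proof. exact: measurable_funD. Qed.

Lemma smeasM g f h : smeas g f -> smeas g h -> smeas g (fun w => f w * h w).
Proof. exact: measurable_funM. Qed.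

Lemma smeasN g f : smeas g f -> smeas g (fun w => - f w).
Proof. exact: measurable_funN. Qed.

Lemma smeasB g f h : smeas g f -> smeas g h -> smeas g (fun w => f w - h w).
Proof. by move=> mf mh; apply: smeasD => //; apply: smeasN. Qed.

Lemma smeas_comp g f (k : R -> R) :
  measurable_fun setT k -> smeas g f -> smeas g (fun w => k (f w)).
Proof. by move=> mk mf; apply: (measurableT_comp mk). Qed.

Lemma smeasX g f n : smeas g f -> smeas g (fun w => f w ^+ n).
Proof. by move=> mf; apply: (smeas_comp (k := fun x => x ^+ n)) => //; exact: exprn_measurable. Qed.

Lemma smeas_sum g I (r : seq I) (Q : pred I) (F : I -> Omega -> R) :
  (forall i, Q i -> smeas g (F i)) -> smeas g (fun w => \sum_(i <- r | Q i) F i w).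
Proof.
move=> mF; elim: r => [|i r IH].
  by under [X in smeas _ X]funext do rewrite big_nil; apply: smeas_cst.
under [X in smeas _ X]funext do rewrite big_cons.
by case Qi: (Q i) => //; apply: smeasD => //; apply: mF.
Qed.

Lemma smeas_prod g I (r : seq I) (F : I -> Omega -> R) :
  (forall i, smeas g (F i)) -> smeas g (fun w => \prod_(i <- r) F i w).
Proof.
move=> mF; elim: r => [|i r IH].
  by under [X in smeas _ X]funext do rewrite big_nil; apply: smeas_cst.
by under [X in smeas _ X]funext do rewrite big_cons; apply: smeasM.
Qed.

Lemma smeas_indic g (A : set Omega) : <<s g >> A -> smeas g \1_A.
Proof. by move=> mA; apply: (@measurable_indic _ (g_sigma_algebraType g)). Qed.

Lemma smeas_preim g f (B : set R) : smeas g f -> measurable B -> <<s g >> (f @^-1` B).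
Proof. by move=> mf mB; have := mf measurableT _ mB; rewrite setTI. Qed.

Lemma smeas_ge g f (a : R) : smeas g f -> <<s g >> [set w | a <= f w].
Proof.
move=> mf; have := smeas_preim mf (measurable_itv `[a, +oo[).
by congr (<<s g >> _); apply/seteqP; split => w /=; rewrite in_itv /= andbT.
Qed.

Lemma smeas_le g f (a : R) : smeas g f -> <<s g >> [set w | f w <= a].
Proof.
move=> mf; have := smeas_preim mf (measurable_itv `]-oo, a]).
by congr (<<s g >> _); apply/seteqP; split => w /=; rewrite in_itv /=.
Qed.

Lemma smeas_mono g g' f : g `<=` <<s g' >> -> smeas g f -> smeas g' f.
Proof.
move=> gg' mf _ B mB; rewrite setTI.
have := smeas_preim mf mB; apply: smallest_sub => //.
exact: smallest_sigma_algebra.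
Qed.

(** Off 0 the inverse is [x] times a real power of [x ^+ 2]; at 0 both sides vanish by the
    convention [0^-1 = 0]. *)
Lemma measurable_inv : measurable_fun [set: R] (@GRing.inv R).
Proof.
have -> : @GRing.inv R = fun x : R => x * (x ^+ 2) `^ (-1).
  apply/funext => x; rewrite powR_inv1 ?sqr_ge0 //.
  have [->|x0] := eqVneq x 0; first by rewrite invr0 mul0r.
  by rewrite expr2 invfM mulrA divff // mul1r.
apply: measurable_funM => //.
apply: (measurableT_comp (f := fun x => x `^ (-1))); first exact: measurable_powR.
exact: exprn_measurable.
Qed.

Lemma smeas_inv g f : smeas g f -> smeas g (fun w => (f w)^-1).
Proof. by move=> mf; apply: (smeas_comp (k := @GRing.inv R)) => //; exact: measurable_inv. Qed.

Lemma smeas_sqrt g f : (forall w, 0 <= f w) -> smeas g f -> smeas g (fun w => Num.sqrt (f w)).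
Proof.
move=> f0 mf; have -> : (fun w => Num.sqrt (f w)) = fun w => f w `^ (2^-1).
  by apply/funext => w; rewrite powR12_sqrt.
by apply: (smeas_comp (k := fun x => x `^ (2^-1))) => //; exact: measurable_powR.
Qed.

Lemma bmeas_cst g (c : R) : bmeas g (fun=> c).
Proof. by split; [exact: smeas_cst|exists `|c|]. Qed.

Lemma bmeasD g f h : bmeas g f -> bmeas g h -> bmeas g (fun w => f w + h w).
Proof.
move=> [mf [M hM]] [mh [M' hM']]; split; first exact: smeasD.
exists (M + M') => w; apply: le_trans (ler_normD _ _) _; exact: lerD.
Qed.

Lemma bmeasM g f h : bmeas g f -> bmeas g h -> bmeas g (fun w => f w * h w).
Proof.
move=> [mf [M hM]] [mh [M' hM']]; split; first exact: smeasM.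
by exists (M * M') => w; rewrite normrM ler_pM.
Qed.

Lemma bmeasN g f : bmeas g f -> bmeas g (fun w => - f w).
Proof.
move=> [mf [M hM]]; split; first exact: smeasN.
by exists M => w; rewrite normrN.
Qed.

Lemma bmeasB g f h : bmeas g f -> bmeas g h -> bmeas g (fun w => f w - h w).
Proof. by move=> mf mh; apply: bmeasD => //; apply: bmeasN. Qed.

Lemma bmeas_sum g I (r : seq I) (Q : pred I) (F : I -> Omega -> R) :
  (forall i, Q i -> bmeas g (F i)) -> bmeas g (fun w => \sum_(i <- r | Q i) F i w).
Proof.
move=> mF; elim: r => [|i r IH].
  by under [X in bmeas _ X]funext do rewrite big_nil; apply: bmeas_cst.
under [X in bmeas _ X]funext do rewrite big_cons.
by case Qi: (Q i) => //; apply: bmeasD => //; apply: mF.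
Qed.

Lemma bmeas_indic g (A : set Omega) : <<s g >> A -> bmeas g \1_A.
Proof.
move=> mA; split; first exact: smeas_indic.
by exists 1 => w; rewrite indicE; case: (_ \in _); rewrite ?normr1 ?normr0.
Qed.

Lemma bmeas_mono g g' f : g `<=` <<s g' >> -> bmeas g f -> bmeas g' f.
Proof. by move=> gg' [mf bf]; split => //; apply: smeas_mono mf. Qed.

End SubSigma.

Section Expectation.
Context {R : realType} {d : measure_display} {Omega : measurableType d}.
Variable P : probability Omega R.
Implicit Types (f g : Omega -> R).
Local Notation "''E' f" := (Rexpect P f) (at level 10, f at level 9).
Local Notation Bm := (@bmeas R _ (@measurable d Omega)).

Lemma smeas_measurable (g : set (set Omega)) f :
  g `<=` measurable -> smeas g f -> measurable_fun setT f.
Proof.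
move=> gm mf _ B mB; rewrite setTI; have := smeas_preim mf mB.
apply: smallest_sub => //; exact: sigma_algebra_measurable.
Qed.

Lemma bmeas_integrable f : Bm f -> Rintegrable P f.
Proof.
move=> [mf [M hM]]; apply: measurable_bounded_integrable => //.
- by rewrite (le_lt_trans (probability_le1 _ _)) ?ltry.
- exact: smeas_measurable mf.
- exists M; split; first exact: num_real.
  by move=> M' MM' w _ /=; apply: le_trans (hM w) (ltW MM').
Qed.

Lemma RexpectD f g : Rintegrable P f -> Rintegrable P g ->
  'E (fun w => f w + g w) = 'E f + 'E g.
Proof. exact: RintegralD. Qed.

Lemma RexpectZ c f : Rintegrable P f -> 'E (fun w => c * f w) = c * 'E f.
Proof. exact: RintegralZl. Qed.

Lemma Rexpect_cst c : 'E (fun=> c) = c.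
Proof.
rewrite -[LHS]/(Rintegral P setT (fun=> c)) Rintegral_cst //.
have e : fine (P setT) = 1 by rewrite probability_setT.
by rewrite -[RHS]mulr1; congr (c * _); exact: e.
Qed.

Lemma Rexpect_ge0 f : (forall w, 0 <= f w) -> 0 <= 'E f.
Proof. by move=> h; apply: Rintegral_ge0. Qed.

Lemma RintegrableD f g : Rintegrable P f -> Rintegrable P g ->
  Rintegrable P (fun w => f w + g w).
Proof.
move=> hf hg; have := integrableD measurableT hf hg.
by apply: eq_integrable => // w _ /=; rewrite EFinD.
Qed.

Lemma RintegrableZ c f : Rintegrable P f -> Rintegrable P (fun w => c * f w).
Proof.
move=> hf; have := integrableZl measurableT c hf.
by apply: eq_integrable => // w _ /=; rewrite EFinM.
Qed.

Lemma RintegrableN f : Rintegrable P f -> Rintegrable P (fun w => - f w).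
Proof.
move=> hf; have := RintegrableZ (-1) hf.
by congr Rintegrable; apply/funext => w; rewrite mulN1r.
Qed.

Lemma RexpectN f : Rintegrable P f -> 'E (fun w => - f w) = - 'E f.
Proof.
move=> hf; rewrite -mulN1r -RexpectZ //; congr Rexpect.
by apply/funext => w; rewrite mulN1r.
Qed.

Lemma RexpectB f g : Rintegrable P f -> Rintegrable P g ->
  'E (fun w => f w - g w) = 'E f - 'E g.
Proof. exact: RintegralB. Qed.

Lemma le_Rexpect f g : Rintegrable P f -> Rintegrable P g ->
  (forall w, f w <= g w) -> 'E f <= 'E g.
Proof. by move=> hf hg h; apply: le_Rintegral. Qed.

Lemma Rintegrable_sum I (r : seq I) (Q : pred I) (F : I -> Omega -> R) :
  (forall i, Q i -> Rintegrable P (F i)) ->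
  Rintegrable P (fun w => \sum_(i <- r | Q i) F i w).
Proof.
move=> hF; elim: r => [|i r IH].
  under [X in Rintegrable _ X]funext do rewrite big_nil.
  exact/bmeas_integrable/bmeas_cst.
under [X in Rintegrable _ X]funext do rewrite big_cons.
by case Qi: (Q i) => //; apply: RintegrableD => //; apply: hF.
Qed.

Lemma Rexpect_sum I (r : seq I) (Q : pred I) (F : I -> Omega -> R) :
  (forall i, Q i -> Rintegrable P (F i)) ->
  'E (fun w => \sum_(i <- r | Q i) F i w) = \sum_(i <- r | Q i) 'E (F i).
Proof.
move=> hF; elim: r => [|i r IH].
  under [X in Rexpect _ X]funext do rewrite big_nil.
  by rewrite Rexpect_cst big_nil.
under [X in Rexpect _ X]funext do rewrite big_cons.
rewrite big_cons; case Qi: (Q i) => //.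
by rewrite RexpectD ?IH //; [exact: hF|exact: Rintegrable_sum].
Qed.

Lemma Rexpect_indic (A : set Omega) : measurable A -> 'E \1_A = prb P A.
Proof. by move=> mA; rewrite /Rexpect integral_indic // setIT. Qed.

Lemma norm_Rexpect_le f M : Bm f -> (forall w, `|f w| <= M) -> `|'E f| <= M.
Proof.
move=> bf h; have fi := bmeas_integrable bf.
have ci c : Rintegrable P (fun=> c) by exact/bmeas_integrable/bmeas_cst.
rewrite ler_norml -[X in _ <= _ <= X](Rexpect_cst M) -(Rexpect_cst (- M)).
by apply/andP; split; apply: le_Rexpect => // w; have := h w; rewrite ler_norml => /andP[].
Qed.

Lemma Rmarkov f (a : R) : Rintegrable P f -> (forall w, 0 <= f w) -> 0 < a ->
  measurable [set w | a <= f w] ->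
  prb P [set w | a <= f w] <= 'E f / a.
Proof.
move=> hf f0 a0 mA; rewrite ler_pdivlMr // mulrC -Rexpect_indic //.
have bi : Bm \1_[set w | a <= f w] by apply: bmeas_indic; exact: sub_sigma_algebra.
rewrite -RexpectZ; last exact: bmeas_integrable.
apply: le_Rexpect => //; first exact/RintegrableZ/bmeas_integrable.
move=> w; rewrite indicE; case: (boolP (w \in _)) => [|_]; last by rewrite mulr0.
by rewrite inE /= mulr1.
Qed.

Lemma prb_le (A B : set Omega) : measurable A -> measurable B -> A `<=` B -> prb P A <= prb P B.
Proof.
move=> mA mB AB; rewrite -!Rexpect_indic //.
have bi C : measurable C -> Rintegrable P (\1_C : Omega -> R).
  by move=> mC; apply: bmeas_integrable; apply: bmeas_indic; exact: sub_sigma_algebra.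
apply: le_Rexpect; [exact: bi|exact: bi|move=> w].
rewrite !indicE; case: (boolP (w \in A)) => [wA|_]; last by case: (w \in B).
by rewrite mem_set //; apply: AB; rewrite inE in wA.
Qed.

Lemma prb_ge0 (A : set Omega) : 0 <= prb P A.
Proof. exact: fine_ge0. Qed.

Lemma prb_setU_le (A B : set Omega) : measurable A -> measurable B ->
  prb P (A `|` B) <= prb P A + prb P B.
Proof.
move=> mA mB; rewrite -!Rexpect_indic //; last exact: measurableU.
have bi C : measurable C -> Rintegrable P (\1_C : Omega -> R).
  by move=> mC; apply: bmeas_integrable; apply: bmeas_indic; exact: sub_sigma_algebra.
rewrite -RexpectD; [|exact: bi|exact: bi]; apply: le_Rexpect; [exact/bi/measurableU|by apply: RintegrableD; apply: bi|].
move=> w; rewrite !indicE in_setU.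
by case: (w \in A); case: (w \in B); rewrite /= ?addr0 ?add0r // lerDl.
Qed.

Lemma prb_setC (A : set Omega) : measurable A -> prb P (~` A) = 1 - prb P A.
Proof.
move=> mA; rewrite -!Rexpect_indic //; last exact: measurableC.
rewrite -[X in X - _](Rexpect_cst 1) -RexpectB.
- by congr Rexpect; apply/funext => w; rewrite !indicE in_setC; case: (_ \in _); rewrite ?subrr ?subr0.
- exact/bmeas_integrable/bmeas_cst.
- by apply: bmeas_integrable; apply: bmeas_indic; exact: sub_sigma_algebra.
Qed.

Lemma prb_bigcup_le (I : finType) (A : I -> set Omega) : (forall i, measurable (A i)) ->
  prb P (\bigcup_i A i) <= \sum_i prb P (A i).
Proof.
move=> mA; under eq_bigr => i _ do rewrite -Rexpect_indic //.
have bi C : measurable C -> Rintegrable P (\1_C : Omega -> R).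
  by move=> mC; apply: bmeas_integrable; apply: bmeas_indic; exact: sub_sigma_algebra.
have mU : measurable (\bigcup_i A i) by apply: fin_bigcup_measurable.
rewrite -Rexpect_indic // -Rexpect_sum; last by move=> i _; apply: bi.
apply: le_Rexpect; [exact: bi|by apply: Rintegrable_sum => i _; apply: bi|].
move=> w; rewrite indicE; case: (boolP (w \in _)) => [|_]; last first.
  by apply: sumr_ge0 => i _; rewrite indicE.
rewrite inE => -[i _ Aiw]; rewrite (bigD1 i) //= indicE mem_set //.
by rewrite lerDl; apply: sumr_ge0 => j _; rewrite indicE.
Qed.

End Expectation.

(** * Product rule for expectations and grouping of independent sigma-algebras *)

Section Independence.
Context {R : realType} {d : measure_display} {Omega : measurableType d}.
Variable P : probability Omega R.
Implicit Types (f : Omega -> R) (g : set (set Omega)).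
Local Notation "''E' f" := (Rexpect P f) (at level 10, f at level 9).
Local Notation Bm := (@bmeas R _ (@measurable d Omega)).

(** The sum counts the integers from 1 to [N] that do not exceed [y], that is, it is the floor of
    [y]. It approximates a bounded function by indicators of its superlevel sets. *)
Lemma count_floor (N : nat) (y : R) : 0 <= y -> y <= N%:R ->
  `|y - \sum_(i < N) (i.+1%:R <= y)%R%:R| <= 1.
Proof.
have full n (z : R) : n%:R <= z -> \sum_(i < n) (i.+1%:R <= z)%R%:R = n%:R :> R.
  move=> nz; rewrite (eq_bigr (fun=> 1)) ?sumr_const ?card_ord // => i _.
  by rewrite (le_trans _ nz) // ler_nat.
move=> y0; elim: N => [|N IH] yN.
  by rewrite big_ord0 subr0 (le_anti (introT andP (conj yN y0))) normr0 ler01.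
have [h|h] := lerP N.+1%:R y.
  have -> : y = N.+1%:R by apply/le_anti; rewrite h yN.
  by rewrite full // subrr normr0.
rewrite big_ord_recr /= (leNgt N.+1%:R y) h addr0.
have [h'|h'] := lerP y N%:R; first exact: IH.
rewrite full ?(ltW h') // ger0_norm ?subr_ge0 ?(ltW h') //.
by move: h; rewrite -natr1; lra.
Qed.

(** The defect [D] is linear, vanishes on indicators of [<<s g >>] and is continuous for the
    supremum norm, while finite combinations of such indicators are uniformly dense. *)
Lemma Rexpect_mul_extend g f (k : Omega -> R) (c : R) : g `<=` measurable ->
  (forall A, <<s g >> A -> 'E (fun w => \1_A w * k w) = 'E \1_A * c) ->
  bmeas g f -> Bm k ->
  'E (fun w => f w * k w) = 'E f * c.
Proof.
move=> gm H bf bk; have [_ [K hK]] := bk; have [mf [M0 hM0]] := bf.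
pose M := Num.max M0 1; have M1 : 1 <= M by rewrite le_max lexx orbT.
have Mgt0 : 0 < M by apply: lt_le_trans M1.
have hM w : `|f w| <= M by rewrite le_max hM0.
have lift h : bmeas g h -> Bm h.
  by apply: bmeas_mono => A /gm /sub_sigma_algebra.
pose D (h : Omega -> R) := 'E (fun w => h w * k w) - 'E h * c.
have DD h1 h2 : bmeas g h1 -> bmeas g h2 -> D (fun w => h1 w + h2 w) = D h1 + D h2.
  move=> /lift b1 /lift b2; rewrite /D.
  under [X in Rexpect P X - _]funext do rewrite mulrDl.
  rewrite !RexpectD; first ring; apply: bmeas_integrable => //; exact: bmeasM.
have DZ a h : bmeas g h -> D (fun w => a * h w) = a * D h.
  move=> /lift b1; rewrite /D.
  under [X in Rexpect P X - _]funext do rewrite -mulrA.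
  rewrite !RexpectZ; first ring; apply: bmeas_integrable => //; exact: bmeasM.
have D1 A : <<s g >> A -> D \1_A = 0 by move=> gA; rewrite /D H // subrr.
have Dcst a : D (fun=> a) = 0.
  have -> : (fun=> a) = (fun w => a * (\1_(setT : set Omega) w : R)).
    by apply/funext => w; rewrite indicE in_setT mulr1.
  rewrite DZ; first by rewrite D1 ?mulr0 //; exact: (@measurableT _ (g_sigma_algebraType g)).
  by apply: bmeas_indic; exact: (@measurableT _ (g_sigma_algebraType g)).
have Dsum N (F : 'I_N -> Omega -> R) : (forall i, bmeas g (F i)) -> (forall i, D (F i) = 0) ->
    D (fun w => \sum_(i < N) F i w) = 0.
  elim: N F => [|N IH] F bF DF.
    by under [X in D X]funext do rewrite big_ord0; exact: Dcst.
  under [X in D X]funext do rewrite big_ord_recr.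
  rewrite DD //; last by apply: bmeas_sum.
  by rewrite DF addr0 IH.
have Dbound h (b : R) : bmeas g h -> (forall w, `|h w| <= b) -> `|D h| <= b * (K + `|c|).
  move=> bh hb; rewrite /D mulrDr (le_trans (ler_normB _ _)) // lerD //.
    by apply: norm_Rexpect_le => [|w]; [by apply: bmeasM => //; exact: lift|rewrite normrM ler_pM].
  by rewrite normrM ler_pM // (norm_Rexpect_le P (lift _ bh)).
(* Affine rescaling to [[0, 1]], where [FN N] below is the average of the indicators of
   [(i+1) / (N+1) <= F] and is within [1 / (N+1)] of [F]. *)
pose F w := (f w + M) / (2 * M).
have bF : bmeas g F.
  by apply: bmeasM; [apply: bmeasD => //; apply: bmeas_cst|apply: bmeas_cst].
have F01 w : 0 <= F w <= 1.
  have := hM w; rewrite ler_norml => /andP[h1 h2].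
  by rewrite divr_ge0 ?ler_pdivrMr /=; lra.
suff DF : D F = 0.
  apply/eqP; rewrite -subr_eq0 -/(D f).
  have -> : f = fun w => (2 * M) * F w + (- M).
    by apply/funext => w; rewrite /F mulrC divfK ?addrK //; lra.
  rewrite DD; [|by apply: bmeasM => //; exact: bmeas_cst|exact: bmeas_cst].
  by rewrite DZ // DF mulr0 Dcst addr0.
pose FN N w := \sum_(i < N.+1) N.+1%:R^-1 * (\1_[set w | i.+1%:R <= N.+1%:R * F w] w : R).
have mS N i : <<s g >> [set w | i.+1%:R <= N.+1%:R * F w].
  by apply: smeas_ge; apply: smeasM; [exact: smeas_cst|exact: bF.1].
have bFN N : bmeas g (FN N).
  by apply: bmeas_sum => i _; apply: bmeasM; [exact: bmeas_cst|exact: bmeas_indic].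
have DFN N : D (FN N) = 0.
  apply: Dsum => i; first by apply: bmeasM; [exact: bmeas_cst|exact: bmeas_indic].
  by rewrite DZ ?D1 ?mulr0 //; apply: bmeas_indic.
have DFe N : `|D F| <= N.+1%:R^-1 * (K + `|c|).
  have -> : D F = D (fun w => F w + (- 1) * FN N w).
    rewrite DD //; last by apply: bmeasM => //; exact: bmeas_cst.
    by rewrite DZ // DFN mulr0 addr0.
  apply: Dbound => [|w]; first by apply: bmeasD => //; apply: bmeasM => //; exact: bmeas_cst.
  have [F0 F1] := andP (F01 w).
  have Ngt0 : 0 < N.+1%:R :> R by [].
  have := @count_floor N.+1 (N.+1%:R * F w) (mulr_ge0 (ltW Ngt0) F0).
  rewrite ler_piMr // => /(_ isT) h.
  rewrite -(ler_pM2l Ngt0) mulfV ?gt_eqF // -[X in X * `|_|](gtr0_norm Ngt0) -normrM.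
  apply: le_trans h; rewrite mulN1r mulrBr /FN -mulr_sumr (mulrA _ N.+1%:R^-1) mulfV ?gt_eqF // mul1r.
  rewrite le_eqVlt; apply/orP; left; apply/eqP; congr `|_ - _|.
  apply: eq_bigr => i _; rewrite indicE; congr ((_ : bool)%:R).
  by apply/idP/idP; rewrite inE.
apply/eqP; rewrite -normr_eq0 eq_le normr_ge0 andbT leNgt; apply/negP => Dp.
have Kc : 0 < K + `|c|.
  have := lt_le_trans Dp (DFe 0%N); rewrite invr1 mul1r //.
have := DFe (Num.bound ((K + `|c|) / `|D F|)).
rewrite leNgt => /negP; apply; rewrite mulrC ltr_pdivrMr // mulrC -ltr_pdivrMr //.
by apply: lt_trans (archi_boundP (ltW (divr_gt0 Kc Dp))) _; rewrite ltr_nat.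
Qed.

(** The extension principle is used twice: it reduces [f] to an indicator with [k] fixed, then [k]
    to an indicator with that of [f] fixed. *)
Lemma Rexpect_mul_indep g1 g2 f (k : Omega -> R) : g1 `<=` measurable -> g2 `<=` measurable ->
  indep P <<s g1 >> <<s g2 >> -> bmeas g1 f -> bmeas g2 k ->
  'E (fun w => f w * k w) = 'E f * 'E k.
Proof.
move=> gm1 gm2 ind bf bk.
have s1 A : <<s g1 >> A -> measurable A.
  by apply: smallest_sub => //; exact: sigma_algebra_measurable.
have s2 A : <<s g2 >> A -> measurable A.
  by apply: smallest_sub => //; exact: sigma_algebra_measurable.
have lift g h : g `<=` measurable -> bmeas g h -> Bm h.
  by move=> gm; apply: bmeas_mono => A /gm /sub_sigma_algebra.
apply: (Rexpect_mul_extend (g := g1)) => // [A mA|]; last exact: lift bk.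
rewrite mulrC (_ : (fun w => _) = fun w => k w * \1_A w); last first.
  by apply/funext => w; rewrite mulrC.
apply: (Rexpect_mul_extend (g := g2)) => // [B mB|]; last first.
  by apply: bmeas_indic; apply: sub_sigma_algebra; exact: s1.
rewrite (_ : (fun w => _) = \1_(A `&` B)); last first.
  by apply/funext => w; rewrite !indicE in_setI mulrC; case: (w \in A); case: (w \in B);
   rewrite ?mulr0 ?mul0r ?mulr1.
rewrite !Rexpect_indic ?ind //; [by rewrite mulrC|exact: s1|exact: s2|].
by apply: measurableI; [exact: s1|exact: s2].
Qed.

(** Dynkin's argument: [Pi] is stable under intersection and generates the left sigma-algebra, and
    the sets [L] independent of the fixed [B] form a lambda-system. *)
Lemma mutual_indep_group m (G : 'I_m -> set (set Omega)) (l : 'I_m) :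
  (forall k, G k `<=` measurable) ->
  mutual_indep P (fun k => <<s G k >>) ->
  indep P <<s \bigcup_(k in [set k | k != l]) G k >> <<s G l >>.
Proof.
move=> Gm mi A B mA mB.
have sm k C : <<s G k >> C -> measurable C.
  by apply: smallest_sub; [exact: sigma_algebra_measurable|exact: Gm].
have sT k : <<s G k >> setT by exact: (@measurableT _ (g_sigma_algebraType (G k))).
(* Slot [l] is kept equal to the whole space, so that intersecting with [B] fills it and mutual
   independence applies to the result. *)
pose Pi := [set D | exists E : 'I_m -> set Omega,
   [/\ forall k, <<s G k >> (E k), E l = setT & D = \bigcap_(k in [set: 'I_m]) E k]].
pose L := [set D | measurable D /\ prb P (D `&` B) = prb P D * prb P B].
have Bm' := sm _ _ mB.
have fin C : measurable C -> P C \is a fin_num by move=> mC; exact: fin_num_measure.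
have Lfin C : measurable C -> (prb P (C `&` B) = prb P C * prb P B) <-> (P (C `&` B) = P C * P B)%E.
  move=> mC; rewrite /prb -fineM ?fin //; split => [h|-> //].
  by rewrite -[LHS]fineK ?h ?fineK ?fin_numM ?fin //; apply: measurableI.
have LL : L A; last by case: LL.
suff : <<s Pi >> `<=` L.
  apply; apply: smallest_sub mA; first exact: smallest_sigma_algebra.
  move=> C [k /= kl GC]; apply: sub_sigma_algebra.
  exists (fun j => if j == k then C else setT); split.
  - by move=> j; case: eqP => [->|_]; [exact: sub_sigma_algebra|exact: sT].
  - by rewrite eq_sym (negbTE kl).
  - apply/seteqP; split => [w Cw j _|w h]; first by case: eqP.
    by have := h k I; rewrite eqxx.
apply: lambda_system_subset => //.
- move=> C D [E [hE El ->]] [E' [hE' E'l ->]].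
  exists (fun k => E k `&` E' k); split.
  + by move=> k; exact: (@measurableI _ (g_sigma_algebraType (G k)) _ _ (hE k) (hE' k)).
  + by rewrite El E'l setIT.
  + by rewrite bigcapI.
- apply/dynkin_lambda_system; split.
  + by split => //; rewrite setTI /prb probability_setT mul1r.
  + move=> C [mC hC]; split; first exact: measurableC.
    have -> : ~` C `&` B = B `\` (C `&` B).
      by rewrite setDIr setDv setU0 setDE setIC.
    have mCB : measurable (C `&` B) by apply: measurableI.
    rewrite prb_setC // mulrBl mul1r -hC /prb measureD //.
    + rewrite setIA (setIC B) -setIA setIid fineB ?fin //.
    + by have := fin _ Bm'; rewrite ge0_fin_numE.
  + move=> F tF LF; have mF i : measurable (F i) by case: (LF i).
    split; first exact: bigcup_measurable.
    apply/Lfin; first exact: bigcup_measurable.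
    rewrite setI_bigcupl !measure_bigcup //; last 2 first.
    * by move=> i _; apply: measurableI.
    * by apply/trivIset_setIr.
    rewrite -[P B]fineK ?fin // muleC -nneseriesZl //.
    by apply: eq_eseriesr => i _; rewrite fineK ?fin // muleC; apply/Lfin; case: (LF i).
- move=> D [E [hE El ->]].
  have mE k : measurable (E k) by exact: sm (hE k).
  have fbm (E' : 'I_m -> set Omega) : (forall k, measurable (E' k)) -> measurable (\bigcap_(k in [set: 'I_m]) E' k).
    by move=> h; apply: fin_bigcap_measurable.
  split; first exact: fbm.
  pose E' k := if k == l then B else E k.
  have -> : \bigcap_(k in [set: 'I_m]) E k `&` B = \bigcap_(k in [set: 'I_m]) E' k.
    apply/seteqP; split => [w [h Bw] k _|w h]; first by rewrite /E'; case: eqP => // _; apply: h.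
    split=> [k _|]; last by have := h l I; rewrite /E' eqxx.
    by have := h k I; rewrite /E'; case: eqP => // ->; rewrite El.
  rewrite (mi E') ?(mi E) //; last by move=> k; rewrite /E'; case: eqP => // ->.
  rewrite (bigD1 l) //= [in RHS](bigD1 l) //= El /prb probability_setT mul1r.
  rewrite /E' eqxx mulrC; congr (_ * _); apply: eq_bigr => k kl.
  by rewrite (negbTE kl).
Qed.

End Independence.

(** * Exchangeable pairs *)

Section Tensors.
Context {R : realType} {d : measure_display} {Omega : measurableType d}.
Variable P : probability Omega R.
Variables (g1 g2 : set (set Omega)).
Hypotheses (gm1 : g1 `<=` measurable) (gm2 : g2 `<=` measurable).
Hypothesis ind12 : indep P <<s g1 >> <<s g2 >>.
Local Notation "''E' f" := (Rexpect P f) (at level 10, f at level 9).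
Local Notation Bm := (@bmeas R _ (@measurable d Omega)).
Local Notation fun3 := (Omega -> Omega -> Omega -> R).

(* [h u v w]: [v] carries the distinguished summand, [w] an independent copy of it and
   [u] everything else.  For finite sums of products the joint law of the three is
   expressed by [swapE] on [Omega] itself, with [u = v], so no product space is needed. *)
Inductive tens : fun3 -> Prop :=
| tens_prod f a b : bmeas g1 f -> bmeas g2 a -> bmeas g2 b ->
    tens (fun u v w => f u * a v * b w)
| tens_add h h' : tens h -> tens h' -> tens (fun u v w => h u v w + h' u v w).

Definition swapE (h : fun3) : R := 'E (fun w => 'E (fun u => h u u w)).

Lemma tens_ext (h h' : fun3) : tens h -> (forall u v w, h u v w = h' u v w) -> tens h'.
Proof.
by move=> th e; rewrite (_ : h' = h) //; apply/funext => u; apply/funext => v; apply/funext => w.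
Qed.

Lemma swapE_ext (h h' : fun3) : (forall u v w, h u v w = h' u v w) -> swapE h = swapE h'.
Proof.
by move=> e; rewrite (_ : h' = h) //; apply/funext => u; apply/funext => v; apply/funext => w.
Qed.

Lemma tens_cst c : tens (fun _ _ _ => c).
Proof.
apply: (tens_ext (tens_prod (bmeas_cst g1 c) (bmeas_cst g2 1) (bmeas_cst g2 1))) => u v w.
by rewrite !mulr1.
Qed.

Lemma tens_fst f : bmeas g1 f -> tens (fun u _ _ => f u).
Proof.
move=> bf; apply: (tens_ext (tens_prod bf (bmeas_cst g2 1) (bmeas_cst g2 1))) => u v w.
by rewrite !mulr1.
Qed.

Lemma tens_snd f : bmeas g2 f -> tens (fun _ v _ => f v).
Proof.
move=> bf; apply: (tens_ext (tens_prod (bmeas_cst g1 1) bf (bmeas_cst g2 1))) => u v w.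
by rewrite mulr1 mul1r.
Qed.

Lemma tens_thd f : bmeas g2 f -> tens (fun _ _ w => f w).
Proof.
move=> bf; apply: (tens_ext (tens_prod (bmeas_cst g1 1) (bmeas_cst g2 1) bf)) => u v w.
by rewrite !mul1r.
Qed.

Lemma tens_mul h h' : tens h -> tens h' -> tens (fun u v w => h u v w * h' u v w).
Proof.
move=> th th'; elim: th => {h} [f a b bf ba bb|h k _ IH _ IH']; last first.
  by apply: (tens_ext (tens_add IH IH')) => u v w; rewrite mulrDl.
elim: th' => {h'} [f' a' b' bf' ba' bb'|h k _ IH _ IH']; last first.
  by apply: (tens_ext (tens_add IH IH')) => u v w; rewrite mulrDr.
apply: (tens_ext (tens_prod (bmeasM bf bf') (bmeasM ba ba') (bmeasM bb bb'))) => u v w /=.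
ring.
Qed.

Lemma tens_opp h : tens h -> tens (fun u v w => - h u v w).
Proof.
by move=> th; apply: (tens_ext (tens_mul (tens_cst (-1)) th)) => u v w; rewrite mulN1r.
Qed.

Lemma tens_sum I (r : seq I) (Q : pred I) (F : I -> fun3) :
  (forall i, tens (F i)) -> tens (fun u v w => \sum_(i <- r | Q i) F i u v w).
Proof.
move=> tF; elim: r => [|i r IH].
  by apply: (tens_ext (tens_cst 0)) => u v w; rewrite big_nil.
case Qi: (Q i).
  by apply: (tens_ext (tens_add (tF i) IH)) => u v w; rewrite big_cons Qi.
by apply: (tens_ext IH) => u v w; rewrite big_cons Qi.
Qed.

Lemma tens_swap h : tens h -> tens (fun u v w => h u w v).
Proof.
elim=> {h} [f a b bf ba bb|h k _ IH _ IH'].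
  by apply: (tens_ext (tens_prod bf bb ba)) => u v w /=; ring.
exact: tens_add.
Qed.

Let lift g h : g `<=` measurable -> bmeas g h -> Bm h.
Proof. by move=> gm; apply: bmeas_mono => A /gm /sub_sigma_algebra. Qed.

Let E_prod f a b w : bmeas g1 f -> bmeas g2 a -> bmeas g2 b ->
  'E (fun u => f u * a u * b w) = 'E f * 'E a * b w.
Proof.
move=> bf ba bb; rewrite -(Rexpect_mul_indep gm1 gm2 ind12) // mulrC -RexpectZ.
  by congr Rexpect; apply/funext => u; rewrite mulrC.
by apply/bmeas_integrable/bmeasM; [exact: lift bf|exact: lift ba].
Qed.

Lemma tens_integrable h : tens h ->
  (forall w, Rintegrable P (fun u => h u u w)) /\
  Rintegrable P (fun w => 'E (fun u => h u u w)).
Proof.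
elim=> {h} [f a b bf ba bb|h k _ [IH1 IH2] _ [IH1' IH2']].
  split=> [w|].
    apply/bmeas_integrable/bmeasM; last exact: bmeas_cst.
    by apply: bmeasM; [exact: lift bf|exact: lift ba].
  rewrite (_ : (fun w => _) = fun w => 'E f * 'E a * b w).
    by apply/RintegrableZ/bmeas_integrable/(lift gm2).
  by apply/funext => w; rewrite E_prod.
split=> [w|]; first exact: RintegrableD.
rewrite (_ : (fun w => _) = fun w => 'E (fun u => h u u w) + 'E (fun u => k u u w)).
  exact: RintegrableD.
by apply/funext => w; rewrite RexpectD.
Qed.

Lemma swapED h k : tens h -> tens k ->
  swapE (fun u v w => h u v w + k u v w) = swapE h + swapE k.
Proof.
move=> /tens_integrable[h1 h2] /tens_integrable[k1 k2]; rewrite /swapE -RexpectD //.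
by congr Rexpect; apply/funext => w; rewrite RexpectD.
Qed.

Lemma swapEZ c h : tens h -> swapE (fun u v w => c * h u v w) = c * swapE h.
Proof.
move=> /tens_integrable[h1 h2]; rewrite /swapE -RexpectZ //.
by congr Rexpect; apply/funext => w; rewrite RexpectZ.
Qed.

Lemma swapE_sum I (r : seq I) (F : I -> fun3) : (forall i, tens (F i)) ->
  swapE (fun u v w => \sum_(i <- r) F i u v w) = \sum_(i <- r) swapE (F i).
Proof.
move=> tF; elim: r => [|i r IH].
  rewrite big_nil -[RHS](mul0r (swapE (fun _ _ _ => 0))) -swapEZ; last exact: tens_cst.
  by apply: swapE_ext => u v w; rewrite big_nil mul0r.
rewrite big_cons -IH -(swapED (tF i) (tens_sum r predT tF)).
by apply: swapE_ext => u v w; rewrite big_cons.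
Qed.

Lemma swapE_le h k : tens h -> tens k -> (forall u w, h u u w <= k u u w) ->
  swapE h <= swapE k.
Proof.
move=> /tens_integrable[h1 h2] /tens_integrable[k1 k2] hk.
by apply: le_Rexpect => // w; apply: le_Rexpect.
Qed.

(** On a product both sides are [E f * E a * E b]: independence splits the inner expectation of
    [f * a], and the resulting expression is symmetric in [a] and [b]. *)
Lemma swapE_swap h : tens h -> swapE h = swapE (fun u v w => h u w v).
Proof.
elim=> {h} [f a b bf ba bb|h k th IH tk IH'].
  have S a' b' : bmeas g2 a' -> bmeas g2 b' ->
      swapE (fun u v w => f u * a' v * b' w) = 'E f * 'E a' * 'E b'.
    move=> ba' bb'; rewrite /swapE -RexpectZ; last exact/bmeas_integrable/(lift gm2).
    by congr Rexpect; apply/funext => w; rewrite E_prod.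
  rewrite (S _ _ ba bb) mulrAC -(S _ _ bb ba).
  by apply: swapE_ext => u v w /=; rewrite mulrAC.
by rewrite (swapED th tk) (swapED (tens_swap th) (tens_swap tk)) IH IH'.
Qed.

Definition mtens p q (H : Omega -> Omega -> Omega -> 'M[R]_(p, q)) : Prop :=
  forall i j, tens (fun u v w => H u v w i j).

Lemma mtens_cst p q (A : 'M[R]_(p, q)) : mtens (fun _ _ _ => A).
Proof. by move=> i j; apply: tens_cst. Qed.

Lemma mtensD p q (H K : Omega -> Omega -> Omega -> 'M[R]_(p, q)) :
  mtens H -> mtens K -> mtens (fun u v w => H u v w + K u v w).
Proof.
by move=> tH tK i j; apply: (tens_ext (tens_add (tH i j) (tK i j))) => u v w; rewrite mxE.
Qed.

Lemma mtensN p q (H : Omega -> Omega -> Omega -> 'M[R]_(p, q)) :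
  mtens H -> mtens (fun u v w => - H u v w).
Proof.
by move=> tH i j; apply: (tens_ext (tens_opp (tH i j))) => u v w; rewrite mxE.
Qed.

Lemma mtensM p q r (H : Omega -> Omega -> Omega -> 'M[R]_(p, q))
    (K : Omega -> Omega -> Omega -> 'M[R]_(q, r)) :
  mtens H -> mtens K -> mtens (fun u v w => H u v w *m K u v w).
Proof.
move=> tH tK i j.
apply: (@tens_ext (fun u v w => \sum_k H u v w i k * K u v w k j)) => [|u v w].
  by apply: tens_sum => k; apply: tens_mul.
by rewrite mxE.
Qed.

Lemma mtensX p (H : Omega -> Omega -> Omega -> 'M[R]_p) n :
  mtens H -> mtens (fun u v w => H u v w ^+ n).
Proof.
move=> tH; elim: n => [|n IH]; first exact: mtens_cst.
by move=> i j; apply: (tens_ext (mtensM tH IH i j)) => u v w; rewrite exprS.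
Qed.

Lemma tens_tr p (H : Omega -> Omega -> Omega -> 'M[R]_p) :
  mtens H -> tens (fun u v w => \tr (H u v w)).
Proof. by move=> tH; apply: tens_sum => i. Qed.

End Tensors.

(** * Moments of a sum of independent positive matrices *)

Section BoundedMatrices.
Context {R : realType} {Omega : pointedType}.
Implicit Type g : set (set Omega).

Definition bmx g p q (X : Omega -> 'M[R]_(p, q)) : Prop :=
  forall i j, bmeas g (fun w => X w i j).

Lemma bmx_cst g p q (A : 'M[R]_(p, q)) : bmx g (fun=> A).
Proof. by move=> i j; apply: bmeas_cst. Qed.

Lemma bmxD g p q (X Y : Omega -> 'M[R]_(p, q)) :
  bmx g X -> bmx g Y -> bmx g (fun w => X w + Y w).
Proof.
move=> bX bY i j; under [Z in bmeas _ Z]funext do rewrite mxE.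
exact: bmeasD.
Qed.

Lemma bmxB g p q (X Y : Omega -> 'M[R]_(p, q)) :
  bmx g X -> bmx g Y -> bmx g (fun w => X w - Y w).
Proof.
move=> bX bY i j; under [Z in bmeas _ Z]funext do rewrite !mxE.
exact: bmeasB.
Qed.

Lemma bmxM g p q r (X : Omega -> 'M[R]_(p, q)) (Y : Omega -> 'M[R]_(q, r)) :
  bmx g X -> bmx g Y -> bmx g (fun w => X w *m Y w).
Proof.
move=> bX bY i j; under [Z in bmeas _ Z]funext do rewrite mxE.
by apply: bmeas_sum => k _; apply: bmeasM.
Qed.

Lemma bmxX g p (X : Omega -> 'M[R]_p) n : bmx g X -> bmx g (fun w => X w ^+ n).
Proof.
move=> bX; elim: n => [|n IH]; first exact: bmx_cst.
move=> i j; under [Z in bmeas _ Z]funext do rewrite exprS.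
exact: bmxM.
Qed.

Lemma bmx_sum g p q I (r : seq I) (Q : pred I) (F : I -> Omega -> 'M[R]_(p, q)) :
  (forall i, Q i -> bmx g (F i)) -> bmx g (fun w => \sum_(i <- r | Q i) F i w).
Proof.
move=> bF i j; under [Z in bmeas _ Z]funext do rewrite summxE.
by apply: bmeas_sum => k Qk; apply: bF.
Qed.

Lemma bmeas_tr g p (X : Omega -> 'M[R]_p) : bmx g X -> bmeas g (fun w => \tr (X w)).
Proof. by move=> bX; apply: bmeas_sum => i _. Qed.

Lemma bmx_mono g g' p q (X : Omega -> 'M[R]_(p, q)) :
  g `<=` <<s g' >> -> bmx g X -> bmx g' X.
Proof. by move=> gg' bX i j; apply: bmeas_mono (bX i j). Qed.

End BoundedMatrices.

Section MatrixMoments.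
Context {R : realType} {d : measure_display} {Omega : measurableType d}.
Variable P : probability Omega R.
Local Notation "''E' f" := (Rexpect P f) (at level 10, f at level 9).
Local Notation Bm := (@bmeas R _ (@measurable d Omega)).
Variables (m N : nat) (G : 'I_m -> set (set Omega)) (X : 'I_m -> Omega -> 'M[R]_N) (b : R).
Hypothesis Gm : forall l, G l `<=` measurable.
Hypothesis Gind : mutual_indep P (fun l => <<s G l >>).
Hypothesis Xm : forall l, bmx (G l) (X l).
Hypothesis Xsym : forall l w, (X l w)^T = X l w.
Hypothesis b0 : 0 <= b.
(** Says [X^2 <= b X] as quadratic forms: the guise in which positivity and the bound [b] on the
    norm of a summand enter. *)
Hypothesis Xb : forall l w q (W : 'M[R]_(N, q)),
  fro (X l w *m W) (X l w *m W) <= b * fro W (X l w *m W).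

Definition REmx p q (A : Omega -> 'M[R]_(p, q)) : 'M[R]_(p, q) :=
  \matrix_(i, j) 'E (fun w => A w i j).

Hypothesis EX : \sum_l REmx (X l) = 1%:M.

Definition Ydev w : 'M[R]_N := \sum_l X l w - 1%:M.

Lemma bmx_X l : bmx measurable (X l).
Proof. by apply: bmx_mono (Xm l) => A /Gm /sub_sigma_algebra. Qed.

Lemma bmx_Ydev : bmx measurable Ydev.
Proof. by apply: bmxB; [apply: bmx_sum => l _; apply: bmx_X|apply: bmx_cst]. Qed.

Lemma Ydev_sym w : (Ydev w)^T = Ydev w.
Proof.
rewrite /Ydev linearB /= trmx1 raddf_sum /=; congr (_ - _).
by apply: eq_bigr => l _; apply: Xsym.
Qed.

Lemma tr_int p (A : Omega -> 'M[R]_p) : bmx measurable A -> Rintegrable P (fun w => \tr (A w)).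
Proof. by move=> bA; apply/bmeas_integrable/bmeas_tr. Qed.

Lemma Rexpect_trM p (C : 'M[R]_p) (A : Omega -> 'M[R]_p) : bmx measurable A ->
  'E (fun w => \tr (C *m A w)) = \sum_i \sum_j C i j * 'E (fun w => A w j i).
Proof.
move=> bA; rewrite -[LHS]/('E (fun w => \sum_i (C *m A w) i i)).
have bCA : bmx measurable (fun w => C *m A w) by apply: bmxM => //; exact: bmx_cst.
rewrite Rexpect_sum; last by move=> i _; apply/bmeas_integrable/bCA.
apply: eq_bigr => i _; under [Z in Rexpect P Z]funext do rewrite mxE.
rewrite Rexpect_sum; last first.
  by move=> j _; apply/RintegrableZ/bmeas_integrable/bA.
by apply: eq_bigr => j _; rewrite RexpectZ //; apply/bmeas_integrable/bA.
Qed.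

Section OneIndex.
Variable l : 'I_m.
Let g1 := \bigcup_(k in [set k | k != l]) G k.
Let g2 := G l.
Let gm1 : g1 `<=` measurable.
Proof. by move=> A [k _]; apply: Gm. Qed.
Let gm2 : g2 `<=` measurable. Proof. exact: Gm. Qed.
Let ind12 : indep P <<s g1 >> <<s g2 >>.
Proof. exact: mutual_indep_group. Qed.
Local Notation tens := (@tens R d Omega g1 g2).
Local Notation mtens := (@mtens R d Omega g1 g2).
Local Notation swapE := (swapE P).

(** [Z] is the deviation without summand [l]. On the diagonal [u = v], [Y] is the full deviation,
    and [Y'] is the deviation in which summand [l] is replaced by its copy. *)
Let Z u : 'M[R]_N := \sum_(k | k != l) X k u - 1%:M.
Let D (u v w : Omega) : 'M[R]_N := X l v - X l w.
Let Y (u v w : Omega) : 'M[R]_N := Z u + X l v.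
Let Y' (u v w : Omega) : 'M[R]_N := Z u + X l w.

Let YE u w : Y u u w = Ydev u.
Proof. by rewrite /Y /Z /Ydev [in RHS](bigD1 l) //= [LHS]addrC -[RHS]addrA. Qed.

Let tX : mtens (fun _ v _ => X l v).
Proof. by move=> i j; apply: tens_snd; apply: Xm. Qed.
Let tX' : mtens (fun _ _ w => X l w).
Proof. by move=> i j; apply: tens_thd; apply: Xm. Qed.
Let tZ : mtens (fun u _ _ => Z u).
Proof.
move=> i j; apply: tens_fst; apply: bmxB; last exact: bmx_cst.
apply: bmx_sum => k kl; apply: bmx_mono (Xm k) => A GA.
by apply: sub_sigma_algebra; exists k.
Qed.
Let tD : mtens D. Proof. by apply: mtensD => //; apply: mtensN. Qed.
Let tY : mtens Y. Proof. exact: mtensD. Qed.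
Let tY' : mtens Y'. Proof. exact: mtensD. Qed.

Let Zs u : (Z u)^T = Z u.
Proof.
rewrite /Z linearB /= trmx1 raddf_sum /=; congr (_ - _).
by apply: eq_bigr => k _; apply: Xsym.
Qed.
Let Ds u v w : (D u v w)^T = D u v w. Proof. by rewrite /D linearB /= !Xsym. Qed.
Let Ys u v w : (Y u v w)^T = Y u v w. Proof. by rewrite /Y linearD /= Xsym Zs. Qed.
Let Y's u v w : (Y' u v w)^T = Y' u v w. Proof. by rewrite /Y' linearD /= Xsym Zs. Qed.

(** A typical term of [D (Y^k - Y'^k)] after telescoping, since [Y - Y' = D]. *)
Let a i j (u v w : Omega) : R := \tr (D u v w *m Y u v w ^+ i *m D u v w *m Y' u v w ^+ j).

Let ta i j : tens (a i j).
Proof. by apply: tens_tr; do 3 ?[apply: mtensM]; try apply: mtensX. Qed.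

(** Exchanging summand and copy changes the sign of both factors [D] and interchanges [Y] with [Y'];
    cyclicity of the trace restores the order. *)
Let a_swap i j : swapE (a i j) = swapE (a j i).
Proof.
rewrite [LHS](swapE_swap gm1 gm2 ind12 (ta i j)); apply: swapE_ext => u v w.
rewrite /a -[D u w v]opprB -/(D u v w) !(mulNmx, mulmxN) opprK.
rewrite -[Y u w v]/(Y' u v w) -[Y' u w v]/(Y u v w).
by rewrite -mulmxA mxtrace_mulC mulmxA.
Qed.

(* With [a_swap], [i |-> swapE (a (2 i) (2 p - 2 i))] is convex and symmetric, so that
   it is largest at the endpoints. *)
Let a_mid i i' j j' : 2 * swapE (a (i + i') (j + j')) <=
  swapE (a (i + i) (j + j)) + swapE (a (i' + i') (j' + j')).
Proof.
have t2 : tens (fun u v w => 2 * a (i + i') (j + j') u v w).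
  by apply: tens_mul; [exact: tens_cst|exact: ta].
have e1 := swapEZ gm1 gm2 ind12 2 (ta (i + i') (j + j')).
have e2 := swapED gm1 gm2 ind12 (ta (i + i) (j + j)) (ta (i' + i') (j' + j')).
rewrite -[X in X <= _]e1 -[X in _ <= X]e2.
apply: (swapE_le gm1 gm2 ind12 t2 (tens_add (ta _ _) (ta _ _))) => u w.
exact: tr_powers_mid.
Qed.

Variable p : nat.

Let a_even i : (i <= p)%N -> swapE (a (i + i) ((p - i) + (p - i))) <= swapE (a (p + p) 0).
Proof.
move=> ip; pose e i := swapE (a (i + i) ((p - i) + (p - i))).
have := @convex_seq_max _ e p _ i ip.
have -> : e 0%N = e p by rewrite /e subn0 subnn a_swap.
have -> : e p = swapE (a (p + p) 0) by rewrite /e subnn.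
rewrite maxxx; apply => k kp; rewrite /e.
have e1 : (p - k = (p - k.+2).+2)%N by lia.
have e2 : (p - k.+1 = (p - k.+2).+1)%N by lia.
rewrite e1 e2; move: (p - k.+2)%N => q.
have -> : (k.+1 + k.+1 = k + k.+2)%N by lia.
have -> : (q.+1 + q.+1 = q.+2 + q)%N by lia.
exact: a_mid.
Qed.

(** An odd exponent is the midpoint of its two even neighbours, so [a_mid] reduces it to
    [a_even]. *)
Let a_max q : (q <= p + p)%N -> swapE (a q (p + p - q)) <= swapE (a (p + p) 0).
Proof.
move=> qp; have := odd_double_half q; case: (odd q) => /= qE; last first.
  have hp : (q./2 <= p)%N by lia.
  have -> : q = (q./2 + q./2)%N by lia.
  have -> : (p + p - (q./2 + q./2) = (p - q./2) + (p - q./2))%N by lia.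
  exact: a_even.
have hp : (q./2.+1 <= p)%N by lia.
have e1 : q = (q./2 + q./2.+1)%N by lia.
have e2 : (p + p - q = (p - q./2) + (p - q./2.+1))%N by lia.
have mid : forall x y z t : R, 2 * x <= y + z -> y <= t -> z <= t -> x <= t.
  by move=> x y z t; lra.
rewrite e2 {1}e1.
exact: mid (a_mid q./2 q./2.+1 (p - q./2) (p - q./2.+1)) (a_even (ltnW hp)) (a_even hp).
Qed.

Let SX k : swapE (fun u v w => \tr (X l v *m Y u v w ^+ k)) =
  'E (fun w => \tr (X l w *m Ydev w ^+ k)).
Proof.
transitivity ('E (fun _ : Omega => 'E (fun w => \tr (X l w *m Ydev w ^+ k)))); last first.
  exact: Rexpect_cst.
by congr (Rexpect P _); apply/funext => w; congr (Rexpect P _); apply/funext => u; rewrite YE.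
Qed.

(** The copy at [w] is integrated separately from the deviation at [u], hence may be replaced by its
    mean. *)
Let SX' k : swapE (fun u v w => \tr (X l w *m Y u v w ^+ k)) =
  'E (fun w => \tr (REmx (X l) *m Ydev w ^+ k)).
Proof.
have bYk : bmx measurable (fun w => Ydev w ^+ k) by apply/bmxX/bmx_Ydev.
rewrite Rexpect_trM // /swapE.
under [T in Rexpect P T]funext => w.
  under [T in Rexpect P T]funext => u do rewrite YE.
  rewrite Rexpect_trM //.
  over.
have bXi i j : Bm (fun w => X l w i j * 'E (fun w0 => (Ydev w0 ^+ k) j i)).
  by apply: bmeasM; [exact: bmx_X|exact: bmeas_cst].
rewrite Rexpect_sum; last first.
  by move=> i _; apply: bmeas_integrable; apply: bmeas_sum => j _.
apply: eq_bigr => i _; rewrite Rexpect_sum; last by move=> j _; apply: bmeas_integrable.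
apply: eq_bigr => j _; rewrite mxE mulrC -RexpectZ; last exact/bmeas_integrable/bmx_X.
by congr Rexpect; apply/funext => w; rewrite mulrC.
Qed.

Let tXY k : tens (fun u v w => \tr (X l v *m Y u v w ^+ k)).
Proof. by apply: tens_tr; apply: mtensM => //; apply: mtensX. Qed.
Let tX'Y k : tens (fun u v w => \tr (X l w *m Y u v w ^+ k)).
Proof. by apply: tens_tr; apply: mtensM => //; apply: mtensX. Qed.

(** At the endpoint the trace is [|D Y^p|^2] with [D = X - X'], at most
    [2 |X Y^p|^2 + 2 |X' Y^p|^2]; [Xb] trades each square for one factor [b]. *)
Let a_top : swapE (a (p + p) 0) <= 2 * b * ('E (fun w => \tr (X l w *m Ydev w ^+ (p + p)))
   + 'E (fun w => \tr (REmx (X l) *m Ydev w ^+ (p + p)))).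
Proof.
rewrite -SX -SX'.
have tS := tens_add (tXY (p + p)) (tX'Y (p + p)).
have e1 := swapED gm1 gm2 ind12 (tXY (p + p)) (tX'Y (p + p)).
have e2 := swapEZ gm1 gm2 ind12 (2 * b) tS.
rewrite -e1 -[X in _ <= X]e2.
apply: (swapE_le gm1 gm2 ind12 (ta _ _) (tens_mul (tens_cst _ _ (2 * b)) tS)) => u w.
rewrite /a expr0 mulmx1; set W := Y u u w ^+ p.
have sW : W^T = W by rewrite /W trmxX Ys.
have -> : \tr (D u u w *m Y u u w ^+ (p + p) *m D u u w) = fro (D u u w *m W) (D u u w *m W).
  rewrite /fro trmx_mul sW Ds exprD -mulmxE -/W (mulmxA _ W W) -(mulmxA _ W (D u u w)).
  exact: mxtrace_mulC.
have trW V : \tr (V *m Y u u w ^+ (p + p)) = fro W (V *m W).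
  by rewrite /fro sW exprD -/W -mulmxE mulmxA mxtrace_mulC.
rewrite !trW /D mulmxBl; apply: le_trans (fro_parallelogram_le _ _) _.
rewrite -mulrA mulrDr mulrDr; apply: lerD; rewrite ler_pM2l //; exact: Xb.
Qed.

(** The left side is the mean of [tr (D Y^k.+1)]. As [D] is antisymmetric under the exchange, it
    equals half the mean of [tr (D (Y^k.+1 - Y'^k.+1))], which telescopes into [k.+1] terms
    [a q (k - q)], each at most the endpoint value. *)
Lemma exchange_pair_step :
  'E (fun w => \tr (X l w *m Ydev w ^+ (p + p).+1))
   - 'E (fun w => \tr (REmx (X l) *m Ydev w ^+ (p + p).+1)) <=
  (p + p).+1%:R * b * ('E (fun w => \tr (X l w *m Ydev w ^+ (p + p)))
   + 'E (fun w => \tr (REmx (X l) *m Ydev w ^+ (p + p)))).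
Proof.
rewrite -SX -SX'; set k := (p + p)%N.
have tDY : tens (fun u v w => \tr (D u v w *m Y u v w ^+ k.+1)).
  by apply: tens_tr; apply: mtensM => //; apply: mtensX.
have tDY' : tens (fun u v w => \tr (D u v w *m Y' u v w ^+ k.+1)).
  by apply: tens_tr; apply: mtensM => //; apply: mtensX.
have -> : swapE (fun u v w => \tr (X l v *m Y u v w ^+ k.+1)) -
          swapE (fun u v w => \tr (X l w *m Y u v w ^+ k.+1)) =
          swapE (fun u v w => \tr (D u v w *m Y u v w ^+ k.+1)).
  apply/eqP; rewrite subr_eq -[X in _ == X](swapED gm1 gm2 ind12 tDY (tX'Y _)).
  apply/eqP; apply: swapE_ext => u v w.
  by rewrite -mxtraceD -mulmxDl /D subrK.
have sw : swapE (fun u v w => \tr (D u v w *m Y u v w ^+ k.+1)) =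
         - swapE (fun u v w => \tr (D u v w *m Y' u v w ^+ k.+1)).
  rewrite [LHS](swapE_swap gm1 gm2 ind12 tDY) -mulN1r -[RHS](swapEZ gm1 gm2 ind12 (-1) tDY').
  apply: swapE_ext => u v w.
  by rewrite mulN1r -[D u w v]opprB -/(D u v w) mulNmx raddfN.
have key : 2 * swapE (fun u v w => \tr (D u v w *m Y u v w ^+ k.+1)) =
   \sum_(q < k.+1) swapE (a q (k - q)).
  have tN := tens_opp tDY'.
  have eN : swapE (fun u v w => - \tr (D u v w *m Y' u v w ^+ k.+1)) =
      - swapE (fun u v w => \tr (D u v w *m Y' u v w ^+ k.+1)).
    rewrite -mulN1r -[RHS](swapEZ gm1 gm2 ind12 (-1) tDY').
    by apply: swapE_ext => u v w; rewrite mulN1r.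
  have eS := swapE_sum gm1 gm2 ind12 (index_enum 'I_k.+1) (fun q => ta q (k - q)).
  rewrite -[RHS]eS mulr2n mulrDl !mul1r {2}sw -eN -[LHS](swapED gm1 gm2 ind12 tDY tN).
  apply: swapE_ext => u v w; rewrite -raddfB -mulmxBr subrXX_mx.
  rewrite mulmx_sumr raddf_sum; apply: eq_bigr => q _ /=.
  have -> : Y u v w - Y' u v w = D u v w by rewrite /Y /Y' /D; apply/matrixP => i j; rewrite !mxE; ring.
  by rewrite /a !mulmxA.
rewrite -(ler_pM2l (ltr0Sn R 1)) key.
apply: (@le_trans _ _ (\sum_(q < k.+1) swapE (a (p + p) 0))).
  by apply: ler_sum => q _; apply: a_max; rewrite -ltnS.
rewrite sumr_const card_ord -[X in X <= _]mulr_natl.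
have fin : forall n x T : R, 0 <= n -> x <= 2 * b * T -> n * x <= 2 * (n * b * T).
  move=> n x T n0 h; rewrite (_ : 2 * (n * b * T) = n * (2 * b * T)); last by ring.
  exact: ler_wpM2l.
apply: fin; first exact: ler0n.
exact: a_top.
Qed.

End OneIndex.

Definition trace_moment p := 'E (fun w => \tr (Ydev w ^+ (p + p))).

(** Summing over [l] uses that the [X l] add up to [Ydev + 1] and their means to 1. The odd moment
    that appears is absorbed by [tr Y^(2p+1) <= tr Y^(2p+2) + tr Y^(2p) / 4]; thus
    [9 / 4 = 2 + 1 / 4]. *)
Lemma trace_moment_step p (kap : R) : (p + p).+1%:R * b <= kap -> kap < 1 ->
  (1 - kap) * trace_moment p.+1 <= 9 / 4 * kap * trace_moment p.
Proof.
move=> hk k1; set k := (p + p)%N.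
have bY n : bmx measurable (fun w => Ydev w ^+ n) by apply/bmxX/bmx_Ydev.
have bXY l n : bmx measurable (fun w => X l w *m Ydev w ^+ n) by apply: bmxM => //; exact: bmx_X.
have bEY l n : bmx measurable (fun w => REmx (X l) *m Ydev w ^+ n).
  by apply: bmxM => //; exact: bmx_cst.
have sumX n : \sum_l 'E (fun w => \tr (X l w *m Ydev w ^+ n)) =
    'E (fun w => \tr (Ydev w ^+ n.+1)) + 'E (fun w => \tr (Ydev w ^+ n)).
  rewrite -Rexpect_sum; last by move=> l _; apply: tr_int.
  rewrite -RexpectD; [|exact: tr_int|exact: tr_int].
  congr Rexpect; apply/funext => w; rewrite -raddf_sum -mulmx_suml -raddfD /=; congr (\tr _).
  by rewrite exprS -mulmxE {2}/Ydev mulmxBl mul1mx subrK.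
have sumE n : \sum_l 'E (fun w => \tr (REmx (X l) *m Ydev w ^+ n)) = 'E (fun w => \tr (Ydev w ^+ n)).
  rewrite -Rexpect_sum; last by move=> l _; apply: tr_int.
  congr Rexpect; apply/funext => w; rewrite -raddf_sum -mulmx_suml /= EX mul1mx //.
have h1 : trace_moment p.+1 <= (p + p).+1%:R * b *
    ('E (fun w => \tr (Ydev w ^+ k.+1)) + 2 * trace_moment p).
  have -> : trace_moment p.+1 = \sum_l ('E (fun w => \tr (X l w *m Ydev w ^+ k.+1))
   - 'E (fun w => \tr (REmx (X l) *m Ydev w ^+ k.+1))).
    by rewrite big_split sumrN /= sumX sumE addrK /trace_moment addSn addnS.
  apply: (@le_trans _ _ (\sum_l (p + p).+1%:R * b * ('E (fun w => \tr (X l w *m Ydev w ^+ k))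
   + 'E (fun w => \tr (REmx (X l) *m Ydev w ^+ k))))).
    by apply: ler_sum => l _; apply: exchange_pair_step.
  by rewrite -mulr_sumr big_split /= sumX sumE /trace_moment -/k -addrA (mulr_natl _ 2) mulr2n.
have h2 : 'E (fun w => \tr (Ydev w ^+ k.+1)) <= trace_moment p.+1 + 4^-1 * trace_moment p.
  rewrite /trace_moment -RexpectZ; last exact: tr_int.
  rewrite -RexpectD; [|exact: tr_int|exact/RintegrableZ/tr_int].
  apply: le_Rexpect; [exact: tr_int|apply: RintegrableD; [exact: tr_int|exact/RintegrableZ/tr_int]|].
  move=> w; have := fro_AMGM (Ydev w ^+ p.+1) (2^-1 *: Ydev w ^+ p).
  rewrite froZr froZl froZr /fro !trmxX Ydev_sym !mulmxE -!exprD.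
  by rewrite -/k addSn -/k; lra.
have M0 q : 0 <= trace_moment q.
  apply: Rexpect_ge0 => w; have := fro_ge0 (Ydev w ^+ q).
  by rewrite /fro trmxX Ydev_sym mulmxE -exprD.
move: h1 h2 (M0 p) (M0 p.+1); set c := _ * b in hk *.
have c0 : 0 <= c by rewrite mulr_ge0.
move: (trace_moment p.+1) (trace_moment p) ('E _) => M' M e h1 h2 pM pM'.
have h3 : M' <= c * (M' + 9 / 4 * M).
  by apply: le_trans h1 _; apply: ler_wpM2l => //; lra.
have h4 : c * (M' + 9 / 4 * M) <= kap * (M' + 9 / 4 * M) by rewrite ler_wpM2r //; lra.
lra.
Qed.

(** With [kap = 1/28] each step gains the factor [(9/4) (1/28) / (27/28) = 1/12]. *)
Lemma trace_moment_bound p : (p + p)%:R * b <= 28^-1 ->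
  trace_moment p <= N%:R * 12^-1 ^+ p.
Proof.
have M0 q : 0 <= trace_moment q.
  apply: Rexpect_ge0 => w; have := fro_ge0 (Ydev w ^+ q).
  by rewrite /fro trmxX Ydev_sym mulmxE -exprD.
elim: p => [_|p IH hp].
  rewrite /trace_moment expr0 mulr1 (_ : (fun w => _) = fun=> N%:R) ?Rexpect_cst //.
  by apply/funext => w; rewrite expr0 mxtrace1.
have h q : (q <= p.+1 + p.+1)%N -> q%:R * b <= 28^-1.
  by move=> qp; apply: le_trans hp; rewrite ler_wpM2r // ler_nat.
have k1 : 28^-1 < 1 :> R by lra.
have := @trace_moment_step p 28^-1 (h _ _) k1.
have := IH (h _ _); rewrite exprS.
have -> : (p + p <= p.+1 + p.+1)%N by lia.
have -> : (p + p < p.+1 + p.+1)%N by lia.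
move=> /(_ isT) h1 /(_ isT) h2.
have : 27 * trace_moment p.+1 <= 9 / 4 * (N%:R * 12^-1 ^+ p) by lra.
lra.
Qed.

(** Markov's inequality at the level that corresponds to an operator norm of 1/2; what remains per
    step is [4 / 12 = 1/3], which is at most [exp (- 1)]. *)
Lemma matrix_deviation p : (p.+1 + p.+1)%:R * b <= 28^-1 ->
  prb P [set w | 4^-1 ^+ p.+1 <= \tr (Ydev w ^+ (p.+1 + p.+1))] <= N%:R * 3^-1 ^+ p.+1.
Proof.
move=> hp; have bT : Bm (fun w => \tr (Ydev w ^+ (p.+1 + p.+1))).
  by apply/bmeas_tr/bmxX/bmx_Ydev.
have e4 : 0 < 4^-1 ^+ p.+1 :> R by rewrite exprn_gt0 ?invr_gt0.
apply: le_trans (Rmarkov (bmeas_integrable P bT) _ e4 _) _.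
- move=> w; have := fro_ge0 (Ydev w ^+ p.+1).
  by rewrite /fro trmxX Ydev_sym mulmxE -exprD.
- have := smeas_ge (4^-1 ^+ p.+1) bT.1; apply: smallest_sub => //.
  exact: sigma_algebra_measurable.
rewrite ler_pdivrMr // -mulrA -exprMn.
have -> : 3^-1 * 4^-1 = 12^-1 :> R by lra.
exact: trace_moment_bound.
Qed.

End MatrixMoments.

(** * Pinelis' inequality in a Hilbert space *)

Section Hyperbolic.
Context {R : realType}.
Implicit Types a c r s x : R.

Definition cosh x : R := (expR x + expR (- x)) / 2.
Definition sinh x : R := (expR x - expR (- x)) / 2.

Lemma sinh0 : sinh 0 = 0.
Proof. by rewrite /sinh oppr0 subrr mul0r. Qed.

Lemma coshD a c : cosh (a + c) = cosh a * cosh c + sinh a * sinh c.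
Proof. rewrite /cosh /sinh opprD !expRD; by field. Qed.

Lemma coshB a c : cosh (a - c) = cosh a * cosh c - sinh a * sinh c.
Proof. rewrite /cosh /sinh opprD opprK !expRD; by field. Qed.

Lemma cosh_gt0 x : 0 < cosh x.
Proof. by rewrite divr_gt0 // addr_gt0 ?expR_gt0. Qed.

Lemma sinh_ge0 x : 0 <= x -> 0 <= sinh x.
Proof. by move=> x0; rewrite divr_ge0 // subr_ge0 ler_expR ge0_cp. Qed.

Lemma sinh_le_cosh x : sinh x <= cosh x.
Proof. by rewrite /sinh /cosh ler_pM2r ?invr_gt0 // lerD2l ge0_cp ?expR_ge0. Qed.

Lemma cosh_add_sinh x : cosh x + sinh x = expR x.
Proof. rewrite /cosh /sinh; by field. Qed.

Lemma expR_le_cosh x : expR x / 2 <= cosh x.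
Proof. by rewrite ler_pM2r ?invr_gt0 // lerDl expR_ge0. Qed.

(** With [x] and [y] written as difference and sum of [(y + x) / 2] and [(y - x) / 2], the addition
    formulas leave a product of two nonnegative [sinh]. *)
Lemma cosh_le x y : 0 <= x -> x <= y -> cosh x <= cosh y.
Proof.
move=> x0 xy; have y0 := le_trans x0 xy.
have := coshB ((y + x) / 2) ((y - x) / 2); have := coshD ((y + x) / 2) ((y - x) / 2).
have -> : (y + x) / 2 + (y - x) / 2 = y by field.
have -> : (y + x) / 2 - (y - x) / 2 = x by field.
move=> -> ->; rewrite lerD2l.
have : 0 <= sinh ((y + x) / 2) * sinh ((y - x) / 2).
  by rewrite mulr_ge0 // sinh_ge0 // divr_ge0 ?subr_ge0 ?addr_ge0.
lra.
Qed.

Let even_part x n : R := \sum_(0 <= k < n) (x ^+ k + (- x) ^+ k) / 2 / k`!%:R.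
Let odd_part x n : R := \sum_(0 <= k < n) (x ^+ k - (- x) ^+ k) / 2 / k`!%:R.

Lemma exp_series_cvg x : series (exp_coeff x) @ \oo --> expR x.
Proof. exact: is_cvg_series_exp_coeff. Qed.

Let even_cvg x : even_part x @ \oo --> cosh x.
Proof.
have -> : even_part x = (fun n => 2^-1 * (series (exp_coeff x) n + series (exp_coeff (- x)) n)).
  apply/funext => n; rewrite /series /= -big_split /= mulr_sumr; apply: eq_bigr => k _.
  by rewrite /exp_coeff /= -mulrDl mulrCA mulrA.
rewrite /cosh mulrC; apply: cvgMr; apply: cvgD; exact: exp_series_cvg.
Qed.

Let odd_cvg x : odd_part x @ \oo --> sinh x.
Proof.
have -> : odd_part x = (fun n => 2^-1 * (series (exp_coeff x) n - series (exp_coeff (- x)) n)).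
  apply/funext => n; rewrite /series /= -sumrB mulr_sumr; apply: eq_bigr => k _.
  by rewrite /exp_coeff /= -mulrBl mulrCA mulrA.
rewrite /sinh mulrC; apply: cvgMr; apply: cvgB; exact: exp_series_cvg.
Qed.

Lemma le_sinh x : 0 <= x -> x <= sinh x.
Proof.
move=> x0; apply: (cvgr_to_ge (@odd_cvg x)).
near=> n; have n2 : (2 <= n)%N by near: n; exact: nbhs_infty_ge.
rewrite /odd_part (@big_cat_nat _ _ _ 2) //= big_nat_recl // big_nat1 /=.
have -> : (x ^+ 0 - (- x) ^+ 0) / 2 / 0`!%:R + (x ^+ 1 - (- x) ^+ 1) / 2 / 1`!%:R = x.
  by rewrite !expr0 !expr1 fact0 (_ : 1`! = 1%N) //; field.
rewrite lerDl.
rewrite big_seq; apply: sumr_ge0 => k _; rewrite !mulr_ge0 ?invr_ge0 //.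
rewrite exprNn -[X in X - _]mul1r -mulrBl mulr_ge0 ?exprn_ge0 // subr_ge0.
by rewrite -signr_odd; case: odd; rewrite ?expr0 ?expr1 // ge0_cp.
Unshelve. all: by end_near.
Qed.

Let even_term x k : (x ^+ k + (- x) ^+ k) / 2 = if odd k then 0 else (x ^+ 2) ^+ k./2.
Proof.
rewrite exprNn -signr_odd; case: (boolP (odd k)) => o.
  by rewrite expr1 mulN1r subrr mul0r.
rewrite expr0 mul1r -exprM (_ : (2 * k./2 = k)%N); last by move: o; lia.
by field.
Qed.

(** Termwise comparison of the power series through [2^q q! <= (2q)!]; the even partial sum of
    length [2 n] dominates the one of length [n]. *)
Lemma cosh_le_expR_sqr x : cosh x <= expR (x ^+ 2 / 2).
Proof.
apply: (ler_cvg_to (@even_cvg x) (@exp_series_cvg (x ^+ 2 / 2))).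
apply: nearW => n.
have H q : even_part x q.*2 <= series (exp_coeff (x ^+ 2 / 2)) q.
  elim: q => [|q IH]; first by rewrite /even_part /series /= !big_nil.
  rewrite /even_part /series /= doubleS !big_nat_recr //= -addrA; apply: lerD => //.
  rewrite even_term odd_double doubleK even_term /= odd_double /= mul0r addr0.
  have -> : exp_coeff (x ^+ 2 / 2) q = (x ^+ 2) ^+ q * (2^-1 ^+ q / q`!%:R).
    by rewrite /exp_coeff /= mulrA -exprMn.
  rewrite ler_wpM2l ?(exprn_ge0 _ (sqr_ge0 x)) //.
  rewrite exprVn -invfM lef_pV2 ?posrE ?mulr_gt0 ?exprn_gt0 ?ltr0n ?fact_gt0 //.
  rewrite -natrX -natrM ler_nat.
  elim: q {IH} => // q IH; rewrite doubleS !factS expnS.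
  have -> : (2 * 2 ^ q * (q.+1 * q`!) = (q.*2.+2) * (2 ^ q * q`!))%N by rewrite -muln2; ring.
  rewrite leq_mul2l; apply/orP; right; apply: leq_trans IH _; exact: leq_pmull.
apply: le_trans (H n); rewrite /even_part -addnn.
rewrite [X in _ <= X](@big_cat_nat _ _ _ n) //= ?leq_addr // lerDl big_seq.
apply: sumr_ge0 => k _; rewrite even_term; case: odd; rewrite ?mul0r //.
by rewrite divr_ge0 // exprn_ge0 ?sqr_ge0.
Qed.

Lemma power_convex (t A B : R) j : 0 <= t <= 1 -> 0 <= A -> 0 <= B ->
  (t * A + (1 - t) * B) ^+ j <= t * A ^+ j + (1 - t) * B ^+ j.
Proof.
move=> /andP[t0 t1] A0 B0; have u0 : 0 <= 1 - t by rewrite subr_ge0.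
elim: j => [|j IH]; first by rewrite !expr0; lra.
rewrite exprS; apply: le_trans (ler_wpM2l _ IH) _; first by rewrite addr_ge0 ?mulr_ge0.
rewrite !exprS -subr_ge0.
have -> : t * (A * A ^+ j) + (1 - t) * (B * B ^+ j) -
   (t * A + (1 - t) * B) * (t * A ^+ j + (1 - t) * B ^+ j) =
   (t * (1 - t)) * ((A - B) * (A ^+ j - B ^+ j)) by ring.
apply: mulr_ge0; first by rewrite mulr_ge0.
have [AB|AB] := lerP A B.
  by rewrite mulr_le0 // subr_le0 // lerXn2r.
by rewrite mulr_ge0 // subr_ge0 ?(ltW AB) // lerXn2r ?nnegrE // ltW.
Qed.

(* Convexity of [cosh] in the square of its argument, read off the power series. *)
Lemma cosh_sqr_convex (t s x y : R) : 0 <= t <= 1 ->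
  s ^+ 2 = t * x ^+ 2 + (1 - t) * y ^+ 2 -> cosh s <= t * cosh x + (1 - t) * cosh y.
Proof.
move=> t01 hs; have cv : (fun n => t * even_part x n + (1 - t) * even_part y n) @ \oo -->
    t * cosh x + (1 - t) * cosh y.
  by apply: cvgD; apply: cvgMr; apply: even_cvg.
apply: (ler_cvg_to (@even_cvg s) cv).
apply: nearW => n; rewrite !mulr_sumr -big_split /=; apply: ler_sum => k _.
rewrite !even_term !mulrA -mulrDl ler_wpM2r ?invr_ge0 //.
case: odd; first by rewrite !mulr0 addr0.
by rewrite hs power_convex ?sqr_ge0.
Qed.

(** Here [q] is the cosine of the angle between two vectors of lengths [a] and [c], and [s ^+ 2] is
    the mean of [(a + c)^2] and [(a - c)^2] with weights [(1 + q) / 2] and [(1 - q) / 2], so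
    [cosh_sqr_convex] applies. If [a * c = 0] then [r = 0] and [q = 0] serves. *)
Lemma cosh_sum_le a c r s : 0 <= a -> 0 <= c -> `|r| <= a * c ->
  s ^+ 2 = a ^+ 2 + c ^+ 2 + 2 * r ->
  exists2 q, `|q| <= 1 /\ r = q * (a * c) & cosh s <= cosh a * cosh c + q * (sinh a * sinh c).
Proof.
move=> a0 c0 hr hs; pose q := if a * c == 0 then 0 else r / (a * c).
have rq : r = q * (a * c).
  rewrite /q; case: eqP => [ac|/eqP ac]; last by rewrite divfK.
  by move: hr; rewrite ac normr_le0 mul0r => /eqP.
have q1 : `|q| <= 1.
  rewrite /q; case: eqP => [ac|/eqP ac]; first by rewrite normr0.
  have ac0 : 0 < a * c by rewrite lt_def ac mulr_ge0.
  by rewrite normrM normfV (gtr0_norm ac0) ler_pdivrMr // mul1r.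
exists q => //.
have t01 : 0 <= (1 + q) / 2 <= 1.
  by move: q1; rewrite ler_norml => /andP[h1 h2]; lra.
have := @cosh_sqr_convex ((1 + q) / 2) s (a + c) (a - c) t01.
rewrite coshD coshB => H; have {}H := H _.
apply: le_trans (H _) _; first by rewrite hs rq; field.
rewrite le_eqVlt; apply/orP; left; apply/eqP; by field.
Qed.

(** The two angles are supplementary, so the [sinh] terms cancel; in the degenerate case [a * c = 0]
    they vanish. *)
Lemma cosh_symmetric_sum a c r s s' : 0 <= a -> 0 <= c -> `|r| <= a * c ->
  s ^+ 2 = a ^+ 2 + c ^+ 2 + 2 * r -> s' ^+ 2 = a ^+ 2 + c ^+ 2 - 2 * r ->
  cosh s + cosh s' <= 2 * (cosh a * cosh c).
Proof.
move=> a0 c0 hr hs hs'.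
have [q [q1 rq] h] := cosh_sum_le a0 c0 hr hs.
have [||q' [q'1 rq'] h'] := @cosh_sum_le a c (- r) s' a0 c0; [by rewrite normrN|by rewrite hs' mulrN|].
have qq : q * (sinh a * sinh c) + q' * (sinh a * sinh c) = 0.
  have [ac|ac] := eqVneq (a * c) 0.
    have : sinh a * sinh c = 0.
      by move/eqP: ac; rewrite mulf_eq0 => /orP[] /eqP ->; rewrite sinh0 ?mul0r ?mulr0.
    by move=> ->; rewrite !mulr0 addr0.
  have : (q + q') * (a * c) = 0 by rewrite mulrDl -rq -rq' subrr.
  by move=> /eqP; rewrite mulf_eq0 (negbTE ac) orbF -mulrDl => /eqP ->; rewrite mul0r.
lra.
Qed.

(** Squaring [1 - c/2 <= exp (- c/2)] gives [exp c <= (1 - c/2)^-2], and the rest is a polynomial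
    inequality on [[0, 1/4]]. This range is why the column terms are kept below 1/4 in norm. *)
Lemma expR_quadratic_le c : 0 <= c <= 4^-1 -> expR c <= 1 + c + c ^+ 2.
Proof.
move=> /andP[c0 c1].
have h : (1 - c / 2) ^+ 2 * expR c <= 1.
  have -> : expR c = (expR (- (c / 2))) ^- 2.
    by rewrite expRN exprVn invrK expr2 -expRD; congr expR; field.
  rewrite -exprVn -exprMn; apply: exprn_ile1; rewrite ?expRN ?invrK.
    by rewrite mulr_ge0 ?expR_ge0 //; lra.
  rewrite -ler_pdivlMr ?expR_gt0 // mul1r -expRN.
  by have := expR_ge1Dx (- (c / 2)).
have h2 : 1 <= (1 - c / 2) ^+ 2 * (1 + c + c ^+ 2).
  rewrite !expr2; nra.
have p : 0 < (1 - c / 2) ^+ 2 by rewrite exprn_gt0 //; lra.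
by rewrite -(ler_pM2l p) (le_trans h).
Qed.

(* One step of Pinelis' argument: [a], [c], [s] are the norms of [x], [z], [x + z] and
   [r] is the inner product of [x] and [z], whose expectation vanishes for centred [z]. *)
Lemma cosh_pinelis a c r s : 0 <= a -> 0 <= c <= 4^-1 -> `|r| <= a * c ->
  s ^+ 2 = a ^+ 2 + c ^+ 2 + 2 * r ->
  cosh s <= cosh a * (1 + c ^+ 2) + sinh a / a * r.
Proof.
move=> a0 /andP[c0 c1] hr hs.
have [q [q1 rq] h] := cosh_sum_le a0 c0 hr hs; apply: le_trans h _.
have e : sinh a / a * r = q * (sinh a * c).
  rewrite rq; have [->|an0] := eqVneq a 0; first by rewrite sinh0 !mul0r !mulr0.
  by field.
rewrite e; have sc := le_sinh c0; have sa := sinh_ge0 a0.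
have h1 : q * (sinh a * sinh c) - q * (sinh a * c) <= sinh a * (sinh c - c).
  rewrite -mulrBr -mulrBr; have : 0 <= sinh a * (sinh c - c) by rewrite mulr_ge0 // subr_ge0.
  move: q1; rewrite ler_norml => /andP[_ q1] x0.
  by rewrite -[X in _ <= X]mul1r ler_wpM2r.
have h2 : sinh a * (sinh c - c) <= cosh a * (sinh c - c).
  by rewrite ler_wpM2r ?subr_ge0 // sinh_le_cosh.
have h3 : cosh c + (sinh c - c) <= 1 + c ^+ 2.
  have := @expR_quadratic_le c; rewrite c0 c1 => /(_ isT).
  by rewrite -cosh_add_sinh; lra.
have := ler_wpM2l (ltW (cosh_gt0 a)) h3; rewrite mulrDr; lra.
Qed.

Lemma smeas_cosh {Omega : pointedType} (g : set (set Omega)) (f : Omega -> R) :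
  smeas g f -> smeas g (fun w => cosh (f w)).
Proof.
move=> mf; apply: smeasM; last exact: smeas_cst.
apply: smeasD; first exact: (smeas_comp (@measurable_expR R)).
by apply: (smeas_comp (@measurable_expR R)); apply: smeasN.
Qed.

Lemma smeas_sinh {Omega : pointedType} (g : set (set Omega)) (f : Omega -> R) :
  smeas g f -> smeas g (fun w => sinh (f w)).
Proof.
move=> mf; apply: smeasM; last exact: smeas_cst.
apply: smeasB; first exact: (smeas_comp (@measurable_expR R)).
by apply: (smeas_comp (@measurable_expR R)); apply: smeasN.
Qed.

End Hyperbolic.

Section VectorBernstein.
Context {R : realType} {d : measure_display} {Omega : measurableType d}.
Variable P : probability Omega R.
Local Notation "''E' f" := (Rexpect P f) (at level 10, f at level 9).
Local Notation Bm := (@bmeas R _ (@measurable d Omega)).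

Definition nrm N (x : 'cV[R]_N) : R := Num.sqrt (fro x x).

Lemma nrm_ge0 N (x : 'cV[R]_N) : 0 <= nrm x.
Proof. exact: sqrtr_ge0. Qed.

Lemma sqr_nrm N (x : 'cV[R]_N) : nrm x ^+ 2 = fro x x.
Proof. by rewrite sqr_sqrtr ?fro_ge0. Qed.

Lemma fro_cV N (x y : 'cV[R]_N) : fro x y = \sum_i x i 0 * y i 0.
Proof. by rewrite froE; apply: eq_bigr => i _; rewrite big_ord1. Qed.

Lemma norm_fro_le N (x y : 'cV[R]_N) : `|fro x y| <= nrm x * nrm y.
Proof.
rewrite -sqrtrM ?fro_ge0 // -sqrtr_sqr ler_wsqrtr //; exact: fro_CS.
Qed.

Lemma norm_coord_le N (x : 'cV[R]_N) i : `|x i 0| <= nrm x.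
Proof.
rewrite -sqrtr_sqr ler_wsqrtr // fro_cV (bigD1 i) //= -expr2 lerDl.
by apply: sumr_ge0 => j _; rewrite -expr2 sqr_ge0.
Qed.

Lemma bmeas_fro g N (x y : Omega -> 'cV[R]_N) : bmx g x -> bmx g y ->
  bmeas g (fun w => fro (x w) (y w)).
Proof.
move=> bx by_; under [Z in bmeas _ Z]funext do rewrite fro_cV.
by apply: bmeas_sum => i _; apply: bmeasM.
Qed.

Lemma bmx_nrm_bound g N (x : Omega -> 'cV[R]_N) : bmx g x -> exists M : R, forall w, nrm (x w) <= M.
Proof.
move=> bx; have [_ [M hM]] := bmeas_fro bx bx.
exists (Num.sqrt M) => w; rewrite ler_wsqrtr //.
by apply: le_trans (hM w); rewrite ler_norm.
Qed.

Lemma smeas_nrm g N (x : Omega -> 'cV[R]_N) : bmx g x -> smeas g (fun w => nrm (x w)).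
Proof.
move=> bx; apply: smeas_sqrt => [w|]; first exact: fro_ge0.
by have [] := bmeas_fro bx bx.
Qed.

Lemma bmeas_cosh_nrm g N (x : Omega -> 'cV[R]_N) : bmx g x -> bmeas g (fun w => cosh (nrm (x w))).
Proof.
move=> bx; split; first by apply: smeas_cosh; apply: smeas_nrm.
have [M hM] := bmx_nrm_bound bx; exists (cosh M) => w.
rewrite ger0_norm ?cosh_le ?nrm_ge0 //; exact/ltW/cosh_gt0.
Qed.

(** A coordinate of the gradient of [cosh |x|]. It is bounded because [|x_i| <= |x|], and division
    by zero gives the correct value 0 at the origin. *)
Lemma bmeas_sinh_coef g N (x : Omega -> 'cV[R]_N) i : bmx g x ->
  bmeas g (fun w => sinh (nrm (x w)) / nrm (x w) * x w i 0).
Proof.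
move=> bx; split.
  apply: smeasM; last by have [] := bx i 0.
  by apply: smeasM; [apply: smeas_sinh|apply: smeas_inv]; apply: smeas_nrm.
have [M hM] := bmx_nrm_bound bx; exists (cosh M) => w.
have n0 := nrm_ge0 (x w).
rewrite -mulrA normrM ger0_norm ?sinh_ge0 //.
rewrite -[X in _ <= X]mulr1 ler_pM ?sinh_ge0 //.
  by apply: le_trans (sinh_le_cosh _) _; rewrite cosh_le.
have [z|z] := eqVneq (nrm (x w)) 0; first by rewrite z invr0 mul0r normr0.
have zp : 0 < nrm (x w) by rewrite lt_def z.
by rewrite normrM normfV (gtr0_norm zp) mulrC ler_pdivrMr // mul1r norm_coord_le.
Qed.

Variables (m N : nat) (G : 'I_m -> set (set Omega)) (Z : 'I_m -> Omega -> 'cV[R]_N).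
Hypothesis Gm : forall l, G l `<=` measurable.
Hypothesis Gind : mutual_indep P (fun l => <<s G l >>).
Hypothesis Zm : forall l, bmx (G l) (Z l).
Hypothesis Zb : forall l w, nrm (Z l w) <= 4^-1.
Hypothesis EZ : forall l i, 'E (fun w => Z l w i 0) = 0.

Let lift g h : g `<=` measurable -> bmeas g h -> Bm h.
Proof. by move=> gm; apply: bmeas_mono => A /gm /sub_sigma_algebra. Qed.

Lemma bmx_sum_rest (s : seq 'I_m) l : l \notin s ->
  bmx (\bigcup_(k in [set k | k != l]) G k) (fun w => \sum_(k <- s) Z k w).
Proof.
move=> ls i j; under [T in bmeas _ T]funext do rewrite summxE big_seq.
apply: bmeas_sum => k ks; apply: bmeas_mono (Zm k i j) => A GA.
apply: sub_sigma_algebra; exists k => //=.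
by apply: contraNneq ls => <-.
Qed.

(** Adding one summand, [cosh_pinelis] leaves a term linear in [Z l] whose coefficients depend on
    the other summands only; it has mean zero by independence and centring. An induction over a
    duplicate-free list plays the part of the filtration. *)
Lemma cosh_nrm_sum_le (s : seq 'I_m) : uniq s ->
  'E (fun w => cosh (nrm (\sum_(k <- s) Z k w))) <=
  \prod_(k <- s) (1 + 'E (fun w => fro (Z k w) (Z k w))).
Proof.
elim: s => [_|l s IH /= /andP[ls us]].
  rewrite big_nil (_ : (fun w => _) = fun=> 1) ?Rexpect_cst //.
  apply/funext => w; rewrite big_nil /nrm /fro mulmx0 mxtrace0 sqrtr0.
  by rewrite /cosh oppr0 expR0; field.
rewrite big_cons.
set g1 := \bigcup_(k in [set k | k != l]) G k.
have gm1 : g1 `<=` measurable by move=> A [k _]; apply: Gm.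
have ind12 : indep P <<s g1 >> <<s G l >> by exact: mutual_indep_group.
pose x w := \sum_(k <- s) Z k w.
have bx : bmx g1 x by exact: bmx_sum_rest.
have bc := bmeas_cosh_nrm bx.
have bsq := bmeas_fro (Zm l) (Zm l).
have b1 : bmeas (G l) (fun w => 1 + fro (Z l w) (Z l w)).
  by apply: bmeasD => //; exact: bmeas_cst.
pose phi i w := sinh (nrm (x w)) / nrm (x w) * x w i 0.
have bphi i : bmeas g1 (phi i) by exact: bmeas_sinh_coef.
have bZ i : bmeas (G l) (fun w => Z l w i 0) by exact: Zm.
have bxZ : bmx measurable (fun w => Z l w + x w).
  apply: bmxD; first by apply: bmx_mono (Zm l) => A /Gm /sub_sigma_algebra.
  by apply: bmx_mono bx => A /gm1 /sub_sigma_algebra.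
have bU : Bm (fun w => cosh (nrm (x w)) * (1 + fro (Z l w) (Z l w))).
  by apply: bmeasM; [exact: lift bc|exact: lift b1].
have bV i : Bm (fun w => phi i w * Z l w i 0).
  by apply: bmeasM; [exact: lift (bphi i)|exact: lift (bZ i)].
apply: (@le_trans _ _ ('E (fun w => cosh (nrm (x w)) * (1 + fro (Z l w) (Z l w)) +
    \sum_i phi i w * Z l w i 0))).
  apply: le_Rexpect.
  - rewrite (_ : (fun w => _) = fun w => cosh (nrm (Z l w + x w))).
      by apply: bmeas_integrable; apply: bmeas_cosh_nrm.
    by apply/funext => w; rewrite big_cons.
  - by apply: bmeas_integrable; apply: bmeasD => //; apply: bmeas_sum => i _.
  move=> w; rewrite big_cons -/(x w).
  have -> : \sum_i phi i w * Z l w i 0 = sinh (nrm (x w)) / nrm (x w) * fro (x w) (Z l w).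
    by rewrite fro_cV mulr_sumr; apply: eq_bigr => i _; rewrite /phi mulrA.
  rewrite -(sqr_nrm (Z l w)); apply: cosh_pinelis; rewrite ?nrm_ge0 ?Zb ?norm_fro_le //.
  by rewrite !sqr_nrm !froDl !froDr (froC (x w)); ring.
rewrite RexpectD; [|exact: bmeas_integrable|]; last first.
  by apply: bmeas_integrable; apply: bmeas_sum => i _.
rewrite Rexpect_sum; last by move=> i _; apply: bmeas_integrable.
rewrite [X in _ + X]big1 ?addr0; last first.
  move=> i _; rewrite (Rexpect_mul_indep gm1 (@Gm l) ind12 (bphi i) (bZ i)).
  by rewrite EZ mulr0.
rewrite (Rexpect_mul_indep gm1 (@Gm l) ind12 bc b1) mulrC RexpectD; last 2 first.
- exact/bmeas_integrable/bmeas_cst.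
- exact/bmeas_integrable/(lift (@Gm l)).
rewrite Rexpect_cst; apply: ler_wpM2l; last exact: IH.
by rewrite addr_ge0 //; apply: Rexpect_ge0 => w; exact: fro_ge0.
Qed.

(** Markov's inequality for [cosh] of the norm, with [1 + y <= exp y] for each factor. The
    exponential parameter is already contained in the scaling of [Z]. *)
Lemma vector_deviation (v t : R) : \sum_l 'E (fun w => fro (Z l w) (Z l w)) <= v -> 0 <= t ->
  prb P [set w | t <= nrm (\sum_l Z l w)] <= 2 * expR (v - t).
Proof.
move=> hv t0.
have bS : bmx measurable (fun w => \sum_l Z l w).
  by apply: bmx_sum => l _; apply: bmx_mono (Zm l) => A /Gm /sub_sigma_algebra.
have bC := bmeas_cosh_nrm bS.
have me (f : Omega -> R) a : smeas measurable f -> measurable [set w | a <= f w].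
  move=> mf; have := smeas_ge a mf; apply: smallest_sub => //.
  exact: sigma_algebra_measurable.
apply: le_trans (prb_le P (B := [set w | cosh t <= cosh (nrm (\sum_l Z l w))]) _ _ _) _.
- by apply: me; apply: smeas_nrm.
- by apply: me; case: bC.
- by move=> w /= h; apply: cosh_le.
apply: le_trans (Rmarkov (bmeas_integrable P bC) _ (cosh_gt0 t) _) _.
- by move=> w; apply/ltW/cosh_gt0.
- by apply: me; case: bC.
rewrite ler_pdivrMr ?cosh_gt0 //.
apply: (@le_trans _ _ (expR v)).
  apply: le_trans (cosh_nrm_sum_le (index_enum_uniq _)) _.
  apply: (@le_trans _ _ (expR (\sum_l 'E (fun w => fro (Z l w) (Z l w))))); last by rewrite ler_expR.
  rewrite expR_sum; apply: ler_prod => l _.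
  rewrite expR_ge1Dx andbT addr_ge0 //; apply: Rexpect_ge0 => w; exact: fro_ge0.
have -> : expR v = 2 * expR (v - t) * (expR t / 2).
  by rewrite expRB; have := expR_gt0 t => et; field; rewrite gt_eqF.
by rewrite ler_wpM2l ?expR_le_cosh // mulr_ge0 ?expR_ge0.
Qed.

End VectorBernstein.

(** * Complex sign sums *)

Section ComplexModulus.
Context {R : realType}.
Local Notation C := R[i].
Local Notation rp := complex.Re.
Local Notation ip := complex.Im.
Implicit Types x y z : C.

Lemma rpD x y : rp (x + y) = rp x + rp y. Proof. by case: x; case: y. Qed.
Lemma ipD x y : ip (x + y) = ip x + ip y. Proof. by case: x; case: y. Qed.
Lemma rpN x : rp (- x) = - rp x. Proof. by case: x. Qed.
Lemma ipN x : ip (- x) = - ip x. Proof. by case: x. Qed.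
Lemma rpM x y : rp (x * y) = rp x * rp y - ip x * ip y. Proof. by case: x; case: y. Qed.
Lemma ipM x y : ip (x * y) = rp x * ip y + ip x * rp y. Proof. by case: x; case: y. Qed.
Lemma rpJ x : rp (conjc x) = rp x. Proof. by case: x. Qed.
Lemma ipJ x : ip (conjc x) = - ip x. Proof. by case: x. Qed.

Lemma rp_sum I (r : seq I) (Q : pred I) (F : I -> C) :
  rp (\sum_(i <- r | Q i) F i) = \sum_(i <- r | Q i) rp (F i).
Proof.
elim: r => [|i r IH]; first by rewrite !big_nil.
by rewrite !big_cons; case: ifP => // _; rewrite rpD IH.
Qed.

Lemma ip_sum I (r : seq I) (Q : pred I) (F : I -> C) :
  ip (\sum_(i <- r | Q i) F i) = \sum_(i <- r | Q i) ip (F i).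
Proof.
elim: r => [|i r IH]; first by rewrite !big_nil.
by rewrite !big_cons; case: ifP => // _; rewrite ipD IH.
Qed.

Lemma complex_eq x y : rp x = rp y -> ip x = ip y -> x = y.
Proof. by case: x => a b; case: y => c d /= -> ->. Qed.

Lemma cabs_ge0 x : 0 <= cabs x.
Proof. by case: x => a b; exact: sqrtr_ge0. Qed.

Lemma sqr_cabs x : cabs x ^+ 2 = rp x ^+ 2 + ip x ^+ 2.
Proof. by case: x => a b; rewrite sqr_sqrtr //= addr_ge0 ?sqr_ge0. Qed.

Lemma cabsE x : cabs x = Num.sqrt (rp x ^+ 2 + ip x ^+ 2).
Proof. by case: x. Qed.

Lemma cabsM x y : cabs (x * y) = cabs x * cabs y.
Proof. exact: ComplexField.Normc.normcM. Qed.

Lemma cabs0 : cabs (0 : C) = 0.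
Proof. exact: ComplexField.Normc.normc0. Qed.

Lemma cabs_eq0 x : cabs x = 0 -> x = 0.
Proof. exact: ComplexField.Normc.eq0_normc. Qed.

Lemma cabsN x : cabs (- x) = cabs x.
Proof. by rewrite !cabsE rpN ipN !sqrrN. Qed.

Lemma cabsJ x : cabs (conjc x) = cabs x.
Proof. by rewrite !cabsE rpJ ipJ sqrrN. Qed.

Lemma rp_le_cabs x : rp x <= cabs x.
Proof.
apply: le_trans (ler_norm _) _; rewrite cabsE -sqrtr_sqr ler_wsqrtr //.
by rewrite lerDl sqr_ge0.
Qed.

Lemma norm_rp_le x : `|rp x| <= cabs x.
Proof. by rewrite cabsE -sqrtr_sqr ler_wsqrtr // lerDl sqr_ge0. Qed.

Lemma norm_ip_le x : `|ip x| <= cabs x.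
Proof. by rewrite cabsE -sqrtr_sqr ler_wsqrtr // lerDr sqr_ge0. Qed.

Lemma le_cabs_sum I (r : seq I) (Q : pred I) (F : I -> C) :
  cabs (\sum_(i <- r | Q i) F i) <= \sum_(i <- r | Q i) cabs (F i).
Proof.
elim: r => [|i r IH]; first by rewrite !big_nil cabs0.
rewrite !big_cons; case: ifP => // _; apply: le_trans (le_normcD _ _) _.
by rewrite lerD2l.
Qed.

Lemma le_cabsD x y : cabs (x + y) <= cabs x + cabs y.
Proof. exact: le_normcD. Qed.

Lemma cosh_cabs_sym x y :
  cosh (cabs (x + y)) + cosh (cabs (x - y)) <= 2 * (cosh (cabs x) * cosh (cabs y)).
Proof.
apply: (@cosh_symmetric_sum _ _ _ (rp x * rp y + ip x * ip y)); rewrite ?cabs_ge0 //.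
- rewrite -sqrtr_sqr -[X in _ <= X]ger0_norm ?mulr_ge0 ?cabs_ge0 // -sqrtr_sqr ler_wsqrtr //.
  rewrite exprMn !sqr_cabs -subr_ge0.
  have -> : (rp x ^+ 2 + ip x ^+ 2) * (rp y ^+ 2 + ip y ^+ 2) - (rp x * rp y + ip x * ip y) ^+ 2
     = (rp x * ip y - ip x * rp y) ^+ 2 by ring.
  exact: sqr_ge0.
- by rewrite !sqr_cabs rpD ipD; ring.
- by rewrite !sqr_cabs rpD ipD rpN ipN; ring.
Qed.

End ComplexModulus.

Section SignAverage.
Context {R : realType}.
Local Notation C := R[i].
Variables (K : finType) (flip : K -> K) (g : K -> C) (s : nat).
Hypothesis flipK : involutive flip.
Hypothesis gflip : forall k, g (flip k) = - g k.
Hypothesis g1 : forall k, cabs (g k) = 1.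
Local Notation F := {ffun 'I_s -> K}.

Definition flip_at (i : 'I_s) (k : F) : F := [ffun j => if j == i then flip (k j) else k j].

Lemma flip_atK i : involutive (flip_at i).
Proof.
by move=> k; apply/ffunP => j; rewrite !ffunE; case: eqP => // _; rewrite flipK.
Qed.

(** Flipping coordinate [i] permutes the grid, so the sum may be averaged over the signs of the term
    [c i]. The remaining sum is unaffected, [i] occurring once in the list, and [cosh_cabs_sym]
    splits off one factor. *)
Lemma sum_cosh_signs (c : 'I_s -> C) (r : seq 'I_s) : uniq r ->
  \sum_(k : F) cosh (cabs (\sum_(i <- r) c i * g (k i))) <=
  #|{: F}|%:R * \prod_(i <- r) cosh (cabs (c i)).
Proof.
elim: r => [_|i r IH /= /andP[ir ur]].
  rewrite big_nil mulr1 (eq_bigr (fun=> 1)) ?sumr_const ?cardT -?cardE //.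
  by move=> k _; rewrite big_nil cabs0 /cosh oppr0 expR0; field.
rewrite big_cons mulrCA; apply: le_trans (ler_wpM2l (ltW (cosh_gt0 _)) (IH ur)).
rewrite mulr_sumr -(ler_pM2l (ltr0Sn R 1)) [X in X <= _]mulr_natl [X in X <= _]mulr2n.
rewrite {2}(reindex_inj (inv_inj (flip_atK i))) -big_split /= mulr_sumr.
apply: ler_sum => k _; rewrite !big_cons ffunE eqxx gflip mulrN.
have -> : \sum_(j <- r) c j * g (flip_at i k j) = \sum_(j <- r) c j * g (k j).
  rewrite big_seq [RHS]big_seq; apply: eq_bigr => j jr; rewrite ffunE.
  by case: eqP jr => // ->; rewrite (negbTE ir).
set T := \sum_(j <- r) _.
have := cosh_cabs_sym T (c i * g (k i)).
by rewrite cabsM g1 mulr1 (addrC T) (addrC T (- _)) [cosh (cabs T) * _]mulrC.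
Qed.

(** Hoeffding's inequality in counting form: Markov's argument on the uniform measure of the grid,
    with [lam] inserted in the coefficients. *)
Lemma sign_tail (c : 'I_s -> C) (lam th : R) : 0 <= lam -> 0 <= th ->
  \sum_(k : F) (th <= cabs (\sum_i c i * g (k i)))%R%:R <=
  #|{: F}|%:R * (2 * expR (lam ^+ 2 * (\sum_i cabs (c i) ^+ 2) / 2 - lam * th)).
Proof.
move=> lam0 th0.
pose cl : 'I_s -> C := fun i => (lam +i* 0)%C * c i.
have cabs_lam z : cabs ((lam +i* 0)%C * z) = lam * cabs z.
  by rewrite cabsM [cabs (_ +i* _)%C]cabsE /= expr0n addr0 sqrtr_sqr ger0_norm.
have h := @sum_cosh_signs cl (index_enum 'I_s) (index_enum_uniq _).
have h2 : \prod_i cosh (cabs (cl i)) <= expR (lam ^+ 2 * (\sum_i cabs (c i) ^+ 2) / 2).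
  rewrite -mulrA mulr_suml mulr_sumr expR_sum; apply: ler_prod => i _.
  rewrite (ltW (cosh_gt0 _)) /=; apply: le_trans (cosh_le_expR_sqr _) _.
  by rewrite cabs_lam ler_expR exprMn mulrA.
have h3 := le_trans h (ler_wpM2l (ler0n R #|{: F}|) h2).
have step k : (th <= cabs (\sum_i c i * g (k i)))%R%:R * (expR (lam * th) / 2) <=
   cosh (cabs (\sum_i cl i * g (k i))) :> R.
  have [hk|_] := boolP (th <= cabs (\sum_i c i * g (k i))); last by rewrite mul0r ltW ?cosh_gt0.
  rewrite mul1r; apply: le_trans (expR_le_cosh _) _.
  have -> : \sum_i cl i * g (k i) = (lam +i* 0)%C * \sum_i c i * g (k i).
    by rewrite mulr_sumr; apply: eq_bigr => i _; rewrite mulrA.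
  by rewrite cabs_lam cosh_le ?mulr_ge0 // ler_wpM2l.
have h4 : (\sum_(k : F) (th <= cabs (\sum_i c i * g (k i)))%R%:R) * (expR (lam * th) / 2) <=
   #|{: F}|%:R * expR (lam ^+ 2 * (\sum_i cabs (c i) ^+ 2) / 2).
  by rewrite mulr_suml; apply: le_trans h3; apply: ler_sum => k _; exact: step.
have e0 : 0 < expR (lam * th) / 2 by rewrite divr_gt0 ?expR_gt0.
rewrite -(ler_pM2r e0); apply: le_trans h4 _.
rewrite expRB -[X in _ <= X]mulrA ler_wpM2l // le_eqVlt; apply/orP; left; apply/eqP.
by field; rewrite gt_eqF ?expR_gt0.
Qed.

End SignAverage.

(** * Complex matrices as real ones *)

Section Realification.
Context {R : realType}.
Local Notation C := R[i].
Local Notation rp := complex.Re.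
Local Notation ip := complex.Im.

Definition mxre p q (M : 'M[C]_(p, q)) : 'M[R]_(p, q) := \matrix_(i, j) rp (M i j).
Definition mxim p q (M : 'M[C]_(p, q)) : 'M[R]_(p, q) := \matrix_(i, j) ip (M i j).

(** The embedding of complex matrices in real ones of twice the size: multiplicative, with the
    adjoint becoming the transpose, so the real trace inequalities apply. *)
Definition rmx p q (M : 'M[C]_(p, q)) : 'M[R]_(p + p, q + q) :=
  block_mx (mxre M) (- mxim M) (mxim M) (mxre M).
Definition rvec q (z : 'cV[C]_q) : 'cV[R]_(q + q) := col_mx (mxre z) (mxim z).

Lemma mxreM p q r (M : 'M[C]_(p, q)) (N : 'M[C]_(q, r)) :
  mxre (M *m N) = mxre M *m mxre N - mxim M *m mxim N.
Proof.
apply/matrixP => i j; rewrite !mxE rp_sum -sumrB; apply: eq_bigr => k _.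
by rewrite !mxE rpM.
Qed.

Lemma mximM p q r (M : 'M[C]_(p, q)) (N : 'M[C]_(q, r)) :
  mxim (M *m N) = mxre M *m mxim N + mxim M *m mxre N.
Proof.
apply/matrixP => i j; rewrite !mxE ip_sum -big_split; apply: eq_bigr => k _ /=.
by rewrite !mxE ipM.
Qed.

Lemma rmxM p q r (M : 'M[C]_(p, q)) (N : 'M[C]_(q, r)) : rmx (M *m N) = rmx M *m rmx N.
Proof.
rewrite /rmx mulmx_block mxreM mximM !(mulmxN, mulNmx); congr block_mx.
- by rewrite opprD.
- by rewrite addrC.
- by rewrite addrC.
Qed.

Lemma rvecM p q (M : 'M[C]_(p, q)) (z : 'cV[C]_q) : rvec (M *m z) = rmx M *m rvec z.
Proof.
rewrite /rvec /rmx mul_block_col mxreM mximM mulNmx; congr col_mx.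
by rewrite addrC.
Qed.

Lemma rmx_adj p q (M : 'M[C]_(p, q)) : rmx (mx_adj M) = (rmx M)^T.
Proof.
rewrite /rmx tr_block_mx; congr block_mx; apply/matrixP => i j; rewrite !mxE ?rpJ ?ipJ //.
by rewrite opprK.
Qed.

Lemma rvec_surj q (u : 'cV[R]_(q + q)) : exists z : 'cV[C]_q, rvec z = u.
Proof.
exists (\col_i (usubmx u i 0 +i* dsubmx u i 0)%C).
rewrite -[RHS]vsubmxK; congr col_mx; apply/matrixP => i j; rewrite !mxE /=;
  by rewrite (ord1 j).
Qed.

Lemma fro_rvec q (y z : 'cV[C]_q) :
  fro (rvec y) (rvec z) = \sum_i rp (conjc (y i 0) * z i 0).
Proof.
rewrite fro_cV big_split_ord /= -big_split; apply: eq_bigr => i _ /=.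
by rewrite !col_mxEu !col_mxEd !mxE rpM rpJ ipJ mulNr opprK.
Qed.

Lemma fro_rvec_sqr q (z : 'cV[C]_q) : fro (rvec z) (rvec z) = \sum_i cabs (z i 0) ^+ 2.
Proof.
rewrite fro_rvec; apply: eq_bigr => i _.
by rewrite rpM rpJ ipJ sqr_cabs mulNr opprK -!expr2.
Qed.

Lemma rvec_eq0 q (z : 'cV[C]_q) : rvec z = 0 -> z = 0.
Proof.
move=> h; have := fro_rvec_sqr z; rewrite h /fro mulmx0 mxtrace0 => /esym/eqP.
rewrite psumr_eq0; last by move=> i _; rewrite sqr_ge0.
move=> /allP H; apply/matrixP => i j; rewrite (ord1 j) mxE.
have := H i (mem_index_enum _); rewrite /= sqrf_eq0 => /eqP.
exact: cabs_eq0.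
Qed.

(** Schur's test: [|z_i| |z_j|] is at most the mean of the squares, and by hermitian symmetry column
    sums of moduli equal row sums, so both halves are bounded by [T]. *)
Lemma schur_hermitian q (M : 'M[C]_q) (T : R) (u : 'cV[R]_(q + q)) :
  mx_adj M = M -> (forall i, \sum_j cabs (M i j) <= T) ->
  fro u (rmx M *m u) <= T * fro u u.
Proof.
move=> hM hT; have [z <-] := rvec_surj u; rewrite -rvecM fro_rvec fro_rvec_sqr.
have Msym i j : cabs (M i j) = cabs (M j i).
  by rewrite -[in LHS]hM !mxE cabsJ.
apply: (@le_trans _ _ (\sum_i \sum_j cabs (M i j) * ((cabs (z i 0) ^+ 2 + cabs (z j 0) ^+ 2) / 2))).
  apply: ler_sum => i _; rewrite mxE mulr_sumr rp_sum; apply: ler_sum => j _.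
  apply: le_trans (rp_le_cabs _) _; rewrite !cabsM cabsJ mulrCA ler_wpM2l ?cabs_ge0 //.
  have := sqr_ge0 (cabs (z i 0) - cabs (z j 0)); rewrite sqrrB; lra.
have -> : \sum_i \sum_j cabs (M i j) * ((cabs (z i 0) ^+ 2 + cabs (z j 0) ^+ 2) / 2) =
   \sum_i (\sum_j cabs (M i j)) * cabs (z i 0) ^+ 2.
  have -> : \sum_i \sum_j cabs (M i j) * ((cabs (z i 0) ^+ 2 + cabs (z j 0) ^+ 2) / 2) =
     (\sum_i \sum_j cabs (M i j) * cabs (z i 0) ^+ 2) / 2 +
     (\sum_i \sum_j cabs (M i j) * cabs (z j 0) ^+ 2) / 2.
    rewrite -mulrDl -big_split mulr_suml; apply: eq_bigr => i _ /=.
    rewrite -big_split mulr_suml; apply: eq_bigr => j _ /=; by field.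
  have -> : \sum_i \sum_j cabs (M i j) * cabs (z j 0) ^+ 2 =
            \sum_i \sum_j cabs (M i j) * cabs (z i 0) ^+ 2.
    by rewrite exchange_big; apply: eq_bigr => j _; apply: eq_bigr => i _; rewrite Msym.
  rewrite -mulrDl -mulr2n -[X in X / 2]mulr_natr mulfK //.
  by apply: eq_bigr => i _; rewrite mulr_suml.
rewrite mulr_sumr; apply: ler_sum => i _.
by rewrite ler_wpM2r ?sqr_ge0.
Qed.

Lemma fro_cols m n (A B : 'M[R]_(m, n)) : fro A B = \sum_j fro (col j A) (col j B).
Proof.
rewrite froE exchange_big; apply: eq_bigr => j _; rewrite fro_cV.
by apply: eq_bigr => i _; rewrite !mxE.
Qed.

Lemma opnorm_mx m n q (A : 'M[R]_(m, n)) (b : R) :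
  (forall u : 'cV[R]_n, fro (A *m u) (A *m u) <= b * fro u u) ->
  forall W : 'M[R]_(n, q), fro (A *m W) (A *m W) <= b * fro W W.
Proof.
move=> h W; rewrite fro_cols (fro_cols W) mulr_sumr; apply: ler_sum => j _.
by rewrite (_ : col j (A *m W) = A *m col j W) // !colE mulmxA.
Qed.

(** With [u = A^T y] one has [|u|^2 = <y, A u>]; Cauchy-Schwarz and the bound on [A] give
    [|u|^4 <= b |y|^2 |u|^2]. *)
Lemma opnorm_tr m n (A : 'M[R]_(m, n)) (b : R) : 0 <= b ->
  (forall u : 'cV[R]_n, fro (A *m u) (A *m u) <= b * fro u u) ->
  forall y : 'cV[R]_m, fro (A^T *m y) (A^T *m y) <= b * fro y y.
Proof.
move=> b0 h y; set u := A^T *m y.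
have [u0|u0] := eqVneq (fro u u) 0.
  by rewrite u0 mulr_ge0 ?fro_ge0.
have up : 0 < fro u u by rewrite lt_def u0 fro_ge0.
have e : fro u u = fro y (A *m u) by rewrite {1}/u fro_mull trmxK.
have := fro_CS y (A *m u); rewrite -e => h1.
have := ler_wpM2l (fro_ge0 y) (h u) => h2.
have := le_trans h1 h2; rewrite expr2 mulrCA mulrA ler_pM2r //; by rewrite mulrC.
Qed.

End Realification.

(** * The dual certificate *)

Section Certificate.
Context {R : realType}.
Local Notation C := R[i].
Local Notation rp := complex.Re.
Local Notation ip := complex.Im.

Lemma colSE p n (S : {set 'I_n}) (M : 'M[C]_(p, n)) i k : colS S M i k = M i (enum_val k).
Proof.
rewrite /colS mxE (bigD1 (enum_val k)) //= big1 ?addr0 => [|j jk].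
  by rewrite !mxE eqxx conjc1 mulr1.
by rewrite !mxE (negbTE jk) conjc0 mulr0.
Qed.

Lemma mx_adjE p q (M : 'M[C]_(p, q)) i j : mx_adj M i j = conjc (M j i).
Proof. by rewrite !mxE. Qed.

Lemma colS_mulmx p q n (S : {set 'I_n}) (A : 'M[C]_(p, q)) (M : 'M[C]_(q, n)) :
  colS S (A *m M) = A *m colS S M.
Proof. by rewrite /colS mulmxA. Qed.

Lemma mx_adjM p q r (M : 'M[C]_(p, q)) (N : 'M[C]_(q, r)) :
  mx_adj (M *m N) = mx_adj N *m mx_adj M.
Proof. by rewrite /mx_adj map_mxM trmx_mul. Qed.

Lemma mx_adjK p q (M : 'M[C]_(p, q)) : mx_adj (mx_adj M) = M.
Proof. by apply/matrixP => i j; rewrite !mxE conjcK. Qed.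

Lemma adj_mulE q (y z : 'cV[C]_q) : (mx_adj y *m z) 0 0 = \sum_i conjc (y i 0) * z i 0.
Proof. by rewrite mxE; apply: eq_bigr => i _; rewrite !mxE. Qed.

Lemma conj_csgn_mul (z : C) : rp (conjc (csgn z) * z) = cabs z.
Proof.
rewrite /csgn; case: eqP => [->|/eqP z0]; first by rewrite mulr0 cabs0.
have cz : cabs z != 0 by apply: contra z0 => /eqP /cabs_eq0 ->.
have -> : z / (cabs z +i* 0)%C = ((rp z / cabs z) +i* (ip z / cabs z))%C.
  apply: (mulIf (x := (cabs z +i* 0)%C)).
    by apply/eqP => -[h]; rewrite h eqxx in cz.
  rewrite divfK; last by apply/eqP => -[h]; rewrite h eqxx in cz.
  by apply: complex_eq; rewrite ?rpM ?ipM /= ?mulr0 ?subr0 ?add0r ?divfK.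
rewrite rpM rpJ ipJ /= mulNr opprK.
by apply: (mulIf cz); rewrite -expr2 sqr_cabs; field.
Qed.

Lemma cabs_csgn_le1 (z : C) : cabs (csgn z) <= 1.
Proof.
rewrite /csgn; case: eqP => [_|/eqP z0]; first by rewrite cabs0.
have cz : cabs z != 0 by apply: contra z0 => /eqP /cabs_eq0 ->.
rewrite cabsM [cabs (_^-1)]ComplexField.Normc.normcV -/(cabs _) [cabs (_ +i* _)%C]cabsE /=.
by rewrite expr0n addr0 sqrtr_sqr ger0_norm ?cabs_ge0 // divff.
Qed.

Lemma unitmx_of_injective (F : fieldType) q (G : 'M[F]_q) : (forall u : 'cV[F]_q, G *m u = 0 -> u = 0) -> G \in unitmx.
Proof.
move=> inj; rewrite -unitmx_tr -row_free_unit -kermx_eq0; apply/eqP/row_matrixP => i.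
rewrite row0; apply: trmx_inj; rewrite trmx0; apply: inj.
apply: trmx_inj; rewrite trmx_mul trmxK trmx0.
by apply/sub_kermxP; rewrite row_sub.
Qed.

(* Fuchs' sufficient condition, with the dual certificate [A^* A_S G^-1 sgn(x_S)]. *)
Lemma certificate_unique_minimizer M n (A : 'M[C]_(M, n)) (S : {set 'I_n}) (x : 'cV[C]_n)
    (G := mx_adj (colS S A) *m colS S A) (c : 'I_n -> 'cV[C]_#|S|) :
  (forall i, i \notin S -> x i 0 = 0) -> G \in unitmx ->
  (forall j, j \notin S -> G *m c j = mx_adj (colS S A) *m col j A) ->
  (forall j, j \notin S ->
     cabs (\sum_k conjc (c j k 0) * csgn (x (enum_val k) 0)) < 1) ->
  BP_unique_minimizer A x.
Proof.
move=> xS Gu Gc hc z Az zx.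
pose sg : 'cV[C]_#|S| := \col_k csgn (x (enum_val k) 0).
pose w := invmx G *m sg; pose h := colS S A *m w; pose u := mx_adj A *m h.
have Gw : G *m w = sg by rewrite /w mulmxA mulmxV // mul1mx.
have Gh : mx_adj G = G by rewrite /G mx_adjM mx_adjK.
have uS (k : 'I_#|S|) : u (enum_val k) 0 = csgn (x (enum_val k) 0).
  have -> : u (enum_val k) 0 = (mx_adj (colS S A) *m h) k 0.
    rewrite [LHS]mxE [RHS]mxE; apply: eq_bigr => i _.
    by rewrite !mx_adjE colSE.
  by rewrite /h mulmxA -/G Gw mxE.
have uSc j : j \notin S -> cabs (u j 0) < 1.
  move=> jS; have -> : u j 0 = \sum_k conjc (c j k 0) * csgn (x (enum_val k) 0); last exact: hc.
  have -> : u j 0 = (mx_adj (col j A) *m h) 0 0.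
    by rewrite !mxE; apply: eq_bigr => i _; rewrite !mxE.
  rewrite /h mulmxA -[colS S A]mx_adjK -mx_adjM -Gc // mx_adjM Gh -mulmxA Gw adj_mulE.
  by apply: eq_bigr => k _; rewrite mxE.
have uS' j : j \in S -> u j 0 = csgn (x j 0).
  by move=> jS; have := uS (enum_rank_in jS j); rewrite enum_rankK_in.
have u1 j : cabs (u j 0) <= 1.
  have [jS|jS] := boolP (j \in S); first by rewrite uS' // cabs_csgn_le1.
  exact/ltW/uSc.
have pair y : (mx_adj u *m y) 0 0 = (mx_adj h *m (A *m y)) 0 0.
  by rewrite /u mx_adjM mx_adjK mulmxA.
have l1x : l1norm x = \sum_i rp (conjc (u i 0) * x i 0).
  apply: eq_bigr => i _; have [iS|iS] := boolP (i \in S); first by rewrite uS' // conj_csgn_mul.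
  by rewrite xS // mulr0 cabs0.
have e : l1norm x = \sum_i rp (conjc (u i 0) * z i 0).
  by rewrite l1x -!rp_sum -!adj_mulE !pair Az.
have le_i i : rp (conjc (u i 0) * z i 0) <= cabs (z i 0).
  apply: le_trans (rp_le_cabs _) _; rewrite cabsM cabsJ -[X in _ <= X]mul1r.
  by rewrite ler_wpM2r ?cabs_ge0.
have [j /andP[jS zj]|zS] := pickP (fun j => (j \notin S) && (z j 0 != 0)).
  rewrite e /l1norm (bigD1 j) //= [X in _ < X](bigD1 j) //=.
  apply: ltr_leD; last by apply: ler_sum => i _; exact: le_i.
  apply: le_lt_trans (rp_le_cabs _) _; rewrite cabsM cabsJ -[X in _ < X]mul1r.
  rewrite ltr_pM2r ?uSc // lt_def cabs_ge0 andbT.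
  by apply: contra zj => /eqP /cabs_eq0 ->.
exfalso; apply: zx.
have zS' j : j \notin S -> z j 0 = 0.
  by move=> jS; have := zS j; rewrite jS /= => /negbFE /eqP.
pose v : 'cV[C]_#|S| := \col_k (z (enum_val k) 0 - x (enum_val k) 0).
have Av : colS S A *m v = 0.
  have : A *m (z - x) = 0 by rewrite mulmxBr Az subrr.
  move=> <-; apply/matrixP => i j; rewrite (ord1 j) [LHS]mxE [RHS]mxE.
  rewrite [RHS](bigID (fun k => k \in S)) /= [X in _ = _ + X]big1 ?addr0; last first.
    by move=> k kS; rewrite !mxE zS' // xS // subrr mulr0.
  rewrite (big_enum_val (fun k => A i k * (z - x) k 0)) /=.
  by apply: eq_bigr => k _; rewrite colSE; congr (_ * _); rewrite !mxE.
have v0 : v = 0.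
  by rewrite -[v]mul1mx -(mulVmx Gu) -mulmxA /G -(mulmxA _ _ v) Av !mulmx0.
apply/matrixP => i j; rewrite (ord1 j).
have [iS|iS] := boolP (i \in S); last by rewrite zS' // xS.
have := congr1 (fun y : 'cV[C]_#|S| => y (enum_rank_in iS i) 0) v0.
by rewrite !mxE enum_rankK_in // => /subr0_eq.
Qed.

End Certificate.

(** * Discretisation of the random signs *)

Section Grid.
Context {R : realType} {d : measure_display} {Omega : measurableType d}.
Variable P : probability Omega R.
Local Notation C := R[i].
Local Notation rp := complex.Re.
Local Notation ip := complex.Im.

(** The generating family inside [gen_sigma]: [<<s gens fs >>] is [gen_sigma fs] by unfolding, so
    the independence assumptions carry over by conversion. *)
Definition gens (fs : set (Omega -> R)) : set (set Omega) :=
  [set E | exists f B, [/\ fs f, measurable B & E = f @^-1` B]].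

Lemma smeas_gens (fs : set (Omega -> R)) f : fs f -> smeas (gens fs) f.
Proof.
by move=> hf _ B mB; rewrite setTI; apply: sub_sigma_algebra; exists f, B.
Qed.

Lemma gens_measurable (fs : set (Omega -> R)) :
  (forall f, fs f -> measurable_fun setT f) -> gens fs `<=` measurable.
Proof. by move=> h _ [f [B [hf mB ->]]]; rewrite -[X in measurable X]setTI; apply: h. Qed.

Lemma prb_bigcup_disjoint (I : finType) (A : I -> set Omega) : (forall i, measurable (A i)) ->
  (forall i j w, A i w -> A j w -> i = j) ->
  prb P (\bigcup_i A i) = \sum_i prb P (A i).
Proof.
move=> mA dA; under eq_bigr => i _ do rewrite -Rexpect_indic //.
have mU : measurable (\bigcup_i A i) by apply: fin_bigcup_measurable.
rewrite -Rexpect_indic // -Rexpect_sum; last first.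
  by move=> i _; apply: bmeas_integrable; apply: bmeas_indic; exact: sub_sigma_algebra.
congr (Rexpect P _); apply/funext => w; rewrite indicE.
case: (boolP (w \in _)) => [|wU].
  rewrite inE => -[i _ Aiw]; rewrite (bigD1 i) //= indicE mem_set //= big1 ?addr0 // => j ji.
  rewrite indicE memNset // => Ajw; by rewrite (dA _ _ _ Ajw Aiw) eqxx in ji.
rewrite big1 // => i _; rewrite indicE memNset // => Aiw.
by move/negP: wU; apply; rewrite inE; exists i.
Qed.

Variables (n : nat) (S : {set 'I_n}) (s : Omega -> 'I_n -> C).
Definition sign_gens := gens (\bigcup_(i in [set i | i \in S]) Ccoords (fun w => s w i)).
Hypothesis sm : sign_gens `<=` measurable.

(* The signs are discretised: [E k] is the event that every sign lies in the cell
   around the grid point [g]; the cells have equal probability and cover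
   almost everything. *)
Definition sign_grid (eta : R) (K : finType) (flip : K -> K) (g : K -> C)
    (E : {ffun 'I_#|S| -> K} -> set Omega) : Prop :=
  [/\ involutive flip /\ (forall k, g (flip k) = - g k), forall k, cabs (g k) = 1,
      forall k, <<s sign_gens >> (E k) /\ prb P (E k) = #|{: {ffun 'I_#|S| -> K}}|%:R^-1,
      prb P (\bigcup_k E k) = 1 &
      forall k w i, E k w -> cabs (s w (enum_val i) - g (k i)) <= eta].

Lemma smeas_sign_re i : i \in S -> smeas sign_gens (fun w => rp (s w i)).
Proof. by move=> iS; apply: smeas_gens; exists i => //; left. Qed.

Lemma smeas_sign_im i : i \in S -> smeas sign_gens (fun w => ip (s w i)).
Proof. by move=> iS; apply: smeas_gens; exists i => //; right. Qed.

(** The sign laws are tested against functions on all of ['I_n], whereas grid points are indexed by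
    the elements of [S]; the default [k0] is used off [S]. *)
Definition extend_ord (K : Type) (k0 : K) (k : 'I_#|S| -> K) (i : 'I_n) : K :=
  if [pick j | enum_val j == i] is Some j then k j else k0.

Lemma extend_ordE (K : Type) (k0 : K) (k : 'I_#|S| -> K) j :
  extend_ord k0 k (enum_val j) = k j.
Proof.
rewrite /extend_ord; case: pickP => [j' /eqP /enum_val_inj -> //|/(_ j)].
by rewrite eqxx.
Qed.

Lemma sign_bigcap (A : 'I_n -> set Omega) : (forall i, i \in S -> <<s sign_gens >> (A i)) ->
  <<s sign_gens >> [set w | forall i, i \in S -> A i w].
Proof.
move=> hA.
have -> : [set w | forall i, i \in S -> A i w] =
    \bigcap_(i in [set: 'I_n]) (if i \in S then A i else setT).
  apply/seteqP; split => [w h i _|w h i iS]; first by case: ifP => // /h.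
  by have := h i I; rewrite iS.
apply: (@fin_bigcap_measurable _ (g_sigma_algebraType sign_gens)) => //.
by move=> i _; case: ifP => [/hA //|_]; exact: (@measurableT _ (g_sigma_algebraType sign_gens)).
Qed.

Lemma card_ffun_inv (K : finType) :
  #|{: {ffun 'I_#|S| -> K}}|%:R^-1 = #|K|%:R^-1 ^+ #|S| :> R.
Proof. by rewrite card_ffun card_ord natrX exprVn. Qed.

Lemma sign_measurable A : <<s sign_gens >> A -> measurable A.
Proof. by apply: smallest_sub => //; exact: sigma_algebra_measurable. Qed.

(** The cells are the atoms themselves, so rounding is exact and the [2 ^ #|S|] disjoint cells carry
    the whole mass. *)
Lemma rademacher_grid eta : 0 <= eta -> rademacher P S s ->
  exists (K : finType) (flip : K -> K) (g : K -> C) E, @sign_grid eta K flip g E.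
Proof.
move=> eta0 rad; pose g (b : bool) : C := (-1) ^+ b.
pose e (k : {ffun 'I_#|S| -> bool}) := extend_ord false k.
pose E (k : {ffun 'I_#|S| -> bool}) := [set w | forall i, i \in S -> s w i = (-1) ^+ e k i].
have E_val k w j : E k w -> s w (enum_val j) = g (k j).
  by move=> /(_ _ (enum_valP j)); rewrite /e extend_ordE.
have mE k : <<s sign_gens >> (E k).
  apply: sign_bigcap => i iS.
  have -> : (fun w => s w i = (-1) ^+ e k i) =
     ((fun w => rp (s w i)) @^-1` [set rp ((-1 : C) ^+ e k i)]) `&`
     ((fun w => ip (s w i)) @^-1` [set ip ((-1 : C) ^+ e k i)]).
    apply/seteqP; split => [w /= -> //|w /= [h1 h2]]; exact: complex_eq.
  apply: (@measurableI _ (g_sigma_algebraType sign_gens)); apply: smeas_preim => //.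
  - exact: smeas_sign_re.
  - exact: smeas_sign_im.
have pE k : prb P (E k) = #|{: {ffun 'I_#|S| -> bool}}|%:R^-1.
  by rewrite card_ffun_inv card_bool; exact: rad.
have g1 k : cabs (g k) = 1.
  case: k; rewrite /g ?expr0 ?expr1 ?cabsN; exact: ComplexField.Normc.normc1.
exists bool, negb, g, E; split => //.
- by split=> [|k]; [exact: negbK|case: k; rewrite /g /= ?expr0 ?expr1 ?opprK].
- rewrite prb_bigcup_disjoint.
  + rewrite (eq_bigr _ (fun k _ => pE k)) sumr_const -[X in X *+ _]mul1r -mulrnAr.
    rewrite -[_^-1 *+ _]mulr_natl mulfV ?mulr1 // pnatr_eq0.
    by rewrite card_ffun card_bool expn_eq0.
  + by move=> k; exact: sign_measurable.
  move=> k k' w Ek Ek'; apply/ffunP => j.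
  have := E_val _ _ j Ek; rewrite (E_val _ _ j Ek') /g.
  case: (k j); case: (k' j) => //; rewrite ?expr0 ?expr1 => /(congr1 (fun z : C => rp z)) /=; lra.
- by move=> k w j Ek; rewrite (E_val _ _ j Ek) subrr cabs0.
Qed.

Definition cexp (t : R) : C := (cos t +i* sin t)%C.

Lemma cabs_cexp t : cabs (cexp t) = 1.
Proof. by rewrite cabsE /= cos2Dsin2 sqrtr1. Qed.

Lemma cexp_lipschitz (a b : R) : a <= b -> cabs (cexp b - cexp a) <= 2 * (b - a).
Proof.
move=> ab.
have L (f df : R -> R) : (forall x : R, is_derive x (1 : R) f (df x)) -> (forall x : R, `|df x| <= 1) ->
    `|f b - f a| <= b - a.
  move=> hd hb.
  have cf : {within `[a, b], continuous f}.
    apply: continuous_subspaceT => x.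
    by apply: differentiable_continuous; apply/derivable1_diffP; case: (hd x).
  have [c _ ->] := @MVT_segment R f df a b ab (fun x _ => hd x) cf.
  rewrite normrM [X in _ * X]ger0_norm ?subr_ge0 // -[X in _ <= X]mul1r.
  by rewrite ler_wpM2r ?subr_ge0.
have hc := L cos (fun x => - sin x) (@is_derive_cos R) (fun x => _).
have {}hc : `|cos b - cos a| <= b - a by apply: hc => x; rewrite normrN sin_max.
have hs := L sin cos (@is_derive_sin R) (@cos_max R).
have -> : cexp b - cexp a = ((cos b - cos a) +i* 0)%C + (0 +i* (sin b - sin a))%C.
  by apply: complex_eq; rewrite /= ?addr0 ?add0r.
apply: le_trans (le_cabsD _ _) _.
rewrite !cabsE /= expr0n addr0 add0r !sqrtr_sqr; lra.
Qed.

Lemma unit_cell M (y : R) : 0 <= y -> y <= M.+1%:R ->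
  exists k : 'I_M.+1, k%:R <= y <= k.+1%:R.
Proof.
elim: M => [|M IH] y0 yM; first by exists ord0; rewrite y0.
have [h|/ltW h] := leP M.+1%:R y.
  by exists ord_max; rewrite h.
have [k hk] := IH y0 h.
by exists (widen_ord (leqnSn M.+1) k).
Qed.

(** Turns membership in an arc, an existential over angles, into closed conditions on the
    coordinates, which makes it visibly measurable. The arc stays in the upper half circle because
    [cos] is monotone there. *)
Lemma arc_half (t0 t1 : R) (z : C) : 0 <= t0 -> t0 <= t1 -> t1 <= pi ->
  (exists2 t, t0 <= t <= t1 & z = cexp t) <->
  [/\ cos t1 <= rp z <= cos t0, 0 <= ip z & rp z ^+ 2 + ip z ^+ 2 = 1].
Proof.
move=> p0 p01 p1.
have mono (u v : R) : 0 <= u <= pi -> 0 <= v <= pi -> (cos v < cos u) = (u < v).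
  by move=> hu hv; apply: ltr_cos; rewrite in_itv.
have le_cos (u v : R) : 0 <= u -> u <= v -> v <= pi -> cos v <= cos u.
  move=> u0 uv vp; rewrite leNgt mono ?u0 ?vp ?(le_trans u0 uv) ?(le_trans uv vp) //.
  by rewrite -leNgt.
split=> [[t /andP[h1 h2] ->]|[/andP[h1 h2] h3 h4]] /=.
  split; last exact: cos2Dsin2.
    by rewrite !le_cos // ?(le_trans h2 p1) ?(le_trans p0 h1).
  by apply: sin_ge0_pi; rewrite (le_trans p0 h1) (le_trans h2 p1).
have z1 : -1 <= rp z <= 1 by rewrite (le_trans (cos_geN1 _) h1) (le_trans h2 (cos_le1 _)).
have ct : cos (acos (rp z)) = rp z by rewrite acosK // in_itv.
have a0 := acos_ge0 z1; have ap := acos_lepi z1.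
exists (acos (rp z)).
  apply/andP; split; rewrite leNgt; apply/negP => hlt.
    have := mono (acos (rp z)) t0; rewrite p0 (le_trans p01 p1) a0 ap hlt ct => /(_ isT isT).
    by rewrite ltNge h2.
  have := mono t1 (acos (rp z)); rewrite p1 (le_trans p0 p01) a0 ap hlt ct => /(_ isT isT).
  by rewrite ltNge h1.
apply: complex_eq => /=; first by rewrite ct.
rewrite sin_acos //; have -> : 1 - rp z ^+ 2 = ip z ^+ 2 by rewrite -h4 addrC addKr.
by rewrite sqrtr_sqr ger0_norm.
Qed.

(** Each half circle is cut into [M.+1] arcs of length [pi / M.+1]; the boolean selects the half, so
    negating it is the antipodal map. The choice of [M] makes twice the arc length at most [eta], 2
    being the Lipschitz constant of [cexp_lipschitz]. *)
Lemma steinhaus_grid eta : 0 < eta -> steinhaus P S s ->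
  exists (K : finType) (flip : K -> K) (g : K -> C) E, @sign_grid eta K flip g E.
Proof.
move=> eta0 st; pose M := Num.bound (2 * pi / eta : R).
have pi0 := @pi_gt0 R.
have hM : 2 * pi / eta < M.+1%:R.
  apply: lt_trans (_ : M%:R < _); last by rewrite ltr_nat.
  by apply: archi_boundP; rewrite divr_ge0 ?mulr_ge0 // ltW.
have M0 : 0 < M.+1%:R :> R by [].
pose K : finType := (bool * 'I_M.+1)%type.
pose th (k : nat) : R := pi * k%:R / M.+1%:R.
have thS k : th k.+1 = th k + pi / M.+1%:R.
  by rewrite /th -natr1 mulrDr mulr1 mulrDl.
have th0 k : 0 <= th k by rewrite divr_ge0 ?mulr_ge0 // ltW.
have thM k : (k <= M.+1)%N -> th k <= pi.
  by move=> kM; rewrite /th ler_pdivrMr // ler_pM2l // ler_nat.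
have th_le k : th k <= th k.+1 by rewrite thS lerDl divr_ge0 // ltW.
pose lo (k : K) : R := pi * (k.1 : nat)%:R + th k.2.
pose hi (k : K) : R := pi * (k.1 : nat)%:R + th k.2.+1.
pose g (k : K) : C := cexp (lo k).
pose flip (k : K) : K := (~~ k.1, k.2).
have cexpDpi t : cexp (pi + t) = - cexp t.
  by apply: complex_eq; rewrite /= addrC ?cosDpi ?sinDpi.
have b01 (b : bool) : (b : nat)%:R <= 1 :> R by case: b.
pose dflt : K := (false, ord0).
pose ek (k : {ffun 'I_#|S| -> K}) := extend_ord dflt k.
pose E (k : {ffun 'I_#|S| -> K}) := [set w | forall i, i \in S ->
   exists2 t, lo (ek k i) <= t <= hi (ek k i) & s w i = cexp t].
have hlo k : hi k - lo k = pi / M.+1%:R by rewrite /hi /lo thS; ring.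
have lohi k : lo k <= hi k by rewrite lerD2l.
have lo0 k : 0 <= lo k by rewrite addr_ge0 // mulr_ge0 // ltW.
have hi2 k : hi k <= 2 * pi.
  have := thM k.2.+1 (ltn_ord k.2); have := ler_wpM2l (ltW pi0) (b01 k.1).
  by rewrite /hi mulr1; lra.
have cardK : #|K|%:R^-1 = pi / M.+1%:R / (2 * pi) :> R.
  rewrite card_prod card_bool card_ord natrM.
  by move: (pi : R) pi0 (M.+1%:R : R) M0 => q q0 r r0; field; rewrite !gt_eqF.
have mE k : <<s sign_gens >> (E k).
  apply: sign_bigcap => i iS.
  set c := ek k i; case: c => b q.
  pose sg : R := (-1) ^+ b.
  have sg2 : sg ^+ 2 = 1 by rewrite /sg sqrr_sign.
  have eqz w t : s w i = cexp (pi * (b : nat)%:R + t) <-> ((sg +i* 0)%C * s w i = cexp t).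
    rewrite /sg; case: (b); rewrite ?mulr1 ?mulr0 ?add0r ?expr0 ?expr1.
      rewrite cexpDpi; have -> : ((-1) +i* 0)%C = -1 :> C by apply: complex_eq; rewrite ?rpN ?ipN /= ?oppr0.
      by rewrite mulN1r; split => [->|<-]; rewrite opprK.
    by have -> : (1 +i* 0)%C = 1 :> C by []; rewrite mul1r.
  have -> : (fun w => exists2 t, lo (b, q) <= t <= hi (b, q) & s w i = cexp t) =
     [set w | cos (th q.+1) <= sg * rp (s w i)] `&` [set w | sg * rp (s w i) <= cos (th q)] `&`
     ([set w | 0 <= sg * ip (s w i)] `&`
     ((fun w => rp (s w i) ^+ 2 + ip (s w i) ^+ 2) @^-1` [set 1])).
    have rz w : rp ((sg +i* 0)%C * s w i) = sg * rp (s w i) by rewrite rpM /= mul0r subr0.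
    have iz w : ip ((sg +i* 0)%C * s w i) = sg * ip (s w i) by rewrite ipM /= mul0r addr0.
    have nz w : (sg * rp (s w i)) ^+ 2 + (sg * ip (s w i)) ^+ 2 = rp (s w i) ^+ 2 + ip (s w i) ^+ 2.
      by rewrite !exprMn sg2 !mul1r.
    have AH w := @arc_half (th q) (th q.+1) ((sg +i* 0)%C * s w i) (th0 q) (th_le q) (thM _ (ltn_ord q)).
    apply/seteqP; split => w.
      move=> [t ht e].
      have [|/andP[h1 h2] h3 h4] := (AH w).1.
        exists (t - pi * (b : nat)%:R); last by apply/eqz; rewrite addrC subrK.
        by move: ht; rewrite /lo /hi /=; lra.
      by rewrite rz iz nz in h1 h2 h3 h4; split; split.
    move=> [[/= h1 h2] [/= h3 h4]].
    have [|t ht /eqz e] := (AH w).2; first by rewrite rz iz nz h1 h2.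
    by exists (pi * (b : nat)%:R + t) => //; rewrite /lo /hi !lerD2l.
  have mr := smeas_sign_re iS; have mi := smeas_sign_im iS.
  have mc f : smeas sign_gens f -> smeas sign_gens (fun w => sg * f w).
    by move=> mf; apply: smeasM => //; exact: smeas_cst.
  do 2 apply: (@measurableI _ (g_sigma_algebraType sign_gens)).
  - by apply: smeas_ge; apply: mc.
  - by apply: smeas_le; apply: mc.
  - by apply: smeas_ge; apply: mc.
  - apply: smeas_preim => //; by apply: smeasD; apply: smeasX.
have pE k : prb P (E k) = #|{: {ffun 'I_#|S| -> K}}|%:R^-1.
  rewrite card_ffun_inv cardK.
  have := st (fun i => lo (ek k i)) (fun i => hi (ek k i)) => ->; last by move=> i; rewrite lo0 lohi hi2.
  by rewrite -prodr_const; apply: eq_bigr => i _; rewrite hlo.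
exists K, flip, g, E; split => //.
- split=> [[b q]|[b q]]; first by rewrite /flip /= negbK.
  rewrite /g /lo /flip /=; case: b => /=; rewrite ?mulr1 ?mulr0 ?add0r cexpDpi ?opprK //.
- by move=> k; exact: cabs_cexp.
(* The closed cells overlap at endpoints, so their probabilities are not added: the union is the
   event that all signs lie on the full circle, whose probability the Steinhaus law gives
   directly. *)
- have -> : \bigcup_k E k = [set w | forall i, i \in S ->
        exists2 t, 0 <= t <= 2 * pi & s w i = cexp t].
    apply/seteqP; split => [w [k _ Ek] i /Ek[t /andP[h1 h2] e]|w hw].
      by exists t => //; rewrite (le_trans (lo0 _) h1) (le_trans h2 (hi2 _)).
    have cell (j : 'I_#|S|) : exists k : K, exists2 t, lo k <= t <= hi k & s w (enum_val j) = cexp t.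
      have [t /andP[t0 t2] e] := hw _ (enum_valP j).
      pose b := pi <= t.
      pose u := t - pi * (b : nat)%:R.
      have [u0 up] : 0 <= u /\ u <= pi.
        by rewrite /u /b; case: (leP pi t) => h /=; rewrite ?mulr1 ?mulr0 ?subr0; split; move: h t0 t2; move: (pi : R) pi0 => q q0; lra.
      have [||q /andP[q1 q2]] := @unit_cell M (u * M.+1%:R / pi).
      + by rewrite divr_ge0 ?mulr_ge0 // ltW.
      + by rewrite ler_pdivrMr // mulrC ler_pM2l.
      exists (b, q); exists t => //; rewrite /lo /hi /=.
      rewrite ler_pdivlMr // in q1; rewrite ler_pdivrMr // in q2.
      have : th q <= u by rewrite /th ler_pdivrMr // mulrC.
      have : u <= th q.+1 by rewrite /th ler_pdivlMr // [pi * _]mulrC.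
      by rewrite /u; lra.
    have [k hk] := choice cell.
    exists (finfun k) => // i iS.
    have [j ->] : exists j : 'I_#|S|, i = enum_val j.
      by exists (enum_rank_in iS i); rewrite enum_rankK_in.
    by rewrite /ek extend_ordE ffunE; exact: hk.
  have := st (fun=> 0) (fun=> 2 * pi) => -> //.
    rewrite big1 // => i _; rewrite subr0 divff // mulf_neq0 ?gt_eqF //.
  by move=> i; rewrite !lexx /= mulr_ge0 // ltW.
- move=> k w j Ek; have [t] := Ek _ (enum_valP j); rewrite /ek extend_ordE => /andP[h1 h2] ->.
  apply: le_trans (cexp_lipschitz h1) _.
  apply: (@le_trans _ _ (2 * (pi / M.+1%:R))).
    by rewrite ler_pM2l // -(hlo (k j)) lerB.
  by rewrite mulrA ler_pdivrMr // [eta * _]mulrC -ler_pdivrMr // ltW.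
Qed.

End Grid.

(** * The Gram matrix and the off-support columns *)

Section RvecCoordinates.
Context {R : realType}.

Lemma rvecEu q (z : 'cV[R[i]]_q) k : rvec z (lshift q k) 0 = complex.Re (z k 0).
Proof. by rewrite col_mxEu mxE. Qed.

Lemma rvecEd q (z : 'cV[R[i]]_q) k : rvec z (rshift q k) 0 = complex.Im (z k 0).
Proof. by rewrite col_mxEd mxE. Qed.

End RvecCoordinates.

Section ComplexMeasurable.
Context {R : realType} {Omega : pointedType}.
Local Notation C := R[i].
Local Notation rp := complex.Re.
Local Notation ip := complex.Im.
Implicit Types (g : set (set Omega)) (f h : Omega -> C).

Definition csmeas g f : Prop := smeas g (fun w => rp (f w)) /\ smeas g (fun w => ip (f w)).

Lemma csmeas_cst g (c : C) : csmeas g (fun=> c).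
Proof. by split; exact: smeas_cst. Qed.

Lemma csmeasJ g f : csmeas g f -> csmeas g (fun w => conjc (f w)).
Proof.
move=> [mr mi]; split.
  by under [X in smeas _ X]funext do rewrite rpJ.
by under [X in smeas _ X]funext do rewrite ipJ; apply: smeasN.
Qed.

Lemma csmeasM g f h : csmeas g f -> csmeas g h -> csmeas g (fun w => f w * h w).
Proof.
move=> [mr mi] [mr' mi']; split.
  by under [X in smeas _ X]funext do rewrite rpM; apply: smeasB; apply: smeasM.
by under [X in smeas _ X]funext do rewrite ipM; apply: smeasD; apply: smeasM.
Qed.

Lemma csmeas_sum g I (r : seq I) (F : I -> Omega -> C) :
  (forall i, csmeas g (F i)) -> csmeas g (fun w => \sum_(i <- r) F i w).
Proof.
move=> mF; split.
  under [X in smeas _ X]funext do rewrite rp_sum.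
  by apply: smeas_sum => i _; case: (mF i).
under [X in smeas _ X]funext do rewrite ip_sum.
by apply: smeas_sum => i _; case: (mF i).
Qed.

Lemma smeas_cabs g f : csmeas g f -> smeas g (fun w => cabs (f w)).
Proof.
move=> [mr mi]; under [X in smeas _ X]funext do rewrite cabsE.
apply: smeas_sqrt; first by move=> w; rewrite addr_ge0 ?sqr_ge0.
by apply: smeasD; apply: smeasX.
Qed.

Lemma csmeas_mulmx g p q r (M : Omega -> 'M[C]_(p, q)) (N : Omega -> 'M[C]_(q, r)) :
  (forall i j, csmeas g (fun w => M w i j)) -> (forall i j, csmeas g (fun w => N w i j)) ->
  forall i j, csmeas g (fun w => (M w *m N w) i j).
Proof.
move=> mM mN i j; under [X in csmeas _ X]funext do rewrite mxE.
by apply: csmeas_sum => k; apply: csmeasM.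
Qed.

Lemma csmeas_adj g p q (M : Omega -> 'M[C]_(p, q)) :
  (forall i j, csmeas g (fun w => M w i j)) -> forall i j, csmeas g (fun w => mx_adj (M w) i j).
Proof.
move=> mM i j; under [X in csmeas _ X]funext do rewrite mx_adjE.
exact: csmeasJ.
Qed.

Lemma csmeas_colS g p n (S : {set 'I_n}) (M : Omega -> 'M[C]_(p, n)) :
  (forall i j, csmeas g (fun w => M w i j)) -> forall i j, csmeas g (fun w => colS S (M w) i j).
Proof. by move=> mM i j; under [X in csmeas _ X]funext do rewrite colSE. Qed.

Lemma bmeas_of_cabs_le g f (b : R) : csmeas g f -> (forall w, cabs (f w) <= b) ->
  bmeas g (fun w => rp (f w)) /\ bmeas g (fun w => ip (f w)).
Proof.
move=> [mr mi] hb; split; split=> //; exists b => w; apply: le_trans (hb w).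
  exact: norm_rp_le.
exact: norm_ip_le.
Qed.

Lemma bmx_rmx g p q (M : Omega -> 'M[C]_(p, q)) :
  (forall i j, bmeas g (fun w => rp (M w i j)) /\ bmeas g (fun w => ip (M w i j))) ->
  bmx g (fun w => rmx (M w)).
Proof.
move=> h i j; case: (split_ordP i) => i' ->; case: (split_ordP j) => j' ->.
- under [X in bmeas _ X]funext do rewrite /rmx block_mxEul mxE.
  by case: (h i' j').
- under [X in bmeas _ X]funext do rewrite /rmx block_mxEur !mxE.
  by apply: bmeasN; case: (h i' j').
- under [X in bmeas _ X]funext do rewrite /rmx block_mxEdl mxE.
  by case: (h i' j').
- under [X in bmeas _ X]funext do rewrite /rmx block_mxEdr mxE.
  by case: (h i' j').
Qed.

Lemma bmx_rvec g q (z : Omega -> 'cV[C]_q) :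
  (forall i, bmeas g (fun w => rp (z w i 0)) /\ bmeas g (fun w => ip (z w i 0))) ->
  bmx g (fun w => rvec (z w)).
Proof.
move=> h i j; rewrite (ord1 j); case: (split_ordP i) => i' ->.
  under [X in bmeas _ X]funext do rewrite /rvec col_mxEu mxE.
  by case: (h i').
under [X in bmeas _ X]funext do rewrite /rvec col_mxEd mxE.
by case: (h i').
Qed.

End ComplexMeasurable.

Section Core.
Context {R : realType} {d : measure_display} {Omega : measurableType d}.
Variable P : probability Omega R.
Local Notation "''E' f" := (Rexpect P f) (at level 10, f at level 9).
Local Notation Bm := (@bmeas R _ (@measurable d Omega)).
Local Notation C := R[i].
Local Notation rp := complex.Re.
Local Notation ip := complex.Im.

Variables (n m : nat) (p : 'I_m -> nat) (G : 'I_m -> set (set Omega))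
  (B : forall l : 'I_m, Omega -> 'M[C]_(p l, n)) (S : {set 'I_n}) (Theta : R).
Hypothesis m0 : (0 < m)%N.
Hypothesis T0 : 0 < Theta.
Hypothesis Gm : forall l, G l `<=` measurable.
Hypothesis Gind : mutual_indep P (fun l => <<s G l >>).
Hypothesis Bmeas : forall l i j, csmeas (G l) (fun w => B l w i j).
Hypothesis rows : forall l w i,
  \sum_k cabs ((mx_adj (B l w) *m colS S (B l w)) i k) <= Theta.
Hypothesis Bint : forall l i j, Cintegrable P (fun w => (mx_adj (B l w) *m B l w) i j).
Hypothesis iso : (m%:R^-1 : C) *: \sum_(l < m) Emx P (fun w => mx_adj (B l w) *m B l w) = 1%:M.

Local Notation s := #|S|.

Definition gramB l w : 'M[C]_(n, s) := mx_adj (B l w) *m colS S (B l w).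
Definition gramS l w : 'M[C]_s := mx_adj (colS S (B l w)) *m colS S (B l w).
Definition xiB l j w : 'cV[C]_s := mx_adj (colS S (B l w)) *m col j (B l w).

Lemma gramBE l w i k : gramB l w i k = (mx_adj (B l w) *m B l w) i (enum_val k).
Proof. by rewrite /gramB -colS_mulmx colSE. Qed.

Lemma gramSE l w k k' : gramS l w k k' = gramB l w (enum_val k) k'.
Proof.
rewrite [LHS]mxE [RHS]mxE; apply: eq_bigr => i _.
by rewrite !mx_adjE colSE.
Qed.

(** Through this identity the row bound [Theta], stated for [B_l^* B_{l,S}], also controls the sum
    of moduli of [B_{l,S}^* b_j]. *)
Lemma xiBE l j w k : xiB l j w k 0 = conjc (gramB l w j k).
Proof.
rewrite [LHS]mxE [in RHS]mxE rmorph_sum; apply: eq_bigr => i _ /=.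
rewrite rmorphM /= !mx_adjE conjcK mulrC; congr (_ * _).
by rewrite mxE.
Qed.

Lemma gramB_meas l i k : csmeas (G l) (fun w => gramB l w i k).
Proof.
apply: csmeas_mulmx => [i' j'|i' j']; first by apply: csmeas_adj; exact: Bmeas.
by apply: csmeas_colS; exact: Bmeas.
Qed.

Lemma gramB_bound l w i k : cabs (gramB l w i k) <= Theta.
Proof.
apply: le_trans (rows l w i); rewrite (bigD1 k) //= lerDl.
by apply: sumr_ge0 => k' _; exact: cabs_ge0.
Qed.

Lemma gramB_bmeas l i k :
  bmeas (G l) (fun w => rp (gramB l w i k)) /\ bmeas (G l) (fun w => ip (gramB l w i k)).
Proof. exact: bmeas_of_cabs_le (gramB_meas l i k) (fun w => gramB_bound l w i k). Qed.

Definition Xl l w : 'M[R]_(s + s) := m%:R^-1 *: rmx (gramS l w).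

Lemma mR0 : 0 < m%:R :> R. Proof. by rewrite ltr0n. Qed.
Lemma minv_ge0 : 0 <= m%:R^-1 :> R. Proof. by rewrite invr_ge0 ler0n. Qed.

Lemma Xl_meas l : bmx (G l) (Xl l).
Proof.
have h : bmx (G l) (fun w => rmx (gramS l w)).
  apply: bmx_rmx => i j; have := gramB_bmeas l (enum_val i) j.
  by under [X in bmeas _ X]funext do rewrite -gramSE;
     under [X in _ /\ bmeas _ X]funext do rewrite -gramSE.
move=> i j; under [X in bmeas _ X]funext do rewrite mxE.
by apply: bmeasM; [exact: bmeas_cst|exact: h].
Qed.

Lemma gramS_rmx l w : rmx (gramS l w) = (rmx (colS S (B l w)))^T *m rmx (colS S (B l w)).
Proof. by rewrite rmxM rmx_adj. Qed.

Lemma Xl_sym l w : (Xl l w)^T = Xl l w.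
Proof. by rewrite /Xl linearZ /= gramS_rmx trmx_mul trmxK. Qed.

(** The rows of [gramS] are the rows of [gramB] with index in [S], so their sums of moduli are at
    most [Theta] and Schur's test applies. *)
Lemma colS_opnorm l w (u : 'cV[R]_(s + s)) :
  fro (rmx (colS S (B l w)) *m u) (rmx (colS S (B l w)) *m u) <= Theta * fro u u.
Proof.
rewrite fro_mull mulmxA -gramS_rmx; apply: schur_hermitian.
  by rewrite /gramS mx_adjM mx_adjK.
by move=> i; under eq_bigr do rewrite gramSE; exact: rows.
Qed.

(** For [X = A^T A / m] the left side is [|A^T (A W)|^2 / m^2] and the form on the right is
    [|A W|^2 / m]; the bound on [A] passes to [A^T]. *)
Lemma Xl_bound l w q (W : 'M[R]_(s + s, q)) :
  fro (Xl l w *m W) (Xl l w *m W) <= Theta / m%:R * fro W (Xl l w *m W).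
Proof.
rewrite /Xl -!scalemxAl froZl !froZr gramS_rmx -!mulmxA.
set A := rmx _; rewrite (mulrC Theta).
rewrite -[X in _ <= X]mulrA ler_wpM2l ?minv_ge0 // mulrCA ler_wpM2l ?minv_ge0 //.
have -> : fro W (A^T *m (A *m W)) = fro (A *m W) (A *m W) by rewrite [RHS]fro_mull.
apply: opnorm_mx; apply: opnorm_tr; first exact: ltW.
exact: colS_opnorm.
Qed.

Lemma natC k : (k%:R : C) = (k%:R +i* 0)%C.
Proof. by rewrite -[RHS]/((k%:R)%:C)%C rmorph_nat. Qed.

Lemma sum_Emx i j : \sum_(l < m) Cexpect P (fun w => (mx_adj (B l w) *m B l w) i j) =
  m%:R *+ (i == j).
Proof.
have mC : m%:R != 0 :> C by rewrite natC; apply/eqP => -[/eqP]; rewrite gt_eqF ?mR0.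
have := congr1 (fun M : 'M[C]_n => m%:R * M i j) iso.
rewrite !mxE mulrA mulfV // mul1r summxE mulrnAr mulr1 => <-.
by apply: eq_bigr => l _; rewrite mxE.
Qed.

Lemma EXl : \sum_l REmx P (Xl l) = 1%:M.
Proof.
have Er k k' : \sum_l 'E (fun w => rp (gramS l w k k')) = m%:R *+ (k == k').
  have := congr1 (fun z : C => rp z) (sum_Emx (enum_val k) (enum_val k')); rewrite /= rp_sum.
  rewrite (inj_eq enum_val_inj) => e; transitivity (rp (m%:R *+ (k == k') : C)).
    rewrite -e; apply: eq_bigr => l _; congr (Rexpect P _); apply/funext => w.
    by rewrite gramSE gramBE.
  by case: (k == k'); rewrite ?mulr1n ?mulr0n // natC.
have Ei k k' : \sum_l 'E (fun w => ip (gramS l w k k')) = 0.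
  have := congr1 (fun z : C => ip z) (sum_Emx (enum_val k) (enum_val k')); rewrite /= ip_sum.
  rewrite (inj_eq enum_val_inj) => e; transitivity (ip (m%:R *+ (k == k') : C)).
    rewrite -e; apply: eq_bigr => l _; congr (Rexpect P _); apply/funext => w.
    by rewrite gramSE gramBE.
  by case: (k == k'); rewrite ?mulr1n ?mulr0n // natC.
have int l k k' : Rintegrable P (fun w => rp (gramS l w k k')) /\ Rintegrable P (fun w => ip (gramS l w k k')).
  have [h1 h2] := Bint l (enum_val k) (enum_val k').
  by split; under [X in Rintegrable _ X]funext do rewrite gramSE gramBE.
have minv : m%:R^-1 * m%:R = 1 :> R by rewrite mulVf // gt_eqF ?mR0.
have ei0 k k' (a : R) : (0 : 'M[R]_s) k k' = a * \sum_l 'E (fun w => ip (gramS l w k k')).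
  by rewrite Ei mulr0 mxE.
have minvb (b : bool) : m%:R^-1 * (m%:R *+ b) = 1 *+ b :> R.
  by case: b; rewrite ?mulr1n ?mulr0n ?mulr0.
rewrite scalar_mx_block; apply/matrixP => i j; rewrite summxE.
case: (split_ordP i) => i' ->; case: (split_ordP j) => j' ->.
- rewrite block_mxEul mxE -minvb -Er mulr_sumr; apply: eq_bigr => l _.
  rewrite mxE -RexpectZ; last by case: (int l i' j').
  by congr (Rexpect P _); apply/funext => w; rewrite mxE block_mxEul mxE.
- rewrite block_mxEur (ei0 i' j' (- m%:R^-1)) mulr_sumr; apply: eq_bigr => l _.
  rewrite mxE -RexpectZ; last by case: (int l i' j').
  by congr (Rexpect P _); apply/funext => w; rewrite mxE block_mxEur !mxE mulrN mulNr.
- rewrite block_mxEdl (ei0 i' j' m%:R^-1) mulr_sumr; apply: eq_bigr => l _.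
  rewrite mxE -RexpectZ; last by case: (int l i' j').
  by congr (Rexpect P _); apply/funext => w; rewrite mxE block_mxEdl mxE.
- rewrite block_mxEdr mxE -minvb -Er mulr_sumr; apply: eq_bigr => l _.
  rewrite mxE -RexpectZ; last by case: (int l i' j').
  by congr (Rexpect P _); apply/funext => w; rewrite mxE block_mxEdr mxE.
Qed.

Lemma gram_deviation q : (q.+1 + q.+1)%:R * (Theta / m%:R) <= 28^-1 ->
  prb P [set w | 4^-1 ^+ q.+1 <= \tr (Ydev Xl w ^+ (q.+1 + q.+1))] <= (s + s)%:R * 3^-1 ^+ q.+1.
Proof.
move=> hq; apply: (matrix_deviation Gm Gind Xl_meas Xl_sym _ Xl_bound EXl hq).
by rewrite divr_ge0 // ltW // mR0.
Qed.

Lemma nrm_le_l1 N (u : 'cV[R]_N) : nrm u <= \sum_i `|u i 0|.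
Proof.
rewrite -[X in _ <= X]ger0_norm ?sumr_ge0 // -sqrtr_sqr ler_wsqrtr // fro_cV expr2 mulr_suml.
apply: ler_sum => i _; rewrite -expr2 -real_normK ?num_real // expr2 ler_wpM2l //.
by rewrite (bigD1 i) //= lerDl sumr_ge0.
Qed.

Variable j : 'I_n.
Hypothesis jS : j \notin S.
Variable lam : R.
Hypothesis lam0 : 0 <= lam.
Hypothesis lam_small : 16 * lam * (Theta / m%:R) <= 1.

Local Notation xr l := (fun w => rvec (xiB l j w)).

Lemma xr_meas l : bmx (G l) (xr l).
Proof.
apply: bmx_rvec => k; have [h1 h2] := gramB_bmeas l j k; split.
  by under [X in bmeas _ X]funext do rewrite xiBE rpJ.
by under [X in bmeas _ X]funext do rewrite xiBE ipJ; apply: bmeasN.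
Qed.

Lemma xr_measurable l : bmx measurable (xr l).
Proof. by apply: bmx_mono (xr_meas l) => A /Gm /sub_sigma_algebra. Qed.

Lemma xr_l1 l w : \sum_i `|rvec (xiB l j w) i 0| <= 2 * Theta.
Proof.
rewrite big_split_ord /= -big_split /=.
apply: (@le_trans _ _ (\sum_k 2 * cabs (gramB l w j k))).
  apply: ler_sum => k _; rewrite rvecEu rvecEd -(cabsJ (gramB l w j k)) -xiBE.
  have := norm_rp_le (xiB l j w k 0); have := norm_ip_le (xiB l j w k 0); lra.
by rewrite -mulr_sumr ler_pM2l //; exact: rows.
Qed.

Lemma E_xr_l1 l : \sum_i `|REmx P (xr l) i 0| <= 2 * Theta.
Proof.
have bi i : Bm (fun w => `|rvec (xiB l j w) i 0|).
  have [h1 [M hM]] := xr_measurable l i 0; split.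
    by apply: (smeas_comp (k := @Num.norm _ R)) => //; exact: normr_measurable.
  by exists M => w; rewrite normr_id.
apply: (@le_trans _ _ (\sum_i 'E (fun w => `|rvec (xiB l j w) i 0|))).
  apply: ler_sum => i _; rewrite mxE.
  by apply: le_normr_Rintegral => //; apply: bmeas_integrable; apply: xr_measurable.
rewrite -Rexpect_sum; last by move=> i _; exact: bmeas_integrable.
rewrite -[X in _ <= X](Rexpect_cst P); apply: le_Rexpect; last by move=> w; exact: xr_l1.
  by apply: Rintegrable_sum => i _; exact: bmeas_integrable.
exact/bmeas_integrable/bmeas_cst.
Qed.

(** Each term is centred by its own mean: isotropy makes only the sum of these means vanish, while
    the deviation bound wants every summand centred. *)
Definition Zl l w : 'cV[R]_(s + s) := (lam / m%:R) *: (rvec (xiB l j w) - REmx P (xr l)).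

Lemma Zl_meas l : bmx (G l) (Zl l).
Proof.
move=> i k; under [X in bmeas _ X]funext do rewrite mxE.
apply: bmeasM; first exact: bmeas_cst.
exact: (bmxB (xr_meas l) (bmx_cst _ _)).
Qed.

Lemma lamm_ge0 : 0 <= lam / m%:R. Proof. by rewrite divr_ge0. Qed.

Lemma Zl_small l w : nrm (Zl l w) <= 4^-1.
Proof.
apply: le_trans (nrm_le_l1 _) _.
(* [4 * Theta] is [2 * Theta] for the vector and [2 * Theta] for its mean, each 2 accounting for
   real and imaginary parts; [lam_small] then gives 1/4. *)
apply: (@le_trans _ _ (lam / m%:R * (4 * Theta))); last by move: lam_small; lra.
under eq_bigr do rewrite mxE normrM (ger0_norm lamm_ge0).
rewrite -mulr_sumr ler_wpM2l ?lamm_ge0 //.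
apply: (@le_trans _ _ (\sum_i (`|rvec (xiB l j w) i 0| + `|REmx P (xr l) i 0|))).
  by apply: ler_sum => i _; rewrite mxE [X in _ + X]mxE; exact: ler_normB.
by rewrite big_split /=; have := xr_l1 l w; have := E_xr_l1 l; lra.
Qed.

Lemma EZl l i : 'E (fun w => Zl l w i 0) = 0.
Proof.
have ix : Rintegrable P (fun w => rvec (xiB l j w) i 0).
  exact/bmeas_integrable/xr_measurable.
have ic c : Rintegrable P (fun=> c) by exact/bmeas_integrable/bmeas_cst.
under [X in Rexpect _ X]funext do rewrite mxE.
rewrite RexpectZ; last first.
  under [X in Rintegrable _ X]funext do rewrite mxE [X in _ + X]mxE.
  by apply: RintegrableD => //; exact: RintegrableN.
under [X in Rexpect _ X]funext do rewrite mxE [X in _ + X]mxE.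
by rewrite RexpectB // Rexpect_cst mxE subrr mulr0.
Qed.

(** Centring does not increase the second moment, and [|B_{l,S}^* b_j|^2 <= Theta |b_j|^2]. The
    means of [|b_j|^2] over [l] add up to [m] by isotropy, so [Theta] enters linearly. *)
Lemma sum_EZl_sqr : \sum_l 'E (fun w => fro (Zl l w) (Zl l w)) <= lam ^+ 2 * (Theta / m%:R).
Proof.
have ix l i : Bm (fun w => rvec (xiB l j w) i 0) by exact: xr_measurable.
have Bj l : Rintegrable P (fun w => rp ((mx_adj (B l w) *m B l w) j j)) by case: (Bint l j j).
have step l : 'E (fun w => fro (Zl l w) (Zl l w)) <=
    (lam / m%:R) ^+ 2 * (Theta * 'E (fun w => rp ((mx_adj (B l w) *m B l w) j j))).
  have bx : Bm (fun w => fro (rvec (xiB l j w)) (rvec (xiB l j w))).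
    by apply: bmeas_fro; exact: xr_measurable.
  have bc : Bm (fun w => fro (rvec (xiB l j w)) (REmx P (xr l))).
    by apply: bmeas_fro; [exact: xr_measurable|exact: bmx_cst].
  set mu := REmx P (xr l) in bc *.
  have ec : 'E (fun w => fro (rvec (xiB l j w)) mu) = fro mu mu.
    under [X in Rexpect _ X]funext do rewrite fro_cV.
    rewrite Rexpect_sum; last first.
      by move=> i _; apply: bmeas_integrable; apply: bmeasM => //; exact: bmeas_cst.
    rewrite fro_cV; apply: eq_bigr => i _.
    transitivity ('E (fun w => mu i 0 * rvec (xiB l j w) i 0)).
      by congr (Rexpect P _); apply/funext => w; rewrite mulrC.
    rewrite RexpectZ; last exact: bmeas_integrable.
    by congr (_ * _); rewrite mxE.
  have -> : (fun w => fro (Zl l w) (Zl l w)) = (fun w => (lam / m%:R) ^+ 2 *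
     ((fro (rvec (xiB l j w)) (rvec (xiB l j w)) + (-2) * fro (rvec (xiB l j w)) mu) + fro mu mu)).
    apply/funext => w; rewrite /Zl -/mu froZl froZr mulrA -expr2; congr (_ * _).
    by rewrite !froDl !froDr !froNl !froNr (froC mu (rvec _)); ring.
  have b1 : Bm (fun w => fro (rvec (xiB l j w)) (rvec (xiB l j w)) + (-2) * fro (rvec (xiB l j w)) mu).
    by apply: bmeasD => //; apply: bmeasM => //; exact: bmeas_cst.
  have bmu : Bm (fun=> fro mu mu) by exact: bmeas_cst.
  rewrite RexpectZ; last by apply: bmeas_integrable; exact: bmeasD.
  rewrite ler_wpM2l ?sqr_ge0 // RexpectD; [|exact: bmeas_integrable|exact: bmeas_integrable].
  rewrite RexpectD; [|exact: bmeas_integrable|by apply: RintegrableZ; exact: bmeas_integrable].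
  rewrite RexpectZ; last exact: bmeas_integrable.
  rewrite ec Rexpect_cst.
  apply: (@le_trans _ _ ('E (fun w => fro (rvec (xiB l j w)) (rvec (xiB l j w))))).
    by have := fro_ge0 mu; lra.
  rewrite -RexpectZ //; apply: le_Rexpect; [exact: bmeas_integrable|exact: RintegrableZ|].
  move=> w; rewrite /xiB rvecM rmx_adj.
  apply: le_trans (opnorm_tr (ltW T0) (colS_opnorm l w) _) _.
  rewrite ler_pM2l // fro_rvec mxE rp_sum; apply: ler_sum => i _.
  by rewrite mx_adjE !mxE.
apply: le_trans (ler_sum _ (fun l _ => step l)) _.
rewrite -mulr_sumr -mulr_sumr.
have -> : \sum_l 'E (fun w => rp ((mx_adj (B l w) *m B l w) j j)) = m%:R.
  have := congr1 (fun z : C => rp z) (sum_Emx j j); rewrite /= rp_sum eqxx mulr1n natC => e.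
  exact: e.
rewrite le_eqVlt; apply/orP; left; apply/eqP; field.
by rewrite gt_eqF ?mR0.
Qed.

(** The sum of the means is a column of off-diagonal entries of the identity, since [j] lies outside
    [S]; hence the centrings cancel. *)
Lemma sum_Zl w : \sum_l Zl l w = lam *: rvec ((m%:R^-1 : C) *: \sum_l xiB l j w).
Proof.
have E0 : \sum_l REmx P (xr l) = 0.
  have Ek k : \sum_l Cexpect P (fun w => gramB l w j k) = 0.
    transitivity (\sum_l Cexpect P (fun w => (mx_adj (B l w) *m B l w) j (enum_val k))).
      by apply: eq_bigr => l _; congr Cexpect; apply/funext => w'; rewrite gramBE.
    rewrite sum_Emx; case: eqP => // e; by have := jS; rewrite e enum_valP.
  apply/matrixP => i k; rewrite (ord1 k) summxE mxE; case: (split_ordP i) => i' ->.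
    have := congr1 (fun z : C => rp z) (Ek i'); rewrite /= rp_sum => e; rewrite -[RHS]e; apply: eq_bigr => l _.
    by rewrite mxE; congr (Rexpect P _); apply/funext => w'; rewrite rvecEu xiBE rpJ.
  have := congr1 (fun z : C => ip z) (Ek i'); rewrite /= ip_sum => e; rewrite -[RHS]oppr0 -[in RHS]e -sumrN.
  apply: eq_bigr => l _; rewrite mxE /= -RexpectN; last first.
    by apply: bmeas_integrable; have [_ h] := gramB_bmeas l j i'; apply: bmeas_mono h => A /Gm /sub_sigma_algebra.
  by congr (Rexpect P _); apply/funext => w'; rewrite rvecEd xiBE ipJ.
rewrite -scaler_sumr sumrB E0 subr0 -scalerA; congr (_ *: _).
have minv : (m%:R^-1 : C) = (m%:R^-1 +i* 0)%C.
  apply: (mulfI (x := m%:R)); first by rewrite natC; apply/eqP => -[/eqP]; rewrite gt_eqF ?mR0.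
  rewrite mulfV; last by rewrite natC; apply/eqP => -[/eqP]; rewrite gt_eqF ?mR0.
  rewrite natC; apply: complex_eq; rewrite ?rpM ?ipM /= ?mulr0 ?mul0r ?addr0 ?subr0 //.
  by rewrite mulfV // gt_eqF ?mR0.
apply/matrixP => i k; rewrite (ord1 k) mxE summxE; case: (split_ordP i) => i' ->.
  rewrite rvecEu mxE minv rpM /= mul0r subr0 summxE rp_sum; congr (_ * _).
  by apply: eq_bigr => l _; rewrite rvecEu.
rewrite rvecEd mxE minv ipM /= mul0r addr0 summxE ip_sum; congr (_ * _).
by apply: eq_bigr => l _; rewrite rvecEd.
Qed.

Lemma column_deviation t : 0 <= t ->
  prb P [set w | t <= nrm (\sum_l Zl l w)] <= 2 * expR (lam ^+ 2 * (Theta / m%:R) - t).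
Proof. move=> t0; exact: (vector_deviation (Z := Zl) (@Gm) Gind Zl_meas Zl_small EZl sum_EZl_sqr t0). Qed.

End Core.

(** * The stacked matrix and its Gram matrix in terms of the blocks *)

Section Stacked.
Context {R : realType}.
Local Notation C := R[i].
Variables (n m : nat) (p : 'I_m -> nat) (B : forall l : 'I_m, 'M[C]_(p l, n)) (S : {set 'I_n}).
Hypothesis m0 : (0 < m)%N.
Local Notation A := (Complex (Num.sqrt (m%:R : R))^-1 0 *: \mxcol_(l < m) B l).

Lemma mx_adj_mxcol q (D : forall l : 'I_m, 'M[C]_(p l, q)) :
  mx_adj (\mxcol_l D l) = \mxrow_l mx_adj (D l).
Proof. by apply/matrixP => i k; rewrite !mxE. Qed.

Lemma mx_adjZ p' q (a : C) (M : 'M[C]_(p', q)) : mx_adj (a *: M) = conjc a *: mx_adj M.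
Proof. by apply/matrixP => i k; rewrite !mxE rmorphM. Qed.

Lemma colS_stacked : colS S A = Complex (Num.sqrt (m%:R : R))^-1 0 *: \mxcol_l colS S (B l).
Proof. by rewrite /colS -scalemxAl mxcol_mul. Qed.

Lemma sqrt_scaling : conjc (Complex (Num.sqrt (m%:R : R))^-1 0) * Complex (Num.sqrt (m%:R : R))^-1 0
  = (m%:R^-1 : C).
Proof.
have mR : 0 < m%:R :> R by rewrite ltr0n.
have mC : m%:R != 0 :> C by rewrite natC; apply/eqP => -[/eqP]; rewrite gt_eqF.
apply: (mulfI mC); rewrite mulfV // natC.
have e : (Num.sqrt (m%:R : R))^-1 * (Num.sqrt (m%:R : R))^-1 = m%:R^-1.
  by rewrite -invfM -expr2 sqr_sqrtr // ltW.
apply: complex_eq; rewrite ?(rpM, ipM) /= ?(rpM, ipM) /=; last by ring.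
by rewrite !(oppr0, mul0r, subr0) e mulfV // gt_eqF.
Qed.

Lemma gram_stacked : mx_adj (colS S A) *m colS S A =
  (m%:R^-1 : C) *: \sum_l mx_adj (colS S (B l)) *m colS S (B l).
Proof.
rewrite colS_stacked mx_adjZ -scalemxAl -scalemxAr scalerA sqrt_scaling.
by rewrite mx_adj_mxcol mul_mxrow_mxcol.
Qed.

Lemma column_stacked j : mx_adj (colS S A) *m col j A =
  (m%:R^-1 : C) *: \sum_l mx_adj (colS S (B l)) *m col j (B l).
Proof.
have -> : col j A = Complex (Num.sqrt (m%:R : R))^-1 0 *: \mxcol_l col j (B l).
  by rewrite -col_mxcol; apply/matrixP => i k; rewrite !mxE.
rewrite colS_stacked mx_adjZ -scalemxAl -scalemxAr scalerA sqrt_scaling.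
by rewrite mx_adj_mxcol mul_mxrow_mxcol.
Qed.

End Stacked.

(** * Inverting a small perturbation of the identity *)

Section Inversion.
Context {R : realType}.

(** From [c = v - Y c] follows [|c|^2 <= 2 |v|^2 + |c|^2 / 2], hence the factor 4. *)
Lemma near_identity_inverse N (Y : 'M[R]_N) (v : 'cV[R]_N) (T := Y + 1%:M) :
  (forall u : 'cV[R]_N, fro (Y *m u) (Y *m u) <= 4^-1 * fro u u) ->
  let c := (\det T)^-1 *: (\adj T *m v) in T *m c = v /\ fro c c <= 4 * fro v v.
Proof.
move=> hY c.
have inj (u : 'cV[R]_N) : T *m u = 0 -> u = 0.
  rewrite /T mulmxDl mul1mx => /eqP; rewrite addr_eq0 => /eqP e.
  have := hY u; rewrite e froNl froNr opprK => h; apply: fro_eq0.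
  by apply/le_anti; rewrite fro_ge0 andbT; lra.
have Tu : T \in unitmx by exact: unitmx_of_injective.
have d0 : \det T != 0 by move: Tu; rewrite unitmxE unitfE.
have Tc : T *m c = v.
  by rewrite /c -scalemxAr mulmxA mul_mx_adj mul_scalar_mx scalerA mulVf // scale1r.
split=> //; have e : c = v - Y *m c.
  by rewrite -[in RHS]Tc /T mulmxDl mul1mx addrC addKr.
have := fro_parallelogram_le v (Y *m c); rewrite -e.
by have := hY c; lra.
Qed.

End Inversion.

Section MeasurableMatrices.
Context {R : realType} {Omega : pointedType}.
Implicit Type g : set (set Omega).

Lemma smeas_det g N (T : Omega -> 'M[R]_N) : (forall i j, smeas g (fun w => T w i j)) ->
  smeas g (fun w => \det (T w)).
Proof.
move=> mT; apply: smeas_sum => sg _; apply: smeasM; first exact: smeas_cst.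
by apply: smeas_prod.
Qed.

Lemma smeas_adj g N (T : Omega -> 'M[R]_N) : (forall i j, smeas g (fun w => T w i j)) ->
  forall i j, smeas g (fun w => (\adj (T w)) i j).
Proof.
move=> mT i j; under [X in smeas _ X]funext do rewrite mxE /cofactor.
apply: smeasM; first exact: smeas_cst.
apply: smeas_det => i' j'; under [X in smeas _ X]funext do rewrite !mxE.
exact: mT.
Qed.

Lemma smeas_mulmx g N M K (X : Omega -> 'M[R]_(N, M)) (Y : Omega -> 'M[R]_(M, K)) :
  (forall i j, smeas g (fun w => X w i j)) -> (forall i j, smeas g (fun w => Y w i j)) ->
  forall i j, smeas g (fun w => (X w *m Y w) i j).
Proof.
move=> mX mY i j; under [Z in smeas _ Z]funext do rewrite mxE.
by apply: smeas_sum => k _; apply: smeasM.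
Qed.

End MeasurableMatrices.

(** * Averaging over the sign cells, and null sets *)

Section SignUnion.
Context {R : realType} {d : measure_display} {Omega : measurableType d}.
Variable P : probability Omega R.

(** Takes the place of conditioning on [A]: independence turns each [prb P (E k]&[Q k)] into the
    common cell probability times [prb P (Q k)], and the count of the [k] with [w] in [Q k] is
    bounded at every [w] before integrating. *)
Lemma sign_union_bound n (S : {set 'I_n}) s eta (K : finType) (flip : K -> K) g E
    (gA : set (set Omega)) (Q : {ffun 'I_#|S| -> K} -> set Omega) (delta : R) :
  @sign_grid R d Omega P n S s eta K flip g E ->
  gA `<=` measurable -> indep P <<s sign_gens S s >> <<s gA >> ->
  (forall k, <<s gA >> (Q k)) ->
  (forall w, \sum_k (\1_(Q k) w : R) <= #|{: {ffun 'I_#|S| -> K}}|%:R * delta) ->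
  \sum_k prb P (E k `&` Q k) <= delta.
Proof.
move=> [_ _ hE pU _] gm ind mQ hQ.
have mQ' k : measurable (Q k).
  by have := mQ k; apply: smallest_sub => //; exact: sigma_algebra_measurable.
have bQ k : Rintegrable P (\1_(Q k) : Omega -> R).
  by apply: bmeas_integrable; apply: bmeas_indic; exact: sub_sigma_algebra.
set F := #|_|%:R in hQ hE *.
have F0 : 0 <= F by exact: ler0n.
have [F1|F1] := eqVneq F 0.
  have : prb P (\bigcup_k E k) = 0.
    rewrite (_ : \bigcup_k E k = set0); first by rewrite /prb measure0.
    apply/seteqP; split => // w [k _ _].
    move: F1; rewrite /F => /eqP; rewrite pnatr_eq0 => /eqP /card0_eq /(_ k).
    by rewrite inE.
  by rewrite pU => /eqP; rewrite oner_eq0.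
have Fp : 0 < F by rewrite lt_def F1.
have step k : prb P (E k `&` Q k) = F^-1 * Rexpect P (\1_(Q k) : Omega -> R).
  by rewrite (ind _ _ (hE k).1 (mQ k)) (hE k).2 Rexpect_indic.
rewrite (eq_bigr _ (fun k _ => step k)).
rewrite -mulr_sumr -Rexpect_sum // mulrC ler_pdivrMr // mulrC.
rewrite -[X in _ <= X](Rexpect_cst P); apply: le_Rexpect => //.
  by apply: Rintegrable_sum.
by apply: bmeas_integrable; exact: bmeas_cst.
Qed.

Lemma prb_ae (D : set Omega) : measurable D -> {ae P, forall w, D w} -> prb P (~` D) = 0.
Proof.
move=> mD [N [mN PN hN]]; apply/le_anti; rewrite prb_ge0 andbT.
apply: (@le_trans _ _ (prb P N)); last by rewrite /prb PN.
by apply: prb_le => //; exact: measurableC.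
Qed.

Lemma Rexpect_ae_indic (D : set Omega) (f : Omega -> R) : measurable D ->
  prb P (~` D) = 0 -> Rintegrable P f ->
  Rintegrable P (fun w => \1_D w * f w) /\ Rexpect P (fun w => \1_D w * f w) = Rexpect P f.
Proof.
move=> mD pD fi.
have mf : measurable_fun setT f by apply/measurable_EFinP; case/integrableP: fi.
have mDf : measurable_fun setT (fun w => \1_D w * f w).
  by apply: measurable_funM => //; exact: measurable_indic.
split.
  apply: (le_integrable measurableT _ _ fi); first exact/measurable_EFinP.
  move=> w _ /=; rewrite lee_fin normrM ler_piMl // indicE.
  by case: (_ \in _); rewrite ?normr1 ?normr0.
congr fine; apply: ae_eq_integral => //; [exact/measurable_EFinP|exact/measurable_EFinP|].
exists (~` D); split; first exact: measurableC.
  have := pD; rewrite /prb => h; rewrite -[LHS]fineK ?h //.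
  by apply: fin_num_measure; exact: measurableC.
move=> w /= h Dw; apply: h => _; rewrite indicE mem_set // mul1r //.
Qed.

End SignUnion.

(** * Numerical bounds on [expR] and [ln] *)

Section Numerics.
Context {R : realType}.

(** [exp (1/4) <= 1 + 1/4 + 1/16 = 21/16], and [(21/16)^4 < 3]. *)
Lemma expR1_le3 : expR 1 <= 3 :> R.
Proof.
have h := @expR_quadratic_le R 4^-1; have {}h : expR 4^-1 <= 21 / 16 :> R.
  apply: le_trans (h _) _; first by rewrite lexx andbT invr_ge0.
  by rewrite expr2; lra.
have -> : expR 1 = expR 4^-1 ^+ 4 :> R by rewrite -expRM_natl; congr expR; field.
apply: (@le_trans _ _ ((21 / 16) ^+ 4)).
  by rewrite lerXn2r ?nnegrE ?expR_ge0 //; lra.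
rewrite !exprS expr0; lra.
Qed.

(** Equivalent to [exp 3 <= 36], while [exp 3 <= 27]. *)
Lemma ln6_ge : 3 / 2 <= ln 6 :> R.
Proof.
rewrite -[X in X <= _]expRK ler_ln ?posrE ?expR_gt0 //.
have h : expR (3 / 2) ^+ 2 <= 6 ^+ 2 :> R.
  have -> : expR (3 / 2) ^+ 2 = expR 1 ^+ 3 :> R.
    by rewrite -!expRM_natl; congr expR; field.
  apply: (@le_trans _ _ (3 ^+ 3)).
    by rewrite lerXn2r ?nnegrE ?expR_ge0 // expR1_le3.
  by rewrite !exprS !expr0; lra.
by rewrite -(@ler_pXn2r _ 2) ?nnegrE ?expR_ge0.
Qed.

Lemma inv3_le_expR (q : nat) (L : R) : L <= q%:R -> 3^-1 ^+ q <= expR (- L) :> R.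
Proof.
move=> Lq; apply: (@le_trans _ _ (expR (- q%:R))); last by rewrite ler_expR lerN2.
rewrite expRN -[q%:R]mulr1 expRM_natl exprVn lef_pV2 ?posrE ?exprn_gt0 ?expR_gt0 //.
by rewrite lerXn2r ?nnegrE ?expR_ge0 // expR1_le3.
Qed.

Lemma nat_ceil (L : R) : 0 < L -> exists q : nat, L <= q.+1%:R <= L + 1.
Proof.
move=> L0; have h : exists q : nat, L <= q.+1%:R.
  exists (Num.bound L); apply: le_trans (ltW (archi_boundP (ltW L0))) _.
  by rewrite ler_nat.
exists (ex_minn h); case: ex_minnP => q hq minq; rewrite hq /=.
case: q hq minq => [|q] hq minq; first by lra.
rewrite -natr1 lerD2r leNgt; apply/negP => Lq.
by have := minq q (ltW Lq); rewrite ltnn.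
Qed.

End Numerics.

(** * Recovery off a small event *)

Section Recovery.
Context {R : realType} {d : measure_display} {Omega : measurableType d}.
Variable P : probability Omega R.
Local Notation C := R[i].
Local Notation rp := complex.Re.
Local Notation ip := complex.Im.

Variables (n m : nat) (p : 'I_m -> nat) (G : 'I_m -> set (set Omega))
  (B : forall l : 'I_m, Omega -> 'M[C]_(p l, n)) (S : {set 'I_n}) (Theta L : R).
Hypothesis n0 : (0 < n)%N.
Hypothesis m0 : (0 < m)%N.
Hypothesis T0 : 0 < Theta.
Hypothesis Gm : forall l, G l `<=` measurable.
Hypothesis Gind : mutual_indep P (fun l => <<s G l >>).
Hypothesis Bmeas : forall l i j, csmeas (G l) (fun w => B l w i j).
Hypothesis rows : forall l w i,
  \sum_k cabs ((mx_adj (B l w) *m colS S (B l w)) i k) <= Theta.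
Hypothesis Bint : forall l i j, Cintegrable P (fun w => (mx_adj (B l w) *m B l w) i j).
Hypothesis iso : (m%:R^-1 : C) *: \sum_(l < m) Emx P (fun w => mx_adj (B l w) *m B l w) = 1%:M.
Hypothesis L32 : 3 / 2 <= L.
Hypothesis mL : 82 * Theta * L ^+ 2 <= m%:R.
Variable gA : set (set Omega).
Hypothesis gAm : gA `<=` measurable.
Hypothesis GgA : forall l, G l `<=` <<s gA >>.

Local Notation s := #|S|.
Local Notation Xl := (Xl B S).
Let A w : 'M[C]_(_, n) := Complex (Num.sqrt (m%:R : R))^-1 0 *: \mxcol_(l < m) B l w.

Let L0 : 0 < L. Proof. by apply: lt_le_trans L32; lra. Qed.
Let mR : 0 < m%:R :> R. Proof. by rewrite ltr0n. Qed.

Let b_le : Theta / m%:R * (82 * L ^+ 2) <= 1.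
Proof. by rewrite mulrAC ler_pdivrMr // mul1r mulrA (mulrC Theta). Qed.

Let b_ge0 : 0 <= Theta / m%:R. Proof. by rewrite divr_ge0 // ltW. Qed.

Variable q : nat.
Hypothesis qL : L <= q.+1%:R <= L + 1.

Definition bad_gram := [set w | 4^-1 ^+ q.+1 <= \tr (Ydev Xl w ^+ (q.+1 + q.+1))].

Lemma prb_bad_gram : prb P bad_gram <= 2 * n%:R * expR (- L).
Proof.
have [qL1 qL2] := andP qL.
have hb : (q.+1 + q.+1)%:R * (Theta / m%:R) <= 28^-1.
  rewrite natrD; have := b_le; have := b_ge0; move: (Theta / m%:R) => b b0 hb.
  have h1 : (q.+1%:R + q.+1%:R) * b <= 2 * (L + 1) * b by rewrite ler_wpM2r //; lra.
  (* [56 = 2 * 28]: the exponent is at most [2 (L + 1)], and the moment recursion asks for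
     [1/28]. *)
  have h2 : 56 * (L + 1) <= 82 * L ^+ 2.
    by have := ler_wpM2r (ltW L0) L32; rewrite -expr2; have := L32; lra.
  have h3 := ler_wpM2l b0 h2.
  have h4 : 2 * (L + 1) * b = 28^-1 * (b * (56 * (L + 1))) by field.
  by apply: le_trans h1 _; rewrite h4; move: h3 hb; lra.
have := gram_deviation m0 T0 Gm Gind Bmeas rows Bint iso hb.
move=> h; apply: le_trans h _; apply: ler_pM => //.
- rewrite natrD -mulr2n -[X in X <= _]mulr_natl ler_pM2l // ler_nat.
  by rewrite -[X in (_ <= X)%N](card_ord n) max_card.
- exact: inv3_le_expR.
Qed.

(* Large enough for [3/2 L / lam] to be a useful bound on the columns, small enough for
   the variance [lam^2 Theta / m <= 25 L / 82] to cost less than [L / 2] in the exponent. *)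
Definition lam : R := 5 * L * Num.sqrt L.

Lemma lam_ge0 : 0 <= lam.
Proof. by rewrite mulr_ge0 ?sqrtr_ge0 // mulr_ge0 // ltW. Qed.

Lemma sqr_lam : lam ^+ 2 = 25 * L ^+ 3.
Proof. by rewrite exprMn sqr_sqrtr ?ltW //; ring. Qed.

(** As [L >= 1], [lam <= 5 L^2], so the left side is at most [80 L^2 Theta / m]. Here the constant
    82 is nearly exhausted. *)
Lemma lam_small : 16 * lam * (Theta / m%:R) <= 1.
Proof.
have h : lam <= 5 * L ^+ 2.
  rewrite expr2 mulrA ler_wpM2l //; first by rewrite mulr_ge0 // ltW.
  have e : L = Num.sqrt (L ^+ 2) by rewrite sqrtr_sqr ger0_norm // ltW.
  rewrite [X in _ <= X]e ler_wsqrtr //.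
  by rewrite expr2; have := L32; nra.
have h2 := ler_wpM2r b_ge0 h; have := b_le; move: h2.
by have := sqr_ge0 L; have := b_ge0; move: (L ^+ 2) (Theta / m%:R) => x b b0 x0; nra.
Qed.

Definition col_sum j w : 'cV[C]_s := (m%:R^-1 : C) *: \sum_l xiB B S l j w.

Definition bad_column j := [set w | j \notin S /\ 3 / 2 * L <= nrm (lam *: rvec (col_sum j w))].

Lemma smeas_col_sum j i : smeas gA (fun w => rvec (col_sum j w) i 0).
Proof.
have mxi l k : csmeas gA (fun w => xiB B S l j w k 0).
  under [X in csmeas _ X]funext do rewrite xiBE.
  apply: csmeasJ; have [h1 h2] := gramB_meas Bmeas l j k.
  by split; apply: (smeas_mono (@GgA l)).
have ms k : csmeas gA (fun w => col_sum j w k 0).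
  under [X in csmeas _ X]funext do rewrite mxE summxE.
  by apply: csmeasM; [exact: csmeas_cst|exact: csmeas_sum].
case: (split_ordP i) => k ->.
  by under [X in smeas _ X]funext do rewrite rvecEu; case: (ms k).
by under [X in smeas _ X]funext do rewrite rvecEd; case: (ms k).
Qed.

Lemma gA_measurable E : <<s gA >> E -> measurable E.
Proof. by apply: smallest_sub => //; exact: sigma_algebra_measurable. Qed.

Lemma smeas_nrm_cV N (z : Omega -> 'cV[R]_N) : (forall i, smeas gA (fun w => z w i 0)) ->
  smeas gA (fun w => nrm (z w)).
Proof.
move=> mz; apply: smeas_sqrt; first by move=> w; exact: fro_ge0.
under [X in smeas _ X]funext do rewrite fro_cV.
by apply: smeas_sum => i _; apply: smeasM.
Qed.

Lemma bad_column_meas j : <<s gA >> (bad_column j).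
Proof.
have h : <<s gA >> [set w | 3 / 2 * L <= nrm (lam *: rvec (col_sum j w))].
  apply: smeas_ge; apply: smeas_nrm_cV => i.
  under [X in smeas _ X]funext do rewrite mxE.
  by apply: smeasM; [exact: smeas_cst|exact: smeas_col_sum].
have [jS|jS] := boolP (j \in S).
  rewrite (_ : bad_column j = set0); first exact: (@measurable0 _ (g_sigma_algebraType gA)).
  by apply/seteqP; split => // w []; rewrite jS.
rewrite (_ : bad_column j = [set w | 3 / 2 * L <= nrm (lam *: rvec (col_sum j w))]) //.
by apply/seteqP; split => w //= [].
Qed.

Lemma prb_bad_column j : prb P (bad_column j) <= 2 * expR (- L).
Proof.
have [jS|jS] := boolP (j \in S).
  rewrite (_ : bad_column j = set0); first by rewrite /prb measure0 mulr_ge0 ?expR_ge0.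
  by apply/seteqP; split => // w []; rewrite jS.
have t0 : 0 <= 3 / 2 * L by rewrite mulr_ge0 // ltW.
have h := column_deviation m0 T0 Gm Gind Bmeas rows Bint iso j lam_ge0 lam_small t0.
have -> : bad_column j = [set w | 3 / 2 * L <= nrm (\sum_l Zl P B S j lam l w)].
  apply/seteqP; split => w /=.
    by rewrite (sum_Zl m0 Gm Bmeas rows iso jS) => -[].
  by rewrite (sum_Zl m0 Gm Bmeas rows iso jS).
apply: le_trans h _; rewrite ler_pM2l // ler_expR sqr_lam.
have -> : 25 * L ^+ 3 * (Theta / m%:R) = 25 * L * (Theta / m%:R * L ^+ 2) by ring.
have h2 : Theta / m%:R * L ^+ 2 <= 82^-1 by have := b_le; lra.
have := ler_wpM2l (mulr_ge0 (ler0n R 25) (ltW L0)) h2; have := L0; lra.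
Qed.

(* The inverse Gram matrix is written through the adjugate to make it a measurable
   function of [w]. *)
Definition Tmx w : 'M[R]_(s + s) := Ydev Xl w + 1%:M.
Definition coefR j w : 'cV[R]_(s + s) :=
  (\det (Tmx w))^-1 *: (\adj (Tmx w) *m rvec (col_sum j w)).
Definition coef j w : 'cV[C]_s := \col_k (coefR j w (lshift s k) 0 +i* coefR j w (rshift s k) 0)%C.

Lemma rvec_coef j w : rvec (coef j w) = coefR j w.
Proof.
apply/matrixP => i k; rewrite (ord1 k); case: (split_ordP i) => i' ->.
  by rewrite rvecEu mxE.
by rewrite rvecEd mxE.
Qed.

Lemma TmxE w : Tmx w = rmx (mx_adj (colS S (A w)) *m colS S (A w)).
Proof.
rewrite /Tmx /Ydev subrK gram_stacked //.
have minv : (m%:R^-1 : C) = (m%:R^-1 +i* 0)%C.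
  have mC : m%:R != 0 :> C by rewrite natC; apply/eqP => -[/eqP]; rewrite gt_eqF.
  apply: (mulfI mC); rewrite mulfV // natC.
  apply: complex_eq; rewrite ?(rpM, ipM) /=; last by ring.
  by rewrite mulfV ?mulr0 ?subr0 // gt_eqF.
apply/matrixP => i k; rewrite summxE.
case: (split_ordP i) => i' ->; case: (split_ordP k) => k' ->.
- rewrite block_mxEul mxE mxE minv rpM /= mul0r subr0 summxE rp_sum mulr_sumr.
  by apply: eq_bigr => l _; rewrite mxE block_mxEul mxE.
- rewrite block_mxEur mxE mxE mxE minv ipM /= mul0r addr0 summxE ip_sum -mulrN -sumrN mulr_sumr.
  by apply: eq_bigr => l _; rewrite mxE block_mxEur mxE mxE.
- rewrite block_mxEdl mxE mxE minv ipM /= mul0r addr0 summxE ip_sum mulr_sumr.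
  by apply: eq_bigr => l _; rewrite mxE block_mxEdl mxE.
- rewrite block_mxEdr mxE mxE minv rpM /= mul0r subr0 summxE rp_sum mulr_sumr.
  by apply: eq_bigr => l _; rewrite mxE block_mxEdr mxE.
Qed.

(** The level [4^-1 ^+ q.+1] is [delta ^+ (2 * q.+1)] for [delta = 1/2]. *)
Let good_contraction w : ~ bad_gram w ->
  forall u : 'cV[R]_(s + s), fro (Ydev Xl w *m u) (Ydev Xl w *m u) <= 4^-1 * fro u u.
Proof.
move=> /negP; rewrite /bad_gram /= -ltNge => good1 u.
have -> : 4^-1 = 2^-1 ^+ 2 :> R by rewrite expr2; lra.
apply: (@power_contraction _ _ _ q) => //.
  by apply: Ydev_sym => l w'; exact: Xl_sym.
apply: le_trans (ltW good1) _; rewrite addnn -mul2n exprM.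
by have -> : 4^-1 = 2^-1 ^+ 2 :> R by rewrite expr2; lra.
Qed.

Lemma good_unitmx w : ~ bad_gram w -> mx_adj (colS S (A w)) *m colS S (A w) \in unitmx.
Proof.
move=> /good_contraction hY.
apply: unitmx_of_injective => u hu; apply: rvec_eq0; apply: fro_eq0.
have : Tmx w *m rvec u = 0.
  rewrite TmxE -rvecM hu; apply/matrixP => i k; rewrite (ord1 k).
  by case: (split_ordP i) => i' ->; rewrite ?rvecEu ?rvecEd !mxE.
rewrite /Tmx mulmxDl mul1mx => /eqP; rewrite addr_eq0 => /eqP e.
have := hY (rvec u); rewrite e froNl froNr opprK => h.
by apply/le_anti; rewrite fro_ge0 andbT; lra.
Qed.

(** Off [bad_column] the column has [|v|^2 <= (9/4) L^2 / (25 L^3)]; inversion costs a factor 4,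
    giving [9 / (25 L)], which is rounded up to [2 / (5 L)]. *)
Lemma good_coef j w : j \notin S -> ~ bad_gram w -> ~ bad_column j w ->
  mx_adj (colS S (A w)) *m colS S (A w) *m coef j w = mx_adj (colS S (A w)) *m col j (A w) /\
  \sum_k cabs (coef j w k 0) ^+ 2 <= 2 / 5 / L.
Proof.
move=> jS /good_contraction hY good2.
have [Tc cb] := near_identity_inverse (rvec (col_sum j w)) hY.
rewrite -/(Tmx w) -/(coefR j w) in Tc cb.
split.
- have inj (y z : 'cV[C]_s) : rvec y = rvec z -> y = z.
    move=> /eq_col_mx[h1 h2]; apply/matrixP => i k; rewrite (ord1 k); apply: complex_eq.
      by have := congr1 (fun M : 'cV[R]_s => M i 0) h1; rewrite !mxE.
    by have := congr1 (fun M : 'cV[R]_s => M i 0) h2; rewrite !mxE.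
  apply: inj; rewrite rvecM -TmxE rvec_coef Tc; congr rvec.
  by rewrite column_stacked.
rewrite -fro_rvec_sqr rvec_coef; apply: le_trans cb _.
have : nrm (lam *: rvec (col_sum j w)) < 3 / 2 * L.
  by rewrite ltNge; apply/negP => h; apply: good2.
move=> h; have : nrm (lam *: rvec (col_sum j w)) ^+ 2 <= (3 / 2 * L) ^+ 2.
  by rewrite lerXn2r ?nnegrE ?nrm_ge0 ?(ltW h) // mulr_ge0 // ltW.
rewrite sqr_nrm froZl froZr mulrA -expr2 sqr_lam.
have L2 : 0 < L ^+ 2 by rewrite exprn_gt0.
have -> : 25 * L ^+ 3 = L ^+ 2 * (25 * L) by ring.
have -> : (3 / 2 * L) ^+ 2 = L ^+ 2 * (9 / 4) by field.
rewrite -(mulrA (L ^+ 2)) ler_pM2l // => hv.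
rewrite ler_pdivlMr; last exact: L0.
move: hv; move: (fro _ _) => F; lra.
Qed.

Lemma smeas_coefR j i : smeas gA (fun w => coefR j w i 0).
Proof.
have mT i' k' : smeas gA (fun w => Tmx w i' k').
  under [X in smeas _ X]funext do rewrite /Tmx /Ydev subrK summxE.
  apply: smeas_sum => l _; have [h _] := Xl_meas Bmeas rows l i' k'.
  exact: (smeas_mono (@GgA l) h).
under [X in smeas _ X]funext do rewrite mxE.
apply: smeasM; first by apply: smeas_inv; apply: smeas_det.
apply: smeas_mulmx => [i' k'|i' k']; first exact: smeas_adj.
by rewrite (ord1 k'); exact: smeas_col_sum.
Qed.

Lemma csmeas_coef j k : csmeas gA (fun w => coef j w k 0).
Proof.
by split; under [X in smeas _ X]funext do rewrite mxE /=; exact: smeas_coefR.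
Qed.

Lemma bad_gram_meas : <<s gA >> bad_gram.
Proof.
apply: smeas_ge; have bY : bmx gA (Ydev Xl).
  apply: bmxB; last exact: bmx_cst.
  apply: bmx_sum => l _; apply: bmx_mono (Xl_meas Bmeas rows l); exact: GgA.
by have [] := bmeas_tr (bmxX (q.+1 + q.+1) bY).
Qed.

Section Signs.
Variables (K : finType) (flip : K -> K) (g : K -> C) (sg : Omega -> 'I_n -> C)
  (E : {ffun 'I_s -> K} -> set Omega).
Hypothesis grid : sign_grid P (S := S) sg (10 * n%:R)^-1 flip g E.
Hypothesis indA : indep P <<s sign_gens S sg >> <<s gA >>.

Definition bad_sign j (k : {ffun 'I_s -> K}) := [set w | j \notin S /\
  ~ bad_gram w /\ ~ bad_column j w /\
  9 / 10 <= cabs (\sum_i conjc (coef j w i 0) * g (k i))].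

Lemma bad_sign_meas j k : <<s gA >> (bad_sign j k).
Proof.
pose T := g_sigma_algebraType gA.
have -> : bad_sign j k = (if j \notin S then setT else set0) `&` (~` bad_gram `&` (~` bad_column j `&`
    [set w | 9 / 10 <= cabs (\sum_i conjc (coef j w i 0) * g (k i))])).
  apply/seteqP; split => [w [jS [h1 [h2 h3]]]|w]; first by rewrite jS.
  by case: ifP => [jS [_ [h1 [h2 h3]]]|_ []].
apply: (@measurableI _ T).
  by case: ifP => _; [exact: (@measurableT _ T)|exact: (@measurable0 _ T)].
apply: (@measurableI _ T); first by apply: (@measurableC _ T); exact: bad_gram_meas.
apply: (@measurableI _ T); first by apply: (@measurableC _ T); exact: bad_column_meas.
apply: smeas_ge; apply: smeas_cabs; apply: csmeas_sum => i.
by apply: csmeasM; [apply: csmeasJ; exact: csmeas_coef|exact: csmeas_cst].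
Qed.

Lemma prb_bad_sign j : \sum_k prb P (E k `&` bad_sign j k) <= 2 * expR (- L).
Proof.
have [[flipK gflip] g1 _ _ _] := grid.
apply: (sign_union_bound grid gAm indA) => [k|w]; first exact: bad_sign_meas.
have [[jS h1 h2]|nb] := pselect [/\ j \notin S, ~ bad_gram w & ~ bad_column j w]; last first.
  rewrite big1 ?mulr_ge0 ?ler0n ?expR_ge0 // => k _; rewrite indicE memNset //.
  by move=> [jS [h1 [h2 _]]]; apply: nb.
have [_ hc] := good_coef jS h1 h2.
(* [2 * L] as parameter of the tail: the exponent is at most [(2 L)^2 (2 / (5 L)) / 2 - 2 L (9/10) =
   - L]. *)
have L2 : 0 <= 2 * L by rewrite mulr_ge0 // ltW.
have := sign_tail flipK gflip g1 (fun i => conjc (coef j w i 0)) L2 (_ : 0 <= 9 / 10 :> R).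
move=> /(_ _); have p910 : 0 <= 9 / 10 :> R by lra.
move=> /(_ p910) h.
apply: (@le_trans _ _ (\sum_(k : {ffun 'I_s -> K}) (9 / 10 <= cabs (\sum_i conjc (coef j w i 0) * g (k i)))%R%:R)).
  apply: ler_sum => k _; rewrite indicE; case: (boolP (w \in _)) => [|_]; last exact: ler0n.
  by rewrite inE => -[_ [_ [_ ->]]].
apply: le_trans h _; rewrite ler_wpM2l ?ler0n // ler_pM2l // ler_expR.
under eq_bigr do rewrite cabsJ.
have LL : 0 < L by exact: L0.
have h5 : \sum_k cabs (coef j w k 0) ^+ 2 * L <= 2 / 5.
  by rewrite -mulr_suml -ler_pdivlMr.
have h6 := ler_wpM2l (ltW LL) h5; rewrite -mulr_suml in h6.
move: h6; move: (\sum_k _) => Q; rewrite expr2; lra.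
Qed.

(** Each coefficient has modulus at most 1 and each sign is within [1 / (10 n)] of its grid point,
    so at most [n] terms add at most 1/10 to a sum strictly below 9/10. *)
Lemma good_signs w k j : j \notin S -> E k w -> ~ bad_gram w -> ~ bad_column j w ->
  ~ bad_sign j k w -> cabs (\sum_i conjc (coef j w i 0) * sg w (enum_val i)) < 1.
Proof.
move=> jS Ek h1 h2 h3; have [_ _ _ _ close] := grid.
have [_ hc] := good_coef jS h1 h2.
have small : cabs (\sum_i conjc (coef j w i 0) * g (k i)) < 9 / 10.
  by rewrite ltNge; apply/negP => h; apply: h3.
have c1 i : cabs (coef j w i 0) <= 1.
  rewrite -(@ler_pXn2r _ 2) ?nnegrE ?cabs_ge0 // expr1n.
  apply: le_trans (_ : 2 / 5 / L <= 1); last by rewrite ler_pdivrMr ?L0 // mul1r; have := L32; lra.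
  apply: le_trans hc; rewrite (bigD1 i) //= lerDl; apply: sumr_ge0 => i' _; exact: sqr_ge0.
have -> : \sum_i conjc (coef j w i 0) * sg w (enum_val i) =
   \sum_i conjc (coef j w i 0) * g (k i) +
   \sum_i conjc (coef j w i 0) * (sg w (enum_val i) - g (k i)).
  by rewrite -big_split; apply: eq_bigr => i _ /=; rewrite -mulrDr addrC subrK.
apply: le_lt_trans (le_cabsD _ _) _.
have nR : 0 < n%:R :> R by rewrite ltr0n.
have : cabs (\sum_i conjc (coef j w i 0) * (sg w (enum_val i) - g (k i))) <= 10^-1.
  apply: le_trans (le_cabs_sum _ _ _) _.
  apply: (@le_trans _ _ (\sum_(i < s) (10 * n%:R)^-1)).
    apply: ler_sum => i _; rewrite cabsM cabsJ -[X in _ <= X]mul1r.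
    by apply: ler_pM => //; rewrite ?cabs_ge0 //; exact: close.
  rewrite sumr_const card_ord -[X in X <= _]mulr_natl invfM mulrCA -[X in _ <= X]mulr1.
  rewrite ler_wpM2l // ler_pdivrMr // mul1r ler_nat.
  by rewrite -[X in (_ <= X)%N](card_ord n) max_card.
lra.
Qed.

Definition bad_event : set Omega := bad_gram `|` (\bigcup_j bad_column j `|`
  (\bigcup_j \bigcup_k (E k `&` bad_sign j k) `|` ~` \bigcup_k E k)).

Hypothesis sgm : sign_gens S sg `<=` measurable.

Let mE k : measurable (E k).
Proof.
have [_ _ h _ _] := grid; have := (h k).1.
by apply: smallest_sub => //; exact: sigma_algebra_measurable.
Qed.

Let mES j k : measurable (E k `&` bad_sign j k).
Proof. by apply: measurableI => //; apply: gA_measurable; exact: bad_sign_meas. Qed.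

Let mUE : measurable (\bigcup_k E k).
Proof. by apply: fin_bigcup_measurable. Qed.

Let mUS j : measurable (\bigcup_k (E k `&` bad_sign j k)).
Proof. by apply: fin_bigcup_measurable => // k _; exact: mES. Qed.

Let mUC : measurable (\bigcup_j bad_column j).
Proof. by apply: fin_bigcup_measurable => // j _; apply: gA_measurable; exact: bad_column_meas. Qed.

Let mUUS : measurable (\bigcup_j \bigcup_k (E k `&` bad_sign j k)).
Proof. by apply: fin_bigcup_measurable => // j _; exact: mUS. Qed.

Let mG : measurable bad_gram.
Proof. by apply: gA_measurable; exact: bad_gram_meas. Qed.

Lemma bad_event_measurable : measurable bad_event.
Proof. by do ! apply: measurableU => //; exact: measurableC. Qed.

Lemma prb_bad_event : prb P bad_event <= 6 * n%:R * expR (- L).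
Proof.
have mC : measurable (~` \bigcup_k E k) by exact: measurableC.
have h0 : prb P (~` \bigcup_k E k) = 0.
  by rewrite prb_setC //; case: grid => _ _ _ -> _; rewrite subrr.
have h1 : prb P (\bigcup_j bad_column j) <= 2 * n%:R * expR (- L).
  apply: le_trans (prb_bigcup_le P _) _.
    by move=> j; apply: gA_measurable; exact: bad_column_meas.
  apply: le_trans (ler_sum _ (fun j _ => prb_bad_column j)) _.
  by rewrite sumr_const card_ord -[X in X <= _]mulr_natl mulrA (mulrC n%:R).
have h2 : prb P (\bigcup_j \bigcup_k (E k `&` bad_sign j k)) <= 2 * n%:R * expR (- L).
  apply: le_trans (prb_bigcup_le P _) _; first exact: mUS.
  apply: (@le_trans _ _ (\sum_(j < n) 2 * expR (- L))).
    apply: ler_sum => j _; apply: le_trans (prb_bigcup_le P _) _; first exact: mES.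
    exact: prb_bad_sign.
  by rewrite sumr_const card_ord -[X in X <= _]mulr_natl mulrA (mulrC n%:R).
have h3 := prb_bad_gram.
have m1 := measurableU _ _ mUUS mC; have m2 := measurableU _ _ mUC m1.
have := prb_setU_le P mG m2; have := prb_setU_le P mUC m1; have := prb_setU_le P mUUS mC.
rewrite h0 /bad_event; lra.
Qed.

Lemma good_event_recovery (x : Omega -> 'cV[C]_n) w :
  (forall i, i \notin S -> x w i 0 = 0) -> (forall i, sg w i = csgn (x w i 0)) ->
  ~ bad_event w -> BP_unique_minimizer (A w) (x w).
Proof.
move=> xS sgE /not_orP[h1 /not_orP[h2 /not_orP[h3 h4]]].
have [k Ek] : exists k, E k w by apply: contrapT => h; apply: h4 => -[k _ Ek]; apply: h; exists k.
have h2' j : ~ bad_column j w by move=> hj; apply: h2; exists j.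
have h3' j : ~ bad_sign j k w by move=> hj; apply: h3; exists j => //; exists k.
apply: (@certificate_unique_minimizer _ _ _ _ S _ (fun j => coef j w)) => //.
- exact: good_unitmx.
- by move=> j jS'; case: (good_coef jS' h1 (h2' j)).
move=> j jS'; have := good_signs jS' Ek h1 (h2' j) (h3' j).
by under eq_bigr do rewrite sgE.
Qed.

End Signs.

End Recovery.

(** * Truncation *)

Section Truncation.
Context {R : realType} {d : measure_display} {Omega : measurableType d}.
Variable P : probability Omega R.
Local Notation C := R[i].
Local Notation rp := complex.Re.
Local Notation ip := complex.Im.

Lemma smeas_of_measurable (f : Omega -> R) : measurable_fun setT f -> smeas measurable f.
Proof.
move=> mf _ B mB; rewrite setTI; apply: sub_sigma_algebra.
by have := mf measurableT B mB; rewrite setTI.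
Qed.

(** The convention for division by zero makes the coordinate formula hold at 0 too, so measurability
    needs no case distinction. *)
Lemma csgnE (z : C) : csgn z = (rp z / cabs z +i* (ip z / cabs z))%C.
Proof.
rewrite /csgn; case: eqP => [->|/eqP z0]; first by rewrite /= !mul0r.
have cz : cabs z != 0 by apply: contra z0 => /eqP /cabs_eq0 ->.
have cC : (cabs z +i* 0)%C != 0 :> C by apply/eqP => -[h]; rewrite h eqxx in cz.
apply: (mulIf cC); rewrite divfK //.
by apply: complex_eq; rewrite ?(rpM, ipM) /= ?mulr0 ?subr0 ?add0r ?divfK.
Qed.

Lemma csgn_measurable (f : Omega -> C) : Cmeasurable f -> Cmeasurable (fun w => csgn (f w)).
Proof.
move=> [mr mi]; have cm : csmeas measurable f by split; exact: smeas_of_measurable.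
have mc := smeas_cabs cm; have [sr si] := cm.
split; apply: (smeas_measurable (g := measurable)) => //.
  by under [X in smeas _ X]funext do rewrite csgnE /=; apply: smeasM => //; exact: smeas_inv.
by under [X in smeas _ X]funext do rewrite csgnE /=; apply: smeasM => //; exact: smeas_inv.
Qed.

Variables (n : nat) (p : nat) (B : Omega -> 'M[C]_(p, n)) (S : {set 'I_n}) (Theta : R).
Variable G : set (set Omega).
Hypothesis Gm : G `<=` measurable.
Hypothesis T0 : 0 < Theta.
Hypothesis Bm : forall i j, csmeas G (fun w => B w i j).

Definition row_bounded : set Omega :=
  [set w | forall i, \sum_k cabs ((mx_adj (B w) *m colS S (B w)) i k) <= Theta].

(** The whole block is replaced by 0 where its own row bound fails. The cut depends on the block
    alone, so it stays measurable for [G] and independence is kept; it acts on a null event, so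
    isotropy survives. *)
Definition truncate w : 'M[C]_(p, n) := if `[< row_bounded w >] then B w else 0.

Lemma row_bounded_meas : <<s G >> row_bounded.
Proof.
have -> : row_bounded = \bigcap_(i in [set: 'I_n])
    [set w | \sum_k cabs ((mx_adj (B w) *m colS S (B w)) i k) <= Theta].
  by apply/seteqP; split => [w h i _|w h i]; [exact: h|exact: (h i I)].
apply: (@fin_bigcap_measurable _ (g_sigma_algebraType G)) => // i _.
apply: smeas_le; apply: smeas_sum => k _; apply: smeas_cabs.
by apply: csmeas_mulmx => i' j'; [exact: csmeas_adj|exact: csmeas_colS].
Qed.

Lemma row_bounded_measurable : measurable row_bounded.
Proof.
have := row_bounded_meas; apply: smallest_sub => //; exact: sigma_algebra_measurable.
Qed.

Lemma truncate_true w : row_bounded w -> truncate w = B w.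
Proof. by move=> h; rewrite /truncate; case: asboolP. Qed.

Lemma indic_if (D : set Omega) w : (\1_D w : R) = if `[< D w >] then 1 else 0.
Proof.
rewrite indicE; case: asboolP => h; first by rewrite mem_set.
by rewrite memNset.
Qed.

Lemma truncate_meas i j : csmeas G (fun w => truncate w i j).
Proof.
have [mr mi] := Bm i j; have mD := smeas_indic row_bounded_meas.
split.
  rewrite (_ : (fun w => _) = fun w => \1_row_bounded w * rp (B w i j)); first exact: smeasM.
  apply/funext => w; rewrite indic_if /truncate; case: asboolP => _; rewrite ?mul1r ?mul0r //.
  by rewrite mxE.
rewrite (_ : (fun w => _) = fun w => \1_row_bounded w * ip (B w i j)); first exact: smeasM.
apply/funext => w; rewrite indic_if /truncate; case: asboolP => _; rewrite ?mul1r ?mul0r //.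
by rewrite mxE.
Qed.

Lemma truncate_rows w i :
  \sum_k cabs ((mx_adj (truncate w) *m colS S (truncate w)) i k) <= Theta.
Proof.
rewrite /truncate; case: asboolP => [h|_]; first exact: h.
rewrite big1 ?ltW // => k _.
by rewrite /colS mul0mx mulmx0 mxE cabs0.
Qed.

Lemma row_bounded_ae :
  {ae P, forall w, norm_inf_inf (mx_adj (B w) *m colS S (B w)) <= Theta} ->
  prb P (~` row_bounded) = 0.
Proof.
move=> h; apply: prb_ae; first exact: row_bounded_measurable.
apply: filterS h => w h i; apply: le_trans h.
exact: (le_bigmax _ (fun i => \sum_k cabs ((mx_adj (B w) *m colS S (B w)) i k)) i).
Qed.

Hypothesis hD : prb P (~` row_bounded) = 0.

Lemma truncate_gram i j : Cintegrable P (fun w => (mx_adj (B w) *m B w) i j) ->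
  Cintegrable P (fun w => (mx_adj (truncate w) *m truncate w) i j) /\
  Cexpect P (fun w => (mx_adj (truncate w) *m truncate w) i j) =
  Cexpect P (fun w => (mx_adj (B w) *m B w) i j).
Proof.
move=> [ir ii].
have [ir' er] := Rexpect_ae_indic row_bounded_measurable hD ir.
have [ii' ei] := Rexpect_ae_indic row_bounded_measurable hD ii.
have e (f : C -> R) : f 0 = 0 -> (fun w => f ((mx_adj (truncate w) *m truncate w) i j)) =
    fun w => \1_row_bounded w * f ((mx_adj (B w) *m B w) i j).
  move=> f0; apply/funext => w; rewrite indic_if /truncate; case: asboolP => _.
    by rewrite mul1r.
  by rewrite mulmx0 mxE f0 mul0r.
have e1 := e (fun z : C => rp z) erefl; have e2 := e (fun z : C => ip z) erefl.
split; first by split; rewrite ?e1 ?e2.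
by rewrite /Cexpect e1 e2 er ei.
Qed.

End Truncation.

(** * Recovery for the original blocks, off the null event of truncation *)

Unset Implicit Arguments.
Set Strict Implicit.
Set Printing Implicit Defensive.

Theorem mainTheorem2 (R : realType) (d : measure_display) (Omega : measurableType d)
    (P : probability Omega R)
    (n m : nat) (p : 'I_m -> nat)
    (B : forall l : 'I_m, Omega -> 'M[R[i]]_(p l, n))
    (S : {set 'I_n}) (x : Omega -> 'cV[R[i]]_n) (x_is_real : bool)
    (Theta eps : R) :
  (0 < n)%N -> (0 < m)%N -> (forall l, 0 < p l)%N ->
  (* B_1, ..., B_m are independent random matrices *)
  (forall l, mx_measurable (B l)) ->
  mutual_indep P (fun l => sigma_mx (B l)) ->
  (* isotropy: E(A^* A) = (1/m) sum_l E(B_l^* B_l) = Id_n *)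
  (forall l i j, Cintegrable P (fun w => (mx_adj (B l w) *m B l w) i j)) ->
  (m%:R^-1 : R[i]) *: \sum_(l < m) Emx P (fun w => mx_adj (B l w) *m B l w)
    = 1%:M ->
  (* Theta = Theta(S, F) *)
  0 < Theta ->
  (forall l, {ae P, forall w, norm_inf_inf (mx_adj (B l w) *m colS S (B l w)) <= Theta}) ->
  (* x is a random vector supported on S *)
  mx_measurable x ->
  (forall w i, i \notin S -> x w i 0 = 0) ->
  (x_is_real -> forall w i, complex.Im (x w i 0) = 0) ->
  (* random sign assumption *)
  (if x_is_real then rademacher P S (fun w i => csgn (x w i 0))
   else steinhaus P S (fun w i => csgn (x w i 0))) ->
  indep P
    (gen_sigma (\bigcup_(i in [set i | i \in S]) Ccoords (fun w => csgn (x w i 0))))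
    (gen_sigma (\bigcup_(l in [set: 'I_m])
                  \bigcup_(kj in [set: 'I_(p l) * 'I_n])
                     Ccoords (fun w => B l w kj.1 kj.2))) ->
  0 < eps < 1 ->
  82 * Theta * (ln (6 * n%:R / eps)) ^+ 2 <= m%:R ->
  (* with probability at least 1 - eps, x is the unique minimizer of (BP) for y = A x *)
  exists E : set Omega,
    [/\ measurable E,
        E `<=` [set w | BP_unique_minimizer
                  ((Complex (Num.sqrt (m%:R : R))^-1 0) *: \mxcol_(l < m) B l w) (x w)]
      & 1 - eps <= prb P E].
Proof.
move=> n0 m0 _ mB mi Bint iso T0 Bae mx xS _ signs indx /andP[e0 e1] mL.
set L := ln _ in mL.
have nR : 0 < n%:R :> R by rewrite ltr0n.
have arg0 : 0 < 6 * n%:R / eps by rewrite divr_gt0 // mulr_gt0.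
(* This choice of [L] turns the total cost [6 n exp (- L)] into [eps]. *)
have expL : expR (- L) = eps / (6 * n%:R).
  by rewrite expRN /L lnK ?posrE // invf_div.
have L32 : 3 / 2 <= L.
  apply: le_trans ln6_ge _; rewrite ler_ln ?posrE // ler_pdivlMr //.
  have n1 : 1 <= n%:R :> R by rewrite ler1n.
  lra.
(* The sigma-algebras are those of the original blocks, to which the independence assumptions refer;
   the truncated blocks are measurable for them. *)
pose G l := gens (\bigcup_(ij in [set: 'I_(p l) * 'I_n]) Ccoords (fun w => B l w ij.1 ij.2)).
pose gA := gens (\bigcup_(l in [set: 'I_m]) \bigcup_(kj in [set: 'I_(p l) * 'I_n])
                     Ccoords (fun w => B l w kj.1 kj.2)).
have coordm l i j f : Ccoords (fun w => B l w i j) f -> measurable_fun setT f.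
  by have [h1 h2] := mB l i j; case=> ->.
have Gm l : G l `<=` measurable.
  by apply: gens_measurable => f [ij _]; exact: coordm.
have gAm : gA `<=` measurable.
  by apply: gens_measurable => f [l _ [ij _]]; exact: coordm.
have GgA l : G l `<=` <<s gA >>.
  move=> _ [f [A [[ij _ hf] mA ->]]]; apply: sub_sigma_algebra; exists f, A; split => //.
  by exists l => //; exists ij.
have Bcs l i j : csmeas (G l) (fun w => B l w i j).
  by split; apply: smeas_gens; exists (i, j) => //; [left|right].
pose Bt l := truncate (B l) S Theta.
have Dm l : measurable (row_bounded (B l) S Theta) := row_bounded_measurable S Theta (@Gm l) (Bcs l).
have D0 l : prb P (~` row_bounded (B l) S Theta) = 0 := row_bounded_ae (@Gm l) (Bcs l) (Bae l).
have tg l i j := truncate_gram (@Gm l) (Bcs l) (D0 l) (Bint l i j).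
have Btcs l i j : csmeas (G l) (fun w => Bt l w i j) by exact: (truncate_meas S Theta (Bcs l) i j).
have Btrows l w i : \sum_k cabs ((mx_adj (Bt l w) *m colS S (Bt l w)) i k) <= Theta.
  exact: truncate_rows.
have Btint l i j : Cintegrable P (fun w => (mx_adj (Bt l w) *m Bt l w) i j) by case: (tg l i j).
have Btiso : (m%:R^-1 : R[i]) *: \sum_(l < m) Emx P (fun w => mx_adj (Bt l w) *m Bt l w) = 1%:M.
  rewrite -iso; congr (_ *: _); apply: eq_bigr => l _; apply/matrixP => i j; rewrite mxE [RHS]mxE.
  by case: (tg l i j).
have Gind : mutual_indep P (fun l => <<s G l >>) by exact: mi.
have L0 : 0 < L by apply: lt_le_trans L32; lra.
have [q hq] := nat_ceil L0.
pose sg w i := csgn (x w i 0).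
have sgm : sign_gens S sg `<=` measurable.
  apply: gens_measurable => f [i _]; have [h1 h2] := csgn_measurable (mx i 0).
  by case=> ->.
have eta0 : 0 < (10 * n%:R)^-1 :> R by rewrite invr_gt0 mulr_gt0.
have [K [flip [g [E grid]]]] : exists (K : finType) (flip : K -> K) (g : K -> R[i]) E,
    sign_grid P (S := S) sg (10 * n%:R)^-1 flip g E.
  case: x_is_real signs => h; first exact: (rademacher_grid (@sgm) (ltW eta0) h).
  exact: steinhaus_grid eta0 h.
have indA : indep P <<s sign_gens S sg >> <<s gA >> by exact: indx.
pose bad := bad_event Bt L q g E.
have mbad : measurable bad.
  exact: (bad_event_measurable L Btcs Btrows (@gAm) (fun l => @GgA l) q grid (@sgm)).
have pbad : prb P bad <= 6 * n%:R * expR (- L).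
  exact: (prb_bad_event m0 T0 (fun l => @Gm l) Gind Btcs Btrows Btint Btiso L32 mL (@gAm) (fun l => @GgA l) hq grid indA (@sgm)).
(* Outside this null event the truncated blocks coincide with the original ones, so recovery for the
   former is recovery for the latter. *)
pose bd := \bigcup_l ~` row_bounded (B l) S Theta.
have mbd : measurable bd by apply: fin_bigcup_measurable => // l _; exact: measurableC.
have pbd : prb P bd = 0.
  apply/le_anti; rewrite prb_ge0 andbT; apply: le_trans (prb_bigcup_le P _) _.
    by move=> l; exact: measurableC.
  by rewrite big1.
exists (~` (bad `|` bd)); split.
- by apply: measurableC; exact: measurableU.
- move=> w /= /not_orP[h1 h2].
  have rb l : row_bounded (B l) S Theta w.
    by apply: contrapT => h; apply: h2; exists l.
  have -> : \mxcol_(l < m) B l w = \mxcol_(l < m) Bt l w.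
    by apply: eq_mxcol => l; rewrite /Bt truncate_true.
  exact: (good_event_recovery n0 m0 L32 grid (x := x) (xS w) (fun i => erefl) h1).
- rewrite prb_setC; last exact: measurableU.
  have := prb_setU_le P mbad mbd; rewrite pbd addr0.
  have -> : eps = 6 * n%:R * expR (- L).
    by rewrite expL mulrC divfK // mulf_neq0 // gt_eqF.
  lra.
Qed.
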